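(* Let $X_{\mathcal T}=\{X_t\}_{t\in\mathcal T}$ be a pairwise Gaussian process, in the sense that $(X_s,X_t)$ is a bivariate Gaussian vector for every pair $(s,t)\in\mathcal T\times\mathcal T$. Suppose Assumptions A and B (stated in the context) hold. Then $$\rho^{NL}_{\max}=\rho^{L}_{\max}\quad\text{and}\quad \rho^{NL}_{\min}=\rho^{L}_{\min}.$$
   Context: $\mathcal T$ is an index set equipped with a measure $\nu$, $X_{\mathcal T}=\{X_t,t\in\mathcal T\}$ is a real stochastic process, and $W_{s,t}\ge 0$ is a weight function on $\mathcal T\times\mathcal T$. $\rho(U,V)$ denotes the Pearson correlation of random variables $U,V$, and $\|h\|_{L_2(\nu)}=\{\int_{\mathcal T}h^2(t)\,\nu(dt)\}^{1/2}$. Extreme nonlinear correlations: $$\rho^{NL}_{\max}=\sup_{f_{\mathcal T}\in\mathcal F_{\mathcal T}}\ \sup_{\|h\|_{L_2(\nu)}=1}\int_{t\in\mathcal T}\int_{s\in\mathcal T}\rho\big(f_s(X_s),f_t(X_t)\big)W_{s,t}h(s)h(t)\,\nu(ds)\nu(dt),$$ and $\rho^{NL}_{\min}$ is the same expression with both suprema replaced by infima, where $\mathcal F_{\mathcal T}$ is a class of families $f_{\mathcal T}=\{f_t,t\in\mathcal T\}$ of deterministic functions specified in Assumption B. Extreme linear correlations: $$\rho^{L}_{\max}=\sup_{\|h\|_{L_2(\nu)}=1}\int_{t\in\mathcal T}\int_{s\in\mathcal T}\rho(X_s,X_t)W_{s,t}h(s)h(t)\,\nu(ds)\nu(dt),$$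 and $\rho^{L}_{\min}$ is the same expression with the supremum replaced by an infimum. Assumption A. (i) There exist $B_n\subset B_{n+1}\subset\mathcal T$ such that $\cup_{n\ge1}B_n=\mathcal T$, $\nu(B_n)<\infty$ and $\int_{B_n}\int_{B_n}W_{s,t}^2\,\nu(ds)\nu(dt)<\infty$ for every integer $n\ge1$. (ii) $\mathbb E[X_t]=0$ and $\mathbb E[X_t^2]=1$ for all $t$, $\mathbb E[X_sX_t]$ is measurable as a function of $(s,t)$ in the product space $\mathcal T\times\mathcal T$, and the weight function is nonnegative and symmetric, $W_{s,t}=W_{t,s}\ge0$. (iii) The linear operator $K_W:h\mapsto\int K_W(\cdot,s)h(s)\,\nu(ds)$ in $L_2(\nu)$ with kernel $K_W(s,t)=\mathbb E[X_sX_t]W_{s,t}$ is bounded. Assumption B. $\mathcal F_{\mathcal T}$ is the class of all families $f_{\mathcal T}=\{f_t,t\in\mathcal T\}$ with $\mathbb E[f_t(X_t)]=0$, $\mathbb E[f_t^2(X_t)]>0$ and $\int_{\mathcal T}\mathbb E[f_t^2(X_t)]\,\nu(dt)<\infty$, such that $\mathbb E[X_t^mf_t(X_t)]$ is a measurable function of $t$ on $\mathcal T$ for every integer $m\ge1$, and such that the kernel $K_{W,f_{\mathcal T}}(s,t)=\rho(f_s(X_s),f_t(X_t))W_{s,t}$ is a measurable function of $(s,t)$ on $\mathcal T\times\mathcal T$. *)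

(* Defs.v *)
From HB Require Import structures.
From mathcomp Require Import all_boot all_order all_algebra.
From mathcomp Require Import all_classical all_reals all_analysis.
From mathcomp Require Import measurable_realfun.

Set Implicit Arguments.
Unset Strict Implicit.
Unset Printing Implicit Defensive.

Import Order.TTheory GRing.Theory Num.Theory.
Import numFieldNormedType.Exports.

Local Open Scope classical_set_scope.
Local Open Scope ring_scope.
Local Open Scope ereal_scope.

Section gaussian.
Context {d : measure_display} {Omega : measurableType d} {R : realType}.
Variable P : probability Omega R.

(* Constants count as Gaussian (zero variance).  They need a separate clause
   because [normal_prob m 0] is by convention the uniform law on [0, 1]. *)
Definition gaussian_rv (Z : Omega -> R) : Prop :=
  exists m s : R, (0 <= s)%R /\
    forall A : set R, measurable A ->
      pushforward P Z A = if s == 0%R then \d_m A else normal_prob m s A.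

(* Degenerate vectors are included, e.g. [(U, U)]. *)
Definition bivariate_gaussian (U V : {RV P >-> R}) : Prop :=
  forall a b : R, gaussian_rv (fun w => (a * U w + b * V w)%R).

(* Meaningful for [U], [V] of finite, nonzero variance; the conventions
   [fine +oo = 0] and [x / 0 = 0] give the value 0 if a variance is 0 or +oo. *)
Definition correlation (U V : Omega -> R) : R :=
  (fine (covariance P U V)
     / (Num.sqrt (fine 'V_P[U]) * Num.sqrt (fine 'V_P[V])))%R.

End gaussian.

Section L2.
Context {d : measure_display} {T : measurableType d} {R : realType}.
Variable nu : {measure set T -> \bar R}.

Definition L2_sphere : set (T -> R) :=
  [set h | measurable_fun [set: T] h /\ 'N[nu]_2%:E[EFin \o h] = 1].

Definition kernel_operator (K : T -> T -> R) (h : T -> R) (t : T) : \bar R :=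
  \int[nu]_s (K t s * h s)%:E.

(* The operator is defined on all of L2: for every [h] in L2 the integral
   defining it converges absolutely for almost every [t]. *)
Definition bounded_kernel_operator (K : T -> T -> R) : Prop :=
  exists C : R, forall h : T -> R, h \in Lfun nu 2%:E ->
    {ae nu, forall t, nu.-integrable [set: T] (fun s => (K t s * h s)%:E)} /\
    'N[nu]_2%:E[kernel_operator K h] <= C%:E * 'N[nu]_2%:E[EFin \o h].

End L2.

Section extreme_correlations.
Context {dT : measure_display} {T : measurableType dT}.
Context {d : measure_display} {Omega : measurableType d} {R : realType}.
Variables (nu : {measure set T -> \bar R}) (P : probability Omega R).
Variables (X : T -> {RV P >-> R}) (W : T -> T -> R).

(* Measurability of [W] is implicit in the square-integrability of [W] on the
   sets [B n] x [B n]. *)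
Record regular_process : Prop := {
  rp_exhaustion : exists B : nat -> set T,
    [/\ forall n, measurable (B n),
        forall n, B n `<=` B n.+1,
        \bigcup_n B n = [set: T],
        forall n, nu (B n) < +oo
      & forall n,
          \int[nu]_(t in B n) \int[nu]_(s in B n) (W s t ^+ 2)%:E < +oo] ;
  rp_mean : forall t, 'E_P[X t] = 0 ;
  rp_moment2 : forall t, 'E_P[fun w => (X t w ^+ 2)%R] = 1 ;
  rp_meas_moment : measurable_fun [set: T * T]
    (fun p => 'E_P[fun w => (X p.1 w * X p.2 w)%R] : \bar R) ;
  rp_meas_weight : measurable_fun [set: T * T] (fun p => W p.1 p.2) ;
  rp_weight_ge0 : forall s t, (0 <= W s t)%R ;
  rp_weight_sym : forall s t, W s t = W t s ;
  rp_bounded : bounded_kernel_operator nu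
    (fun s t => (fine 'E_P[fun w => (X s w * X t w)%R] * W s t)%R) }.

(* Integrability of [t |-> E[f_t(X_t)^2]] means that this nonnegative function
   is measurable with finite integral.  It may be infinite on a nu-null set
   of [t]'s. *)
Record admissible_family (f : T -> R -> R) : Prop := {
  af_meas : forall t, measurable_fun [set: R] (f t) ;
  af_mean : forall t, 'E_P[fun w => f t (X t w)] = 0 ;
  af_moment2_gt0 : forall t, 0 < 'E_P[fun w => (f t (X t w) ^+ 2)%R] ;
  af_moment2_int : nu.-integrable [set: T]
    (fun t => 'E_P[fun w => (f t (X t w) ^+ 2)%R]) ;
  af_meas_moment : forall m : nat, (1 <= m)%N -> measurable_fun [set: T]
    (fun t => 'E_P[fun w => (X t w ^+ m * f t (X t w))%R] : \bar R) ;
  af_meas_kernel : measurable_fun [set: T * T]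
    (fun p => (correlation P (f p.1 \o X p.1) (f p.2 \o X p.2)
                 * W p.1 p.2)%R) }.

Definition correlation_form (Y : T -> Omega -> R) (h : T -> R) : \bar R :=
  \int[nu]_t \int[nu]_s
    (correlation P (Y s) (Y t) * W s t * h s * h t)%:E.

Definition nonlinear_form (f : T -> R -> R) (h : T -> R) : \bar R :=
  correlation_form (fun t => f t \o X t) h.

Definition linear_form (h : T -> R) : \bar R :=
  correlation_form (fun t => X t) h.

Definition rhoNL_max : \bar R :=
  ereal_sup [set ereal_sup [set nonlinear_form f h | h in L2_sphere nu]
            | f in admissible_family].

Definition rhoNL_min : \bar R :=
  ereal_inf [set ereal_inf [set nonlinear_form f h | h in L2_sphere nu]
            | f in admissible_family].

Definition rhoL_max : \bar R :=
  ereal_sup [set linear_form h | h in L2_sphere nu].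

Definition rhoL_min : \bar R :=
  ereal_inf [set linear_form h | h in L2_sphere nu].

End extreme_correlations.

(* Main.v *)
(* Expand [f_t (X_t)] in normalized Hermite polynomials, with coefficients
   [a_m t] of unit [l^2] norm and [a_0 t = 0].  By Mehler's formula the
   correlation of [f_s (X_s)] and [f_t (X_t)] is [r s t * G s t], where [r] is the
   correlation of [X_s] and [X_t] and [G s t] is the sum over [m >= 1] of
   [a_m s * a_m t * r s t ^ (m - 1)], a positive semidefinite kernel with unit
   diagonal.  Multiplying the kernel [K = r * W] by such a [G] (a Schur
   multiplier) does not enlarge its numerical range: if
   [G s t = \sum_k w_k s * w_k t], the form of [K * G] at [h] is the sum of the
   forms of [K] at the functions [w_k * h], whose squared norms add up to that of
   [h].  Only measurability of [G] is available, so [G] is first approximated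
   almost everywhere by step kernels of this shape.  Conversely, the linear
   families [f_t x = c t * x] with [c > 0] in [L2 nu] attain the linear extremes. *)
Require Import Defs.
From HB Require Import structures.
From mathcomp Require Import all_boot all_order all_algebra.
From mathcomp Require Import all_classical all_reals all_analysis.
From mathcomp Require Import measurable_realfun.
From mathcomp Require Import ring lra.

Set Implicit Arguments.
Unset Strict Implicit.
Unset Printing Implicit Defensive.

Import Order.TTheory GRing.Theory Num.Theory.
Import numFieldNormedType.Exports.

Local Open Scope classical_set_scope.
Local Open Scope ring_scope.

(** * Positive semidefinite kernels *)

(** The powers of [r] are positive semidefinite and jointly measurable, but without separability
    they need not split, everywhere on the square, into countably many measurable factors. Averaging
    over the cells of a finite partition does give such factors, and it preserves positivity because
    the double integral of a positive semidefinite kernel is nonnegative. It can however lower the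
    diagonal: the kernel equal to 1 on the diagonal and 0 off it has average 0 over atomless cells.
    A unit diagonal is needed for the squared norms to add up, so it is restored by hand, and the
    approximation is made to hold along the diagonal too in order to control the cost. The
    partitions live on a finite measure whose null sets are null for [nu]. Parseval's identity rests
    on the density of polynomials, which comes from the exponential moments of Gaussian laws. *)

Lemma cvg_sumr (R : realType) (I : Type) (r : seq I) (u : I -> nat -> R)
    (a : I -> R) :
  (forall i, u i @ \oo --> a i) ->
  \sum_(i <- r) u i n @[n --> \oo] --> \sum_(i <- r) a i.
Proof. by move=> ua; apply: cvg_big => //; exact: add_continuous. Qed.

Section positive_semidefinite.
Context {R : realType}.

(** Weighted points form a list in which repetitions are allowed, so that lists can be extended,
    mapped or drawn at random without any distinctness condition. *)
Definition psd (T : Type) (G : T -> T -> R) : Prop :=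
  (forall s t, G s t = G t s) /\
  forall l : seq (R * T),
    0 <= \sum_(p <- l) \sum_(q <- l) p.1 * q.1 * G p.2 q.2.

Lemma psd_quadratic (T : Type) (G : T -> T -> R) (a b : R) (s t : T) :
  psd G -> 0 <= a ^+ 2 * G s s + a * b * G s t *+ 2 + b ^+ 2 * G t t.
Proof.
move=> [sG /(_ [:: (a, s); (b, t)])].
rewrite !big_cons !big_nil /= (sG t s) !addr0.
by congr (0 <= _); ring.
Qed.

Lemma psd_diag (T : Type) (G : T -> T -> R) (t : T) : psd G -> 0 <= G t t.
Proof.
by move=> /(psd_quadratic 1 0 t t); rewrite expr1n expr0n /= !mul0r mulr0 !mul0r mul0rn !addr0 mul1r.
Qed.

Lemma psd_eq0 (T : Type) (G : T -> T -> R) (s t : T) :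
  psd G -> G s s = 0 -> G s t = 0.
Proof.
move=> pG Gs0; apply/eqP/negPn/negP => Gst0.
(* With [G s s = 0] the form at weights [(a, 1)] is affine in [a]; this [a] gives it the value
   -1. *)
have := psd_quadratic (- (G t t + 1) / (2 * G s t)) 1 s t pG.
rewrite Gs0 mulr0 add0r mulr1 expr1n mul1r.
have -> : - (G t t + 1) / (2 * G s t) * G s t *+ 2 + G t t = -1.
  by field.
by rewrite oppr_ge0 ler10.
Qed.

Lemma psd_norm_le1 (T : Type) (G : T -> T -> R) (s t : T) :
  psd G -> (forall t, G t t = 1) -> `|G s t| <= 1.
Proof.
move=> pG G1; have := psd_quadratic 1 1 s t pG.
have := psd_quadratic 1 (-1) s t pG.
by rewrite !G1 ler_norml; lra.
Qed.

Lemma psd_rank1 (T : Type) (a : T -> R) : psd (fun s t => a s * a t).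
Proof.
split=> [s t|l]; first by rewrite mulrC.
have -> : \sum_(p <- l) \sum_(q <- l) p.1 * q.1 * (a p.2 * a q.2) =
    (\sum_(p <- l) p.1 * a p.2) ^+ 2.
  rewrite expr2 big_distrl /=; apply: eq_bigr => p _.
  by rewrite big_distrr /=; apply: eq_bigr => q _; ring.
exact: sqr_ge0.
Qed.

Lemma psd0 (T : Type) : psd (fun _ _ : T => 0).
Proof.
split=> // l; apply: sumr_ge0 => p _; apply: sumr_ge0 => q _.
by rewrite mulr0.
Qed.

Lemma psdD (T : Type) (G H : T -> T -> R) :
  psd G -> psd H -> psd (fun s t => G s t + H s t).
Proof.
move=> [sG pG] [sH pH]; split=> [s t|l]; first by rewrite sG sH.
under eq_bigr do (under eq_bigr do rewrite mulrDr; rewrite big_split /=).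
by rewrite big_split /= addr_ge0.
Qed.

Lemma psd_sum (T : Type) (G : nat -> T -> T -> R) (n : nat) :
  (forall i, psd (G i)) -> psd (fun s t => \sum_(i < n) G i s t).
Proof.
move=> pG; elim: n => [|n IH].
  by under eq_fun do under eq_fun do rewrite big_ord0; exact: psd0.
under eq_fun do under eq_fun do rewrite big_ord_recr /=.
exact: psdD.
Qed.

Lemma psd_cvg (T : Type) (G_ : nat -> T -> T -> R) (G : T -> T -> R) :
  (forall n, psd (G_ n)) -> (forall s t, G_ ^~ s ^~ t @ \oo --> G s t) ->
  psd G.
Proof.
move=> pG GG; split=> [s t|l].
  rewrite -(cvg_lim _ (GG s t))// -(cvg_lim _ (GG t s))//.
  by congr (lim (_ @ \oo)); apply/funext => n; exact: (pG n).1.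
have : (fun n => \sum_(p <- l) \sum_(q <- l) p.1 * q.1 * G_ n p.2 q.2) @ \oo
    --> \sum_(p <- l) \sum_(q <- l) p.1 * q.1 * G p.2 q.2.
  by apply: cvg_sumr => p; apply: cvg_sumr => q; apply: cvgMl_tmp.
move=> h; rewrite -(cvg_lim _ h)//; apply: limr_ge; first by apply: cvgP h.
by apply: nearW => n; apply: (pG n).2.
Qed.

(** Minimising the form of [G] over the weight of one extra point [x] leaves the form of this
    kernel; the proof inserts the minimising weight. If [G x x = 0], division by 0 gives 0 and the
    kernel is [G] itself. *)
Lemma psd_schur_complement (T : Type) (G : T -> T -> R) (x : T) :
  psd G -> psd (fun s t => G s t - G s x * G x t / G x x).
Proof.
move=> pG; have [sG qG] := pG; split=> [s t|l].
  by rewrite sG (sG s x) (sG x t) [G x s * _]mulrC.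
have [G0|G0] := eqVneq (G x x) 0.
  under eq_bigr do under eq_bigr do rewrite G0 invr0 mulr0 subr0.
  exact: qG.
pose S := \sum_(p <- l) p.1 * G p.2 x.
pose Q := \sum_(p <- l) \sum_(q <- l) p.1 * q.1 * G p.2 q.2.
have -> : \sum_(p <- l) \sum_(q <- l)
    p.1 * q.1 * (G p.2 q.2 - G p.2 x * G x q.2 / G x x) = Q - S * S / G x x.
  rewrite /S [in RHS]big_distrl [in RHS]mulr_suml -sumrB.
  apply: eq_bigr => p _; rewrite [in RHS]big_distrr [in RHS]mulr_suml -sumrB /=.
  by apply: eq_bigr => q _; rewrite (sG x q.2); ring.
have := qG ((- (S / G x x), x) :: l).
rewrite !big_cons /=.
under [X in _ + X]eq_bigr do rewrite big_cons /=.
rewrite big_split /= -/Q.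
have -> : \sum_(q <- l) - (S / G x x) * q.1 * G x q.2 = - (S / G x x) * S.
  by rewrite big_distrr /=; apply: eq_bigr => q _; rewrite (sG x q.2); ring.
have -> : \sum_(i <- l) i.1 * - (S / G x x) * G i.2 x = - (S / G x x) * S.
  by rewrite big_distrr /=; apply: eq_bigr => q _; ring.
by congr (0 <= _); field.
Qed.

(** Cholesky elimination, one point of [l] at a time, on successive Schur complements. The clause on
    vanishing diagonals strengthens the induction: the complement vanishes at [(x, x)], so the later
    factors vanish at [x] and do not disturb the values already reproduced there. *)
Lemma psd_gram (T : eqType) (G : T -> T -> R) (l : seq T) : psd G ->
  exists n (w : nat -> T -> R),
    (forall s k, G s s = 0 -> w k s = 0) /\
    forall s t, s \in l -> t \in l -> G s t = \sum_(k < n) w k s * w k t.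
Proof.
elim: l G => [|x l IH] G pG; first by exists 0%N, (fun _ _ => 0).
have pG' := psd_schur_complement x pG.
have [n [w [w0 wG]]] := IH _ pG'.
have sG := pG.1.
pose v s := G s x / Num.sqrt (G x x).
have vv s t : v s * v t = G s x * G x t / G x x.
  rewrite /v (sG t x).
  have [G0|G0] := eqVneq (G x x) 0.
    by rewrite G0 sqrtr0 invr0 !mulr0.
  rewrite -[in RHS](sqr_sqrtr (psd_diag x pG)); field.
  by rewrite sqrtr_eq0 -ltNge lt_neqAle eq_sym G0 psd_diag.
have w0' s k : G s s = 0 -> w k s = 0.
  by move=> G0; apply: w0; rewrite G0 (psd_eq0 x pG G0) !mul0r subr0.
have wx k : w k x = 0.
  have [G0|G0] := eqVneq (G x x) 0; first exact: w0'.
  by apply: w0; rewrite mulfK// subrr.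
have G'x t : G x t - G x x * G x t / G x x = 0.
  have [G0|G0] := eqVneq (G x x) 0.
    by rewrite (psd_eq0 t pG G0) !(mulr0, mul0r) subrr.
  by rewrite mulrAC divff// mul1r subrr.
exists n.+1, (fun k => if k is k'.+1 then w k' else v); split.
  move=> s [|k] G0; last exact: w0'.
  by rewrite /v (psd_eq0 x pG G0) mul0r.
move=> s t sl tl; rewrite big_ord_recl /= vv.
have -> : \sum_(i < n) w i s * w i t = G s t - G s x * G x t / G x x; last by rewrite addrC subrK.
move: sl tl; rewrite !inE => /predU1P[->|sl].
  by move=> _; rewrite G'x big1// => i _; rewrite wx mul0r.
move=> /predU1P[->|tl]; last by rewrite -wG.
rewrite big1 => [|i _]; last by rewrite wx mulr0.
by rewrite (sG s x) [G x s * _]mulrC G'x.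
Qed.

(** Schur product theorem: on the finitely many points of [l], a Gram factorisation of [G] turns the
    form of the product into a sum of forms of [H] with weights [p.1 * w k p.2]. *)
Lemma psdM (T : eqType) (G H : T -> T -> R) :
  psd G -> psd H -> psd (fun s t => G s t * H s t).
Proof.
move=> pG [sH pH]; split=> [s t|l]; first by rewrite pG.1 sH.
have [n [w [_ wG]]] := psd_gram [seq p.2 | p <- l] pG.
have -> : \sum_(p <- l) \sum_(q <- l) p.1 * q.1 * (G p.2 q.2 * H p.2 q.2) =
   \sum_(k < n) \sum_(p <- l) \sum_(q <- l)
     (p.1 * w k p.2) * (q.1 * w k q.2) * H p.2 q.2.
  rewrite [RHS]exchange_big big_seq [RHS]big_seq /=; apply: eq_bigr => p pl.
  rewrite [RHS]exchange_big big_seq [RHS]big_seq /=; apply: eq_bigr => q ql.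
  rewrite wG ?map_f// mulr_suml mulr_sumr; apply: eq_bigr => k _; ring.
apply: sumr_ge0 => k _.
have := pH [seq (p.1 * w k p.2, p.2) | p <- l].
by rewrite big_map; under eq_bigr do rewrite big_map.
Qed.

Lemma psd_exp (T : eqType) (G : T -> T -> R) (n : nat) :
  psd G -> psd (fun s t => G s t ^+ n).
Proof.
move=> pG; elim: n => [|n IH].
  under eq_fun do under eq_fun do rewrite expr0 -[1]mulr1.
  exact: (@psd_rank1 T (fun=> 1)).
under eq_fun do under eq_fun do rewrite exprS.
exact: psdM.
Qed.

End positive_semidefinite.

(** * Monotone class and limit theorems for integrals *)

Section functional_monotone_class.
Context d (T : measurableType d) (R : realType).

Import HBNNSimple.

(** Functional version of the pi-lambda theorem: Dynkin's lemma gives indicators, linearity gives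
    simple functions, bounded pointwise limits give the rest. It serves for rectangles in
    [step_dense] and for rays in [poly_approx_bounded]. *)
Lemma functional_monotone_class (G : set (set T)) (V : set (T -> R)) :
  @measurable d T = <<s G >> -> setI_closed G ->
  V (cst 1) ->
  (forall (a : R) (f g : T -> R), V f -> V g -> V (fun x => a * f x + g x)) ->
  (forall A, G A -> V \1_A) ->
  (forall (f_ : nat -> T -> R) (f : T -> R) (M : R),
    (forall n, V (f_ n)) -> (forall n, measurable_fun setT (f_ n)) ->
    (forall n x, `|f_ n x| <= M) -> (forall x, f_ ^~ x @ \oo --> f x) -> V f) ->
  forall (f : T -> R) (M : R),
    measurable_fun setT f -> (forall x, `|f x| <= M) -> V f.
Proof.
move=> GE GI V1 Vlin VG Vlim.
have V0 : V (cst 0).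
  by have := Vlin (-1) _ _ V1 V1; under eq_fun do rewrite /= mulN1r addNr.
have Vsum I (r : seq I) (c : I -> R) (g : I -> T -> R) :
    (forall i, V (g i)) -> V (fun x => \sum_(i <- r) c i * g i x).
  move=> Vg; elim: r => [|i r IH].
    by under eq_fun do rewrite big_nil; exact: V0.
  by under eq_fun do rewrite big_cons; exact: Vlin.
have Vind A : measurable A -> V \1_A.
  rewrite GE; apply: (dynkin_induction GE GI (P := [set A | V \1_A])) => //=.
  - by rewrite (_ : \1_setT = cst 1)//; apply/funext => x; rewrite indicT.
  - move=> S mS VS; have := Vlin (-1) _ _ VS V1.
    congr V; apply/funext => x; rewrite /= !indicE in_setC.
    by case: (x \in S) => /=; rewrite mulN1r ?addNr ?oppr0 ?add0r.
  - move=> F mF tF VF.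
    apply: (Vlim (fun n => \1_(\big[setU/set0]_(i < n) F i)) _ 1).
    + move=> n; rewrite (_ : \1_ _ =
          (fun x => \sum_(i <- index_enum 'I_n) 1 * \1_(F i) x)).
        by apply: (Vsum _ _ (fun=> 1) (fun i : 'I_n => \1_(F i))) => i.
      apply/funext => x; under [RHS]eq_bigr do rewrite mul1r.
      elim: n => [|n IH]; first by rewrite !big_ord0 indic0.
      rewrite !big_ord_recr /= -IH !indicE in_setU.
      suff : ~~ ((x \in \big[setU/set0]_(i < n) F i) && (x \in F n)).
        by case: (x \in _); case: (x \in F n); rewrite //= ?addr0 ?add0r.
      apply/negP => /andP[]; rewrite !inE -bigcup_mkord => -[k /= kn Fkx] Fnx.
      move/trivIsetP : tF => /(_ k n Logic.I Logic.I).
      by rewrite ltn_eqF// => /(_ isT)/seteqP[+ _] => /(_ x); apply.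
    + by move=> n; apply: measurable_indic; apply: bigsetU_measurable.
    + move=> n x; rewrite indicE; case: (_ \in _); rewrite ?normr1 ?normr0//.
    + move=> x; have [[k _ Fkx]|nx] := pselect ((\bigcup_k F k) x).
        rewrite indicE mem_set; last by exists k.
        apply: cvg_near_cst; exists k.+1 => // n /= kn.
        by rewrite indicE mem_set// -bigcup_mkord; exists k.
      rewrite indicE memNset//; apply: cvg_near_cst; apply: nearW => n.
      rewrite indicE memNset// -bigcup_mkord => -[k _ Fkx]; apply: nx.
      by exists k.
have Vpos (f : T -> R) (M : R) : measurable_fun setT f -> (forall x, 0 <= f x <= M) -> V f.
  move=> mf fM.
  have mf' : measurable_fun setT (EFin \o f) by apply/measurable_EFinP.
  pose g := nnsfun_approx measurableT mf'.
  have gf n x : 0 <= g n x <= f x.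
    apply/andP; split; first exact: fun_ge0.
    rewrite -lee_fin nnsfun_approxE; apply: le_approx => // y _.
    by rewrite lee_fin; case/andP: (fM y).
  apply: (Vlim (fun n => g n) f M) => //.
  - move=> n; rewrite (_ : (g n : T -> R) = fun x =>
        \sum_(y <- finmap.enum_fset (fset_set (range (g n)))) y * \1_(g n @^-1` [set y]) x).
      apply: (Vsum _ _ (fun y => y) (fun y => \1_(g n @^-1` [set y]))) => y.
      apply: Vind; rewrite -[X in measurable X]setTI.
      have mg : measurable_fun setT (g n) by exact: measurable_funP.
      by apply: mg => //; exact: measurable_set1.
    by apply/funext => x; rewrite {1}(fimfunE (g n)) fsbig_finite.
  - move=> n x; case/andP: (gf n x) => g0 gx; case/andP: (fM x) => _ fx.
    by rewrite ger0_norm// (le_trans gx).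
  - move=> x; have f0 y : setT y -> (0 <= (EFin \o f) y)%E.
      by move=> _; rewrite lee_fin; case/andP: (fM y).
    exact: (fine_cvg (cvg_nnsfun_approx measurableT mf' f0 (x := x) Logic.I)).
move=> f M mf fM.
(* Adding [M] moves the values into [[0, 2M]]; the constant is then removed by linearity. *)
have V2 : V (fun x => f x + M).
  apply: (Vpos _ (M + M)); first exact: measurable_funD.
  by move=> x; have := fM x; rewrite ler_norml; lra.
have := Vlin (- M) _ _ V1 V2.
by congr V; apply/funext => x /=; ring.
Qed.

End functional_monotone_class.

Section integral_limits.
Context d (T : measurableType d) (R : realType).
Variable mu : {measure set T -> \bar R}.

Lemma dominated_Rintegral (f_ : nat -> T -> R) (f g : T -> R) :
  (forall n, measurable_fun setT (f_ n)) -> measurable_fun setT f ->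
  {ae mu, forall x, f_ ^~ x @ \oo --> f x} ->
  mu.-integrable setT (EFin \o g) ->
  (forall n x, `|f_ n x| <= g x) ->
  mu.-integrable setT (EFin \o f) /\
  \int[mu]_x f_ n x @[n --> \oo] --> \int[mu]_x f x.
Proof.
move=> mf_ mf f_f ig f_g.
have mf_' n : measurable_fun setT (EFin \o f_ n) by apply/measurable_EFinP.
have mf' : measurable_fun setT (EFin \o f) by apply/measurable_EFinP.
have f_f' : {ae mu, forall x, setT x ->
    (fun n => (EFin \o f_ n) x) @ \oo --> (EFin \o f) x}.
  apply: filterS f_f => x h _; apply: cvg_EFin => //; exact: nearW.
have f_g' : {ae mu, forall x n, setT x ->
    (`|(EFin \o f_ n) x| <= (EFin \o g) x)%E}.
  by apply: aeW => x n _; rewrite /= lee_fin.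
have [i1 _ c] := dominated_convergence measurableT mf_' mf' f_f' ig f_g'.
split => //; apply: fine_cvg.
rewrite /Rintegral fineK//; exact: integrable_fin_num.
Qed.

Lemma dominated_Rintegral_norm (f_ : nat -> T -> R) (f g : T -> R) :
  (forall n, measurable_fun setT (f_ n)) -> measurable_fun setT f ->
  {ae mu, forall x, f_ ^~ x @ \oo --> f x} ->
  mu.-integrable setT (EFin \o g) ->
  (forall n x, `|f_ n x| <= g x) ->
  (forall x, `|f x| <= g x) ->
  \int[mu]_x `|f_ n x - f x| @[n --> \oo] --> (0 : R).
Proof.
move=> mf_ mf f_f ig f_g fg.
have [] := @dominated_Rintegral (fun n x => `|f_ n x - f x|) (cst 0)
  (fun x => g x + g x).
- by move=> n; apply: measurableT_comp => //; exact: measurable_funB.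
- by [].
- apply: filterS f_f => x h.
  rewrite /= -(@normr0 _ R) -(subrr (f x)).
  by apply: cvg_norm; apply: cvgB => //; exact: cvg_cst.
- exact: (integrableD measurableT ig ig).
- move=> n x; rewrite normr_id (le_trans (ler_normB _ _))//.
  exact: lerD.
- by move=> _; rewrite Rintegral_cst// mul0r.
Qed.

(** Fatou's lemma on the complement of the exceptional null set, where the lower limit is the
    limit. *)
Lemma fatou_bound (f_ : nat -> T -> \bar R) (f : T -> \bar R) (C : \bar R) :
  (forall n, measurable_fun setT (f_ n)) -> measurable_fun setT f ->
  (forall n x, (0 <= f_ n x)%E) -> (forall x, (0 <= f x)%E) ->
  {ae mu, forall x, f_ ^~ x @ \oo --> f x} ->
  (forall n, (\int[mu]_x f_ n x <= C)%E) ->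
  (\int[mu]_x f x <= C)%E.
Proof.
move=> mf_ mf f_0 f0 f_f f_C.
have [N [mN N0 subN]] := f_f.
have mD : measurable (setT `\` N) by exact: measurableD.
rewrite (ge0_negligible_integral mN)//.
have := @fatou _ _ _ mu _ mD f_ (fun n => measurable_funS measurableT (@subsetT _ _) (mf_ n))
  (fun n x _ => f_0 n x).
have -> : (\int[mu]_(x in setT `\` N) limn_einf (f_ ^~ x) =
    \int[mu]_(x in setT `\` N) f x)%E.
  apply: eq_integral => x; rewrite inE => -[_ Nx].
  have h : f_ ^~ x @ \oo --> f x by apply: contrapT => h; apply: Nx; exact: subN.
  by rewrite is_cvg_limn_einfE; [exact: (cvg_lim _ h)|exact: cvgP h].
move=> h; apply: (le_trans h); rewrite limn_einf_lim.
apply: lime_le; first exact: is_cvg_einfs.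
apply: nearW => n; apply: (@le_trans _ _ (\int[mu]_x f_ n x)%E) => //.
apply: (@le_trans _ _ (\int[mu]_(x in setT `\` N) f_ n x)%E).
  by apply: ereal_inf_lbound; exists n => /=.
by apply: ge0_subset_integral.
Qed.

End integral_limits.

(** * Bounded measurable functions and their integrals *)

Section bounded_measurable.
Context d (T : measurableType d) (R : realType).

Definition bounded_measurable (f : T -> R) : Prop :=
  measurable_fun setT f /\ exists M : R, forall x, `|f x| <= M.

Lemma bounded_measurable_cst (c : R) : bounded_measurable (cst c).
Proof. by split => //; exists `|c|. Qed.

Lemma bounded_measurable_indic (A : set T) :
  measurable A -> bounded_measurable \1_A.
Proof.
move=> mA; split; first exact: measurable_indic.
by exists 1 => x; rewrite indicE; case: (_ \in _); rewrite ?normr1 ?normr0.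
Qed.

Lemma bounded_measurableD (f g : T -> R) : bounded_measurable f ->
  bounded_measurable g -> bounded_measurable (fun x => f x + g x).
Proof.
move=> [mf [M fM]] [mg [N gN]]; split; first exact: measurable_funD.
by exists (M + N) => x; rewrite (le_trans (ler_normD _ _))// lerD.
Qed.

Lemma bounded_measurableM (f g : T -> R) : bounded_measurable f ->
  bounded_measurable g -> bounded_measurable (fun x => f x * g x).
Proof.
move=> [mf [M fM]] [mg [N gN]]; split; first exact: measurable_funM.
by exists (M * N) => x; rewrite normrM ler_pM.
Qed.

Lemma bounded_measurableZ (c : R) (f : T -> R) : bounded_measurable f ->
  bounded_measurable (fun x => c * f x).
Proof. exact/bounded_measurableM/bounded_measurable_cst. Qed.

Lemma bounded_measurableB (f g : T -> R) : bounded_measurable f ->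
  bounded_measurable g -> bounded_measurable (fun x => f x - g x).
Proof.
move=> bf bg; under eq_fun do rewrite -mulN1r.
exact/bounded_measurableD/bounded_measurableZ.
Qed.

Lemma bounded_measurable_norm (f : T -> R) : bounded_measurable f ->
  bounded_measurable (fun x => `|f x|).
Proof.
move=> [mf [M fM]]; split; first exact: measurableT_comp.
by exists M => x; rewrite normr_id.
Qed.

Lemma bounded_measurable_sum (I : Type) (r : seq I) (f : I -> T -> R) :
  (forall i, bounded_measurable (f i)) ->
  bounded_measurable (fun x => \sum_(i <- r) f i x).
Proof.
move=> bf; elim: r => [|i r IH].
  under eq_fun do rewrite big_nil; exact: bounded_measurable_cst.
under eq_fun do rewrite big_cons; exact: bounded_measurableD.
Qed.

Lemma sum_indic_fiber (I : finType) (iota : T -> I) (c : I -> R) (x : T) :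
  \sum_i c i * \1_(iota @^-1` [set i]) x = c (iota x).
Proof.
rewrite (bigD1 (iota x))//= indicE mem_set// mulr1.
rewrite big1 ?addr0// => i /eqP ni; rewrite indicE memNset ?mulr0//.
by move=> /= h; apply: ni.
Qed.

Lemma bounded_measurable_fin (I : finType) (iota : T -> I) (c : I -> R) :
  (forall i, measurable (iota @^-1` [set i])) ->
  bounded_measurable (fun x => c (iota x)).
Proof.
move=> mi; have -> : (fun x => c (iota x)) =
    (fun x => \sum_(i <- index_enum I) c i * \1_(iota @^-1` [set i]) x).
  by apply/funext => x; rewrite sum_indic_fiber.
apply: bounded_measurable_sum => i; apply: bounded_measurableZ.
exact: bounded_measurable_indic.
Qed.

Variable mu : {measure set T -> \bar R}.

Lemma Rintegral_sum (I : Type) (r : seq I) (f : I -> T -> R) :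
  (forall i, mu.-integrable setT (EFin \o f i)) ->
  \int[mu]_x (\sum_(i <- r) f i x) = \sum_(i <- r) \int[mu]_x f i x.
Proof.
move=> fi; elim: r => [|i r IH].
  under eq_Rintegral do rewrite big_nil.
  by rewrite Rintegral_cst// mul0r big_nil.
under eq_Rintegral do rewrite big_cons.
rewrite RintegralD//; first by rewrite IH big_cons.
have := integrable_sum measurableT r (P := xpredT) (fun i _ => fi i).
congr (integrable _ _ _); apply/funext => x /=.
by rewrite sumEFin.
Qed.

Hypothesis mu_fin : (mu setT < +oo)%E.

Lemma bounded_measurable_integrable (f : T -> R) :
  bounded_measurable f -> mu.-integrable setT (EFin \o f).
Proof.
move=> [mf [M fM]]; apply: measurable_bounded_integrable => //.
exists M; split; first exact: num_real.
by move=> N MN x _ /=; rewrite (le_trans (fM x))// ltW.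
Qed.

End bounded_measurable.

Lemma bounded_measurable_comp d1 d2 (T1 : measurableType d1)
    (T2 : measurableType d2) (R : realType) (f : T2 -> R) (g : T1 -> T2) :
  measurable_fun setT g -> bounded_measurable f ->
  bounded_measurable (fun x => f (g x)).
Proof.
move=> mg [mf [M fM]]; split; first exact: (measurableT_comp mf mg).
by exists M.
Qed.

Section bounded_measurable_prod.
Context d1 d2 (T1 : measurableType d1) (T2 : measurableType d2) (R : realType).

Variables (mu : {finite_measure set T1 -> \bar R}).
Variables (nu : {finite_measure set T2 -> \bar R}).

Lemma product_measure_finite : ((mu \x nu)%E setT < +oo)%E.
Proof.
rewrite -setXTT product_measure1E// lte_mul_pinfty//.
- exact: fin_num_measure.
- by rewrite -ge0_fin_numE//; exact: fin_num_measure.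
Qed.

Lemma bounded_measurable_integrable_prod (f : T1 * T2 -> R) :
  bounded_measurable f -> (mu \x nu)%E.-integrable setT (EFin \o f).
Proof.
exact/bounded_measurable_integrable/product_measure_finite.
Qed.

Lemma Rintegral_prod (f : T1 * T2 -> R) : bounded_measurable f ->
  bounded_measurable (fun x => \int[nu]_y f (x, y)) /\
  \int[(mu \x nu)%E]_p f p = \int[mu]_x \int[nu]_y f (x, y).
Proof.
move=> bf; have fi := bounded_measurable_integrable_prod bf.
have bfx x : bounded_measurable (fun y => f (x, y)).
  exact: bounded_measurable_comp (pair1_measurable x) bf.
have nufin : (nu setT < +oo)%E.
  by rewrite -ge0_fin_numE//; exact: fin_num_measure.
have ifx x := bounded_measurable_integrable nufin (bfx x).
split.
  split.
    exact: (measurableT_comp (fine_measurable measurableT)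
      (measurable_fubini_F fi)).
  have [mf [M fM]] := bf; exists (M * fine (nu setT)) => x.
  rewrite (le_trans (le_normr_Rintegral measurableT (ifx x)))//.
  rewrite -Rintegral_cst//; apply: le_Rintegral => //.
    exact: (integrable_norm (ifx x)).
  exact/(bounded_measurable_integrable nufin)/bounded_measurable_cst.
rewrite /Rintegral -integral12_prod_meas1//; congr fine.
apply: eq_integral => x _; rewrite /fubini_F /= fineK//.
exact: (integrable_fin_num measurableT (ifx x)).
Qed.

Lemma Rintegral_prod_swap (f : T1 * T2 -> R) : bounded_measurable f ->
  \int[(mu \x nu)%E]_p f p = \int[nu]_y \int[mu]_x f (x, y).
Proof.
move=> bf; have fi := bounded_measurable_integrable_prod bf.
have mufin : (mu setT < +oo)%E.
  by rewrite -ge0_fin_numE//; exact: fin_num_measure.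
rewrite /Rintegral -integral21_prod_meas1//; congr fine.
apply: eq_integral => y _; rewrite /fubini_G /= fineK//.
apply: integrable_fin_num => //; apply: bounded_measurable_integrable => //.
exact: bounded_measurable_comp (pair2_measurable y) bf.
Qed.

End bounded_measurable_prod.

(** * Density of step kernels in mean *)

Section step_density.
Context d (T : measurableType d) (R : realType).
Lemma measurable_fin_prod (I : finType) (iota : T -> I) :
  (forall i, measurable (iota @^-1` [set i])) ->
  forall j : I * I,
    measurable ((fun p : T * T => (iota p.1, iota p.2)) @^-1` [set j]).
Proof.
move=> mi [i j]; rewrite (_ : _ @^-1` _ =
  (iota @^-1` [set i]) `*` (iota @^-1` [set j])).
  exact: measurableX.
by apply/seteqP; split => -[s t] /= => [[-> ->]|[-> ->]].
Qed.

Lemma bounded_measurable_step (I : finType) (iota : T -> I) (c : I -> I -> R) :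
  (forall i, measurable (iota @^-1` [set i])) ->
  bounded_measurable (fun p : T * T => c (iota p.1) (iota p.2)).
Proof.
move=> mi.
exact: (@bounded_measurable_fin _ _ _ (I * I)%type _ (fun j => c j.1 j.2)
  (measurable_fin_prod mi)).
Qed.

Variable M : {measure set (T * T) -> \bar R}.
Hypothesis M_fin : (M setT < +oo)%E.

Let bi (f : T * T -> R) (bf : bounded_measurable f) :=
  bounded_measurable_integrable M_fin bf.

(** Monotone class argument starting from rectangles; bounded limits are handled by dominated
    convergence. The measure [M] is any finite one and not just a product, so that a measure
    charging the diagonal can be used later. *)
Lemma step_dense (G : T * T -> R) : bounded_measurable G ->
  forall e : R, 0 < e -> exists (I : finType) (iota : T -> I) (c : I -> I -> R),
    (forall i, measurable (iota @^-1` [set i])) /\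
    \int[M]_p `|G p - c (iota p.1) (iota p.2)| <= e.
Proof.
move=> [mG [K GK]].
suff [] : bounded_measurable G /\ forall e : R, 0 < e ->
    exists (I : finType) (iota : T -> I) (c : I -> I -> R),
    (forall i, measurable (iota @^-1` [set i])) /\
    \int[M]_p `|G p - c (iota p.1) (iota p.2)| <= e by [].
move: G K mG GK; apply: (functional_monotone_class
  (measurable_prod_measurableType T T)).
- move=> _ _ [A1 mA1 [A2 mA2 <-]] [B1 mB1 [B2 mB2 <-]].
  exists (A1 `&` B1); first exact: measurableI.
  by exists (A2 `&` B2); [exact: measurableI|rewrite setXI].
- split; first exact: bounded_measurable_cst.
  move=> e e0; exists unit, (fun=> tt), (fun _ _ => 1); split.
    by move=> i; rewrite preimage_cst; case: ifP.
  under eq_Rintegral do rewrite subrr normr0.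
  by rewrite Rintegral_cst// mul0r ltW.
- move=> a f g [bf hf] [bg hg]; split.
    by apply: bounded_measurableD => //; exact: bounded_measurableZ.
  move=> e e0.
  (* The 1 in the denominator covers [a = 0]. The two step kernels are then combined on the common
     refinement of their partitions, indexed by pairs of cells. *)
  have e1 : 0 < e / (2 * (`|a| + 1)) by rewrite divr_gt0// mulr_gt0// ltr_wpDl.
  have e2 : 0 < e / 2 by rewrite divr_gt0.
  have [I [iI [c [mI Hc]]]] := hf _ e1.
  have [J [iJ [b [mJ Hb]]]] := hg _ e2.
  exists (I * J)%type, (fun t => (iI t, iJ t)),
    (fun i j => a * c i.1 j.1 + b i.2 j.2); split.
    move=> [i j]; rewrite (_ : _ @^-1` _ = iI @^-1` [set i] `&` iJ @^-1` [set j]).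
      exact: measurableI.
    by apply/seteqP; split => t /= => [[-> ->]|[-> ->]].
  have bc := bounded_measurable_step c mI.
  have bb := bounded_measurable_step b mJ.
  have bfc := bounded_measurable_norm (bounded_measurableB bf bc).
  have bgb := bounded_measurable_norm (bounded_measurableB bg bb).
  apply: (@le_trans _ _ (\int[M]_p (`|a| * `|f p - c (iI p.1) (iI p.2)| +
      `|g p - b (iJ p.1) (iJ p.2)|))).
    apply: le_Rintegral => //.
    + apply/bi/bounded_measurable_norm/bounded_measurableB.
        by apply: bounded_measurableD => //; exact: bounded_measurableZ.
      by apply: bounded_measurableD => //; exact: bounded_measurableZ.
    + by apply/bi/bounded_measurableD => //; exact: bounded_measurableZ.
    + move=> p _; rewrite /= -normrM (le_trans _ (ler_normD _ _))//.
      by rewrite le_eqVlt; apply/orP; left; apply/eqP; congr `|_|; ring.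
  rewrite RintegralD//; [|exact/bi/bounded_measurableZ|exact: bi].
  rewrite RintegralZl//; last exact: bi.
  have : `|a| * \int[M]_p `|f p - c (iI p.1) (iI p.2)| <= e / 2.
    apply: (@le_trans _ _ (`|a| * (e / (2 * (`|a| + 1))))).
      by rewrite ler_wpM2l.
    have a1 : 0 < `|a| + 1 by rewrite ltr_wpDl.
    rewrite (_ : `|a| * _ = (e / 2) * (`|a| / (`|a| + 1))); last first.
      by field; rewrite gt_eqF.
    by rewrite ler_piMr ?ltW// ltr_pdivrMr// mul1r ltrDl.
  by move: Hb; lra.
- move=> _ [A mA [B mB <-]]; split.
    by apply: bounded_measurable_indic; exact: measurableX.
  move=> e e0; exists (bool * bool)%type, (fun t => (t \in A, t \in B)),
    (fun i j => (i.1 && j.2)%:R); split.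
    have mb (C : set T) (b : bool) : measurable C ->
        measurable [set t | (t \in C) = b].
      move=> mC; case: b.
        by rewrite (_ : [set t | _] = C)//; apply/seteqP; split=> t /=;
          [move/set_mem|move/mem_set].
      rewrite (_ : [set t | _] = ~` C); first exact: measurableC.
      by apply/seteqP; split => t /=; [move=> /negbT; rewrite notin_setE|move=> nC; rewrite memNset].
    move=> [a b]; rewrite (_ : _ @^-1` _ =
        [set t | (t \in A) = a] `&` [set t | (t \in B) = b]).
      by apply: measurableI; exact: mb.
    by apply/seteqP; split => t /= => [[-> ->]|[-> ->]].
  rewrite (_ : (\int[M]_p _) = \int[M]_p 0); first by rewrite Rintegral_cst// mul0r ltW.
  apply: eq_Rintegral => -[s t] _ /=.
  by rewrite indicE in_setX subrr normr0.
- move=> f_ f K Vf mf_ fK f_f.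
  have mf : measurable_fun setT f by apply: (measurable_fun_cvg mf_) => x _; exact: f_f.
  have fK' x : `|f x| <= K.
    have c : `|f_ n x| @[n --> \oo] --> `|f x| by exact: cvg_norm.
    rewrite -(cvg_lim (@norm_hausdorff _ _) c).
    by apply: limr_le; [exact: cvgP c|exact: nearW].
  have bf : bounded_measurable f by split => //; exists K.
  split => // e e0.
  have cv : \int[M]_p `|f_ n p - f p| @[n --> \oo] --> (0 : R).
    apply: (@dominated_Rintegral_norm _ _ _ M f_ f (cst K)) => //.
      exact: aeW.
    exact/bi/bounded_measurable_cst.
  move/cvgrPdist_le : cv => /(_ (e / 2)) [|n _ /(_ n (leqnn n))].
    by rewrite divr_gt0.
  rewrite /= sub0r normrN => hn.
  have e2 : 0 < e / 2 by rewrite divr_gt0.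
  have [bn /(_ _ e2) [I [iI [c [mI Hc]]]]] := Vf n.
  exists I, iI, c; split => //.
  have bc := bounded_measurable_step c mI.
  apply: (@le_trans _ _ (\int[M]_p (`|f_ n p - f p| + `|f_ n p - c (iI p.1) (iI p.2)|))).
    apply: le_Rintegral => //.
    + exact/bi/bounded_measurable_norm/bounded_measurableB.
    + by apply/bi/bounded_measurableD; exact/bounded_measurable_norm/bounded_measurableB.
    + move=> p _; rewrite (distrC (f_ n p) (f p)) (le_trans _ (ler_normD _ _))//.
      by rewrite le_eqVlt; apply/orP; left; apply/eqP; congr `|_|; ring.
  rewrite RintegralD//; [|exact/bi/bounded_measurable_norm/bounded_measurableB..].
  by have := ler_norm (\int[M]_x `|f_ n x - f x|); move: Hc hn; lra.
Qed.

End step_density.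

(** * Integrals and step approximation of positive semidefinite kernels *)

Section psd_integral.
Context d (T : measurableType d) (R : realType).
Variable mu : {finite_measure set T -> \bar R}.

Let mu_fin : (mu setT < +oo)%E.
Proof. by rewrite -ge0_fin_numE//; exact: fin_num_measure. Qed.

Let bi (f : T -> R) (bf : bounded_measurable f) :=
  bounded_measurable_integrable mu_fin bf.

(* Points are added one at a time: [H_sum l] plus its expected increment under
   the remaining independent draws from the normalised measure does not
   increase if the new point is well chosen. *)
Lemma psd_integral_ge0 (H : T -> T -> R) :
  psd H -> bounded_measurable (fun p : T * T => H p.1 p.2) ->
  0 <= \int[(mu \x mu)%E]_p H p.1 p.2.
Proof.
move=> [sH pH] bH.
have [bI ->] := Rintegral_prod mu mu bH.
set I2 := (X in 0 <= X).
pose m := fine (mu setT).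
have [m0|m0] := eqVneq m 0.
  rewrite /I2 /Rintegral (_ : (\int[mu]_x _)%E = 0%E)//.
  apply: null_set_integral => //.
    by apply/measurable_EFinP; exact: bI.1.
  by move: m0; rewrite /m => /eqP; rewrite fine_eq0 ?fin_num_measure// => /eqP.
have m_gt0 : 0 < m by rewrite lt_neqAle eq_sym m0/= fine_ge0.
(* The slack of 1 between [c] and the diagonal lets the averaging step end in a contradiction
   although integration only yields weak inequalities. *)
have [c [c0 Hc]] : exists c : R, 0 <= c /\ forall s, H s s <= c - 1.
  have [_ [c Hc]] := bH; exists (`|c| + 1); split; first by rewrite addr_ge0.
  by move=> s; rewrite addrK (le_trans (ler_norm _))// (le_trans (Hc (s, s)))// ler_norm.
pose g t := m^-1 * \int[mu]_s H t s.
pose S := m^-1 * (m^-1 * I2).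
have bHt t : bounded_measurable (H t).
  exact: (bounded_measurable_comp (pair1_measurable t) bH).
have bHd : bounded_measurable (fun t => H t t).
  exact: (@bounded_measurable_comp _ _ _ _ _ (fun p => H p.1 p.2) (fun t => (t, t))
    (measurable_fun_pair (@measurable_id _ _ _) (@measurable_id _ _ _)) bH).
have bg : bounded_measurable g by exact: bounded_measurableZ.
have intg : \int[mu]_t g t = m * S.
  rewrite /g RintegralZl//; last exact: bi.
  by rewrite /S (mulrA m) mulfV// mul1r.
pose Q (l : seq T) := \sum_(s <- l) \sum_(t <- l) H s t.
have Q0 l : 0 <= Q l.
  have := pH [seq (1, t) | t <- l]; rewrite big_map.
  by under eq_bigr do (rewrite big_map; under eq_bigr do rewrite /= !mul1r).
(* Expected value of [Q] after [j] independent draws are added to [l], with each new diagonal term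
   replaced by [c]; [g t] is the mean of [H t] and [S] the mean of [H] over both variables. *)
pose Psi (j : nat) (l : seq T) : R :=
  Q l + j%:R * 2 * \sum_(t <- l) g t + j%:R * c + j%:R * (j%:R - 1) * S.
have step j l : exists t, Psi j (t :: l) <= Psi j.+1 l.
  apply: contrapT => /forallNP h.
  have QS t : Q (t :: l) = H t t + \sum_(u <- l) 2 * H u t + Q l.
    rewrite /Q !big_cons; under [X in _ + X = _]eq_bigr do rewrite big_cons.
    rewrite big_split /= -mulr_sumr (eq_bigr (fun u => H u t)) => [|u _//].
    by ring.
  pose K := Q l + j%:R * 2 * (\sum_(u <- l) g u) + j%:R * c + j%:R * (j%:R - 1) * S.
  have PE t : Psi j (t :: l) = H t t + (\sum_(u <- l) 2 * H u t) + (j%:R * 2) * g t + K.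
    by rewrite /Psi QS big_cons /K; ring.
  have b1 : bounded_measurable (fun t => \sum_(u <- l) 2 * H u t).
    by apply: bounded_measurable_sum => u; exact: bounded_measurableZ.
  have b2 : bounded_measurable (fun t => (j%:R * 2) * g t) by exact: bounded_measurableZ.
  have bK : bounded_measurable (fun _ : T => K) by exact: bounded_measurable_cst.
  have b3 := bounded_measurableD bHd b1.
  have b4 := bounded_measurableD b3 b2.
  have bP : bounded_measurable (fun t => Psi j (t :: l)).
    under eq_fun do rewrite PE; exact: bounded_measurableD.
  have intP : \int[mu]_t Psi j (t :: l) <= m * (Psi j.+1 l - 1).
    under eq_Rintegral do rewrite PE.
    rewrite RintegralD//; [|exact: bi..].
    rewrite RintegralD//; [|exact: bi..].
    rewrite RintegralD//; [|exact: bi..].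
    rewrite Rintegral_sum; last by move=> u; exact/bi/bounded_measurableZ.
    rewrite (eq_bigr (fun u => 2 * (m * g u))); last first.
      move=> u _; rewrite RintegralZl//; last exact: bi.
      by rewrite /g (mulrA m) mulfV// mul1r.
    rewrite RintegralZl//; last exact: bi.
    rewrite Rintegral_cst// intg -mulr_sumr -mulr_sumr -/m.
    have : \int[mu]_x H x x <= m * (c - 1).
      rewrite mulrC -Rintegral_cst//; apply: le_Rintegral => //.
        exact: bi.
      exact/bi/bounded_measurable_cst.
    rewrite /Psi /K -natr1; set A := \int[mu]_x H x x; set B := \sum_(u <- l) g u.
    rewrite -(lerD2r (2 * (m * B) + j%:R * 2 * (m * S) +
      (Q l + j%:R * 2 * B + j%:R * c + j%:R * (j%:R - 1) * S) * m)).
    by move=> hh; apply: le_trans (le_trans hh _); rewrite le_eqVlt; apply/orP; left; apply/eqP; ring.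
  have : m * Psi j.+1 l <= \int[mu]_t Psi j (t :: l).
    rewrite mulrC -Rintegral_cst//; apply: le_Rintegral => //.
    + exact/bi/bounded_measurable_cst.
    + exact: bi.
    + by move=> t _; apply/ltW; rewrite ltNge; apply/negP; exact: h.
  move/le_trans => /(_ _ intP); rewrite ler_pM2l//.
  by rewrite -subr_ge0 addrAC subrr add0r oppr_ge0 ler10.
have Psi_ge0 j l : 0 <= Psi j l.
  elim: j l => [|j IH] l.
    by rewrite /Psi !mul0r !addr0.
  by have [t] := step j l; exact: le_trans (IH _).
suff S0 : 0 <= S by move: S0; rewrite /S !pmulr_rge0 ?invr_gt0.
rewrite leNgt; apply/negP => S0.
(* From the empty list, [Psi j] equals [j * (c + (j - 1) * S)]; for [S < 0] this [j] makes it
   negative. *)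
have := Psi_ge0 (Num.truncn (c / - S)).+2 [::].
rewrite /Psi /Q !big_nil mulr0 !add0r -mulrA -mulrDr pmulr_rge0 ?ltr0n//.
rewrite -natr1 addrK.
have : c / - S < (Num.truncn (c / - S)).+1%:R by exact: truncnS_gt.
by rewrite ltr_pdivrMr ?oppr_gt0//; lra.
Qed.

End psd_integral.

Section psd_step_approximation.
Context d (T : measurableType d) (R : realType).
Variable mu : {finite_measure set T -> \bar R}.

Lemma psd_diagonal (I : finType) (a : I -> R) :
  (forall i, 0 <= a i) -> psd (fun i j => if i == j then a i else 0).
Proof.
move=> a0; split=> [i j|l].
  by rewrite eq_sym; case: eqVneq => // ->.
have -> : \sum_(p <- l) \sum_(q <- l)
    p.1 * q.1 * (if p.2 == q.2 then a p.2 else 0) =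
    \sum_(i : I) a i * (\sum_(p <- l) p.1 * (p.2 == i)%:R) ^+ 2.
  under [RHS]eq_bigr do rewrite expr2 big_distrl /= mulr_sumr.
  rewrite [RHS]exchange_big /=; apply: eq_bigr => p _.
  under [RHS]eq_bigr do rewrite mulr_sumr mulr_sumr.
  rewrite [RHS]exchange_big /=; apply: eq_bigr => q _.
  rewrite (bigD1 p.2)//= eqxx big1 => [|i ip]; last first.
    by rewrite [p.2 == i]eq_sym (negbTE ip) mulr0 mul0r mulr0.
  rewrite [q.2 == p.2]eq_sym.
  by case: (p.2 == q.2); rewrite /= ?(mulr1, mulr0, addr0)// mulrC.
by apply: sumr_ge0 => i _; rewrite mulr_ge0// sqr_ge0.
Qed.

Let mu_fin : (mu setT < +oo)%E.
Proof. by rewrite -ge0_fin_numE//; exact: fin_num_measure. Qed.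

Let bi (f : T -> R) (bf : bounded_measurable f) :=
  bounded_measurable_integrable mu_fin bf.

Let bi2 (f : T * T -> R) (bf : bounded_measurable f) :=
  bounded_measurable_integrable_prod mu mu bf.

Lemma Rintegral_prod_mul (f g : T -> R) :
  bounded_measurable f -> bounded_measurable g ->
  \int[(mu \x mu)%E]_p (f p.1 * g p.2) = (\int[mu]_t f t) * \int[mu]_t g t.
Proof.
move=> bf bg.
have bfg : bounded_measurable (fun p : T * T => f p.1 * g p.2).
  by apply: bounded_measurableM; [exact: bounded_measurable_comp (@measurable_fst _ _ T T) bf|
    exact: bounded_measurable_comp (@measurable_snd _ _ T T) bg].
rewrite (Rintegral_prod mu mu bfg).2 /=.
transitivity (\int[mu]_x (f x * \int[mu]_y g y)).
  by apply: eq_Rintegral => x _; rewrite RintegralZl//; exact: bi.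
by rewrite RintegralZr//; exact: bi.
Qed.

(** [step_dense] is applied to the sum of the product measure and the image of [mu] under
    [t |-> (t, t)]. The diagonal needs this separate control because it may be null for the product
    measure. *)
Lemma step_dense_diag (G : T * T -> R) : bounded_measurable G ->
  forall e : R, 0 < e -> exists (I : finType) (iota : T -> I) (c : I -> I -> R),
    [/\ forall i, measurable (iota @^-1` [set i]),
      \int[(mu \x mu)%E]_p `|G p - c (iota p.1) (iota p.2)| <= e &
      \int[mu]_t `|G (t, t) - c (iota t) (iota t)| <= e].
Proof.
move=> bG e e0.
have mdiag : measurable_fun setT (fun t : T => (t, t)).
  exact: (measurable_fun_pair (@measurable_id _ _ _) (@measurable_id _ _ _)).
unshelve epose proof (@step_dense _ _ _
  (measure_add (mu \x mu)%E (pushforward mu (fun t : T => (t, t)))) _ _ bG _ e0)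
  as [I [iota [c [mi H]]]].
- exact: mdiag.
- rewrite (_ : _ setT = (mu \x mu)%E setT + mu setT)%E; last exact: measure_addE.
  by apply: lte_add_pinfty => //; exact: product_measure_finite.
pose F (p : T * T) : R := `|G p - c (iota p.1) (iota p.2)|.
have bF : bounded_measurable F.
  apply: bounded_measurable_norm; apply: bounded_measurableB => //.
  exact: (bounded_measurable_step c mi).
have bFd : bounded_measurable (fun t => F (t, t)) by exact: bounded_measurable_comp bF.
have mF : measurable_fun setT (EFin \o F) by apply/measurable_EFinP; exact: bF.1.
have F0 p : (0 <= (F p)%:E)%E by rewrite lee_fin /F normr_ge0.
have HE : \int[(mu \x mu)%E]_p F p + \int[mu]_t F (t, t) <= e.
  move: H; rewrite /Rintegral -/F ge0_integral_measure_add// ge0_integral_pushforward//.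
  rewrite preimage_setT fineD//.
    exact: (integrable_fin_num _ (bi2 bF)).
  exact: (integrable_fin_num _ (bi bFd)).
have I1 : 0 <= \int[(mu \x mu)%E]_p F p by apply: Rintegral_ge0 => p _; rewrite /F normr_ge0.
have I2 : 0 <= \int[mu]_t F (t, t) by apply: Rintegral_ge0 => t _; rewrite /F normr_ge0.
exists I, iota, c; split => //.
- by apply: le_trans HE; rewrite lerDl.
- by apply: le_trans HE; rewrite lerDr.
Qed.

(** The cell averages [avg] of [G] are positive semidefinite because their form is the integral of
    [phi s * phi t * G s t] for a step function [phi]. Raising the diagonal to 1 adds a nonnegative
    diagonal kernel. The distance to [G] is estimated through a step kernel [c] that need not be
    positive semidefinite. *)
Lemma psd_step_approximation (G : T -> T -> R) :
  psd G -> (forall t, G t t = 1) ->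
  measurable_fun setT (fun p : T * T => G p.1 p.2) ->
  forall e : R, 0 < e -> exists (I : finType) (iota : T -> I) (g : I -> I -> R),
    [/\ forall i, measurable (iota @^-1` [set i]), psd g, forall i, g i i = 1 &
      \int[(mu \x mu)%E]_p `|G p.1 p.2 - g (iota p.1) (iota p.2)| <= e].
Proof.
move=> pG G1 mG e e0.
have bG : bounded_measurable (fun p : T * T => G p.1 p.2).
  by split => //; exists 1 => p; exact: psd_norm_le1.
pose m := fine (mu setT).
have m0 : 0 <= m by exact: fine_ge0.
(* The final error is twice the distance from [G] to [c] plus [m] times their distance along the
   diagonal. *)
have e'0 : 0 < e / (2 + m) by rewrite divr_gt0// ltr_wpDr.
have [I [iota [c [mi HF HD]]]] := step_dense_diag bG e'0.
pose a (i : I) (t : T) : R := \1_(iota @^-1` [set i]) t.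
have a_sum (h : I -> R) t : \sum_i h i * a i t = h (iota t).
  exact: sum_indic_fiber.
have a01 i t : 0 <= a i t <= 1.
  by rewrite /a indicE; case: (_ \in _); rewrite /= ?lexx ?ler01.
have ba i : bounded_measurable (a i) by exact: bounded_measurable_indic.
have baa i j : bounded_measurable (fun p : T * T => a i p.1 * a j p.2).
  by apply: bounded_measurableM; [exact: bounded_measurable_comp (@measurable_fst _ _ T T) (ba i)|
    exact: bounded_measurable_comp (@measurable_snd _ _ T T) (ba j)].
have aa0 i j s t : 0 <= a i s * a j t by rewrite mulr_ge0//; case/andP: (a01 i s); case/andP: (a01 j t).
have baaG i j : bounded_measurable (fun p : T * T => a i p.1 * a j p.2 * G p.1 p.2).
  exact: bounded_measurableM.
have bstep (h : I -> I -> R) := @bounded_measurable_step _ _ R I iota h mi.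
pose q i := \int[mu]_t a i t.
have q0 i : 0 <= q i by apply: Rintegral_ge0 => t _; case/andP: (a01 i t).
pose J i j := \int[(mu \x mu)%E]_p (a i p.1 * a j p.2 * G p.1 p.2).
have qq i j : \int[(mu \x mu)%E]_p (a i p.1 * a j p.2) = q i * q j.
  exact: Rintegral_prod_mul.
have Jqq i j : `|J i j| <= q i * q j.
  rewrite (le_trans (le_normr_Rintegral _ (bi2 (baaG i j))))// -qq.
  apply: le_Rintegral => //.
  - exact/bi2/bounded_measurable_norm.
  - exact: bi2.
  - move=> p _; rewrite normrM (ger0_norm (aa0 _ _ _ _)) ler_piMr//.
    exact: psd_norm_le1.
have Jsym i j : J i j = J j i.
  rewrite /J [RHS]Rintegral_prod_swap// (Rintegral_prod mu mu (baaG i j)).2.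
  apply: eq_Rintegral => s _; apply: eq_Rintegral => t _ /=.
  by rewrite (pG.1 s t) [a i s * _]mulrC.
(* Cells of mass 0 get average 0, by the convention on inverses; [avgE] still holds there because
   [J] vanishes too. *)
pose avg i j := (q i)^-1 * (q j)^-1 * J i j.
have avgE i j : avg i j * (q i * q j) = J i j.
  have := Jqq i j; rewrite /avg.
  have [->|qi] := eqVneq (q i) 0.
    by rewrite mul0r mulr0 normr_le0 => /eqP ->.
  have [->|qj] := eqVneq (q j) 0.
    by rewrite mulr0 mulr0 normr_le0 => /eqP ->.
  by move=> _; field; rewrite qi qj.
have pavg : psd avg.
  split=> [i j|l]; first by rewrite /avg Jsym [(q i)^-1 * _]mulrC.
  pose phi t := \sum_(p <- l) p.1 * (q p.2)^-1 * a p.2 t.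
  have bphi : bounded_measurable phi.
    by apply: bounded_measurable_sum => p; exact: bounded_measurableZ.
  have pH := psdM (psd_rank1 phi) pG.
  have := @psd_integral_ge0 _ _ _ mu _ pH.
  rewrite (_ : \int[_]_p _ = \sum_(p <- l) \sum_(q <- l) p.1 * q.1 * avg p.2 q.2).
    apply; apply: bounded_measurableM => //; apply: bounded_measurableM.
      exact: bounded_measurable_comp (@measurable_fst _ _ T T) bphi.
    exact: bounded_measurable_comp (@measurable_snd _ _ T T) bphi.
  under eq_Rintegral.
    move=> x _; rewrite (_ : phi x.1 * phi x.2 * G x.1 x.2 =
      \sum_(p <- l) \sum_(r <- l) (p.1 * r.1 * ((q p.2)^-1 * (q r.2)^-1)) *
        (a p.2 x.1 * a r.2 x.2 * G x.1 x.2)); last first.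
      rewrite /phi 2!mulr_suml; apply: eq_bigr => p _.
      by rewrite mulr_sumr mulr_suml; apply: eq_bigr => r _; ring.
    over.
  have bs p r : bounded_measurable (fun x : T * T => p.1 * r.1 * ((q p.2)^-1 * (q r.2)^-1) *
        (a p.2 x.1 * a r.2 x.2 * G x.1 x.2)) by exact: bounded_measurableZ.
  rewrite Rintegral_sum; last by move=> p; apply/bi2/bounded_measurable_sum => r.
  apply: eq_bigr => p _; rewrite Rintegral_sum; last by move=> r; exact: bi2.
  apply: eq_bigr => r _; rewrite RintegralZl//; last exact: bi2.
  by rewrite /avg -/(J _ _); ring.
pose g i j := avg i j + (if i == j then 1 - avg i i else 0).
have avg1 i : avg i i <= 1.
  have := Jqq i i; rewrite ler_norml -avgE => /andP[_].
  have [qi _|qi] := eqVneq (q i) 0; first by rewrite /avg qi invr0 !mul0r.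
  by rewrite ger_pMl// mulr_gt0// lt_neqAle eq_sym qi/=.
exists I, iota, g; split => //.
- by apply: psdD => //; apply: psd_diagonal => i; rewrite subr_ge0.
- by move=> i; rewrite /g eqxx addrC subrK.
set pi2 := (mu \x mu)%E.
pose F (p : T * T) : R := `|G p.1 p.2 - c (iota p.1) (iota p.2)|.
pose D t : R := `|G t t - c (iota t) (iota t)|.
have bF : bounded_measurable F by apply: bounded_measurable_norm; exact: bounded_measurableB.
have bD : bounded_measurable D.
  exact: (@bounded_measurable_comp _ _ _ _ _ F (fun t => (t, t))
    (measurable_fun_pair (@measurable_id _ _ _) (@measurable_id _ _ _)) bF).
(* Off the diagonal, averaging over a cell does not increase the distance to the constant [c i j].
   On it, [g i i] equals [G t t], so the distance to [c i i] is measured by [D], and the remaining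
   factor [q i] is at most [m]. *)
have key i j : `|c i j - g i j| * (q i * q j) <=
    \int[pi2]_p (a i p.1 * a j p.2 * F p) +
    (if i == j then m * \int[mu]_t (a i t * D t) else 0).
  have baaF : bounded_measurable (fun p : T * T => a i p.1 * a j p.2 * F p) by exact: bounded_measurableM.
  have aaF0 : 0 <= \int[pi2]_p (a i p.1 * a j p.2 * F p).
    by apply: Rintegral_ge0 => p _; rewrite mulr_ge0 ?aa0 ?normr_ge0.
  have [<-{j baaF aaF0}|ij] := eqVneq i j.
    apply: (@le_trans _ _ (m * \int[mu]_t (a i t * D t))); last first.
      by rewrite lerDr; apply: Rintegral_ge0 => p _; rewrite mulr_ge0 ?aa0 ?normr_ge0.
    rewrite /g eqxx [avg i i + _]addrC subrK mulrCA ler_pM//.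
    - by rewrite mulr_ge0 ?normr_ge0 ?q0.
    - rewrite /m /q -[fine _]mul1r -Rintegral_cst//; apply: le_Rintegral => //.
      + exact: bi.
      + exact/bi/bounded_measurable_cst.
      + by move=> t _; case/andP: (a01 i t).
    - rewrite -RintegralZl//; last exact: bi.
      apply: le_Rintegral => //.
      + exact/bi/bounded_measurableZ.
      + exact/bi/bounded_measurableM.
      + move=> t _; rewrite mulrC /a indicE; have [|] := boolP (t \in _).
          by rewrite inE /= => it; rewrite /D G1 it distrC.
        by rewrite !mul0r.
  rewrite /g (negbTE ij) !addr0 -(ger0_norm (mulr_ge0 (q0 i) (q0 j))) -normrM.
  rewrite mulrBl avgE -qq -RintegralZl//; last exact: bi2.
  have bc : bounded_measurable (fun p : T * T => c i j * (a i p.1 * a j p.2)) by exact: bounded_measurableZ.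
  rewrite /J -RintegralB//; [|exact: bi2..].
  rewrite (le_trans (le_normr_Rintegral _ (bi2 (bounded_measurableB bc (baaG i j)))))//.
  apply: le_Rintegral => //.
  - exact/bi2/bounded_measurable_norm/bounded_measurableB.
  - exact: bi2.
  - move=> p _; rewrite /F /a !indicE.
    have [|] := boolP (p.1 \in _); last by rewrite /= !(mul0r, mulr0) subrr normr0.
    have [|] := boolP (p.2 \in _); last by rewrite /= !(mul0r, mulr0) subrr normr0.
    by rewrite !inE /= => -> ->; rewrite !mul1r mulr1 distrC.
have bH : bounded_measurable (fun p : T * T => `|c (iota p.1) (iota p.2) - g (iota p.1) (iota p.2)|).
  by apply: bounded_measurable_norm; exact: bounded_measurableB.
apply: (@le_trans _ _ (\int[pi2]_p (F p + `|c (iota p.1) (iota p.2) - g (iota p.1) (iota p.2)|))).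
  apply: le_Rintegral => //.
  - by apply/bi2/bounded_measurable_norm/bounded_measurableB.
  - exact/bi2/bounded_measurableD.
  - move=> p _; rewrite (le_trans _ (ler_normD _ _))//.
    by rewrite le_eqVlt; apply/orP; left; apply/eqP; congr `|_|; ring.
rewrite RintegralD//; [|exact: bi2..].
have sumaa (h : I -> I -> R) (x : T * T) :
    \sum_i \sum_j h i j * (a i x.1 * a j x.2) = h (iota x.1) (iota x.2).
  rewrite (eq_bigr (fun i => h i (iota x.2) * a i x.1)) ?a_sum// => i _.
  rewrite -a_sum mulr_suml; apply: eq_bigr => j _; ring.
have -> : \int[pi2]_p `|c (iota p.1) (iota p.2) - g (iota p.1) (iota p.2)| =
    \sum_i \sum_j `|c i j - g i j| * (q i * q j).
  under eq_Rintegral do rewrite -(sumaa (fun i j => `|c i j - g i j|)).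
  rewrite Rintegral_sum; last first.
    by move=> i; apply/bi2/bounded_measurable_sum => j; exact: bounded_measurableZ.
  apply: eq_bigr => i _; rewrite Rintegral_sum; last first.
    by move=> j; apply/bi2; exact: bounded_measurableZ.
  by apply: eq_bigr => j _; rewrite RintegralZl ?qq//; exact: bi2.
have bound : \sum_i \sum_j `|c i j - g i j| * (q i * q j) <=
    \int[pi2]_p F p + m * \int[mu]_t D t.
  apply: (@le_trans _ _ (\sum_i \sum_j (\int[pi2]_p (a i p.1 * a j p.2 * F p) +
    (if i == j then m * \int[mu]_t (a i t * D t) else 0)))).
    by apply: ler_sum => i _; apply: ler_sum => j _; exact: key.
  under eq_bigr do rewrite big_split /=.
  rewrite big_split /= lerD//.
    rewrite -[X in _ <= X](_ : \int[pi2]_p \sum_i \sum_j (a i p.1 * a j p.2 * F p) = _); last first.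
      apply: eq_Rintegral => p _.
      under eq_bigr do under eq_bigr do rewrite mulrC.
      exact: (sumaa (fun _ _ => F p)).
    rewrite Rintegral_sum; last first.
      by move=> i; apply/bi2/bounded_measurable_sum => j; exact: bounded_measurableM.
    rewrite le_eqVlt; apply/orP; left; apply/eqP; apply: eq_bigr => i _; rewrite Rintegral_sum//.
    by move=> j; exact/bi2/bounded_measurableM.
  rewrite (eq_bigr (fun i => m * \int[mu]_t (a i t * D t))); last first.
    move=> i _; rewrite (bigD1 i)//= eqxx big1 ?addr0// => j.
    by rewrite eq_sym => /negbTE ->.
  rewrite -mulr_sumr -Rintegral_sum; last by move=> i; exact/bi/bounded_measurableM.
  rewrite ler_wpM2l// le_eqVlt; apply/orP; left; apply/eqP.
  apply: eq_Rintegral => t _; under eq_bigr do rewrite mulrC.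
  exact: (a_sum (fun=> D t)).
apply: (@le_trans _ _ (e / (2 + m) + (e / (2 + m) + m * (e / (2 + m))))).
  rewrite lerD// (le_trans bound)// lerD// ler_wpM2l//.
rewrite le_eqVlt; apply/orP; left; apply/eqP; field.
by rewrite gt_eqF// ltr_wpDr.
Qed.

End psd_step_approximation.

(** * Sigma-finite measures and square integrable functions *)

Section ae_product.
Context d1 d2 (T1 : measurableType d1) (T2 : measurableType d2) (R : realType).
Variables (m1 : {sigma_finite_measure set T1 -> \bar R}).
Variables (m2 : {sigma_finite_measure set T2 -> \bar R}).

(** By Tonelli, the masses of the sections of a null set integrate to 0. *)
Lemma ae_product_section (Q : T1 * T2 -> Prop) :
  {ae (m1 \x m2)%E, forall p, Q p} ->
  {ae m1, forall x, {ae m2, forall y, Q (x, y)}}.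
Proof.
move=> [N [mN N0 subN]].
have mphi := measurable_fun_xsection m2 mN.
have : ae_eq m1 setT (m2 \o xsection N) (cst 0%E).
  apply/(ae_eq_integral_abs m1 measurableT mphi).
  rewrite -N0; apply: eq_integral => x _.
  by rewrite /= gee0_abs.
apply: filterS => x /(_ Logic.I) /= Nx0.
exists (xsection N x); split => //; first exact: measurable_xsection.
by move=> y /= nQ; rewrite /xsection /= inE; apply: subN.
Qed.

End ae_product.

Section sigma_finite_weight.
Context d (T : measurableType d) (R : realType).
Variable nu : {measure set T -> \bar R}.
Variable B : nat -> set T.
Hypothesis mB : forall n, measurable (B n).
Hypothesis B_fin : forall n, (nu (B n) < +oo)%E.
Hypothesis B_cover : \bigcup_n B n = setT.

(** A weighted sum of the indicators of the [B n]. It serves as the density of a finite measure, and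
    its square root scales the linear family. *)
Lemma exists_positive_integrable : exists phi : T -> R,
  [/\ measurable_fun setT phi, forall t, 0 < phi t &
      nu.-integrable setT (EFin \o phi)].
Proof.
(* The factors make both [c n] and [c n * nu (B n)] at most the inverse of [2 ^ n.+1], so the series
   is at most 1 everywhere and has integral at most 1. *)
pose c n : R := 1 / (2 ^ n.+1)%:R / (1 + fine (nu (B n))).
have nuB n : 0 <= fine (nu (B n)) by exact: fine_ge0.
have p2 n : 0 < (2 ^ n.+1)%:R :> R by rewrite ltr0n expn_gt0.
have c0 n : 0 < c n by rewrite !divr_gt0// ltr_wpDr.
have c1 n : c n <= 1 / (2 ^ n.+1)%:R.
  apply: ler_piMr; first by rewrite ltW// divr_gt0.
  by rewrite invf_le1 ?lerDl// ltr_wpDr.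
have cB n : c n * fine (nu (B n)) <= 1 / (2 ^ n.+1)%:R.
  rewrite (_ : c n * _ = 1 / (2 ^ n.+1)%:R *
    ((1 + fine (nu (B n)))^-1 * fine (nu (B n)))); last by rewrite /c mulrA.
  apply: ler_piMr; first by rewrite ltW// divr_gt0.
  by rewrite mulrC ler_pdivrMr ?mul1r ?lerDr// ltr_wpDr.
pose phie (t : T) : \bar R := (\sum_(0 <= n <oo) (c n * \1_(B n) t)%:E)%E.
have cI0 n t : (0 <= (c n * \1_(B n) t)%:E)%E.
  by rewrite lee_fin mulr_ge0 ?indicE ?ler0n// ltW.
have mcI n : measurable_fun setT (fun t => (c n * \1_(B n) t)%:E).
  by apply/measurable_EFinP; apply: measurable_funM => //; exact: measurable_indic.
have mphie : measurable_fun setT phie.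
  by apply: ge0_emeasurable_sum.
have phie1 t : (phie t <= 1)%E.
  apply: (@le_trans _ _ (\sum_(0 <= n <oo) (1 / (2 ^ n.+1)%:R)%:E)%E).
    apply: lee_nneseries => n _ //.
    rewrite lee_fin (le_trans _ (c1 n))//; apply: ler_piMr; first exact: ltW.
    by rewrite indicE; case: (_ \in _).
  exact: (epsilon_trick0 xpredT ler01).
have phie0 t : (0 < phie t)%E.
  have : (\bigcup_n B n) t by rewrite B_cover.
  move=> [n _ Bnt]; rewrite /phie.
  apply: lt_le_trans (nneseries_lim_ge n.+1 (fun k _ _ => cI0 k t)).
  rewrite big_nat_recr//= indicE mem_set// mulr1.
  apply: (@lt_le_trans _ _ (c n)%:E); first by rewrite lte_fin.
  by apply: leeDr; apply: sume_ge0 => k _.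
have phiefin t : phie t \is a fin_num.
  by rewrite ge0_fin_numE ?(ltW (phie0 t))// (le_lt_trans (phie1 t))// ltry.
exists (fine \o phie); split.
- by apply: measurableT_comp => //; exact: fine_measurable.
- by move=> t /=; rewrite fine_gt0// phie0 (le_lt_trans (phie1 t))// ltry.
- apply/integrableP; split.
    apply/measurable_EFinP; apply: measurableT_comp => //; exact: fine_measurable.
  rewrite (eq_integral phie); last first.
    by move=> t _; rewrite /= ger0_norm ?fineK// fine_ge0// ltW.
  rewrite /phie integral_nneseries//.
  apply: (@le_lt_trans _ _ (\sum_(0 <= n <oo) (1 / (2 ^ n.+1)%:R)%:E)%E); last first.
    by rewrite (le_lt_trans (epsilon_trick0 xpredT ler01))// ltry.
  apply: lee_nneseries => n _.
    by move=> _; apply: integral_ge0 => t _; exact: cI0.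
  under eq_integral do rewrite EFinM.
  rewrite ge0_integralZl//; first last.
  - by rewrite lee_fin ltW.
  - by apply/measurable_EFinP; exact: measurable_indic.
  rewrite integral_indic// setIT -(@fineK _ (nu (B n))) ?ge0_fin_numE//.
  by rewrite -EFinM lee_fin.
Qed.

(** The measure with the positive density [phi] creates no new null sets. Averaging over cells needs
    its finiteness; almost everywhere statements are then carried back to [nu]. *)
Lemma exists_dominating_finite_measure :
  exists mu : {finite_measure set T -> \bar R},
    forall A, measurable A -> mu A = 0%E -> nu A = 0%E.
Proof.
have [phi [mphi phi0 iphi]] := exists_positive_integrable.
have mphi' : measurable_fun setT (EFin \o phi) by exact/measurable_EFinP.
pose m (A : set T) : \bar R := (\int[nu]_(x in A) (phi x)%:E)%E.
have m0 : m set0 = 0%E by rewrite /m integral_set0.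
have m_ge0 A : (0 <= m A)%E.
  by apply: integral_ge0 => x _; rewrite lee_fin ltW.
have m_sa : semi_sigma_additive m.
  move=> A mA tA mUA; rewrite /m ge0_integral_bigcup//; last 2 first.
  - exact: measurable_funTS.
  - by move=> x _; rewrite lee_fin ltW.
  apply: is_cvg_ereal_nneg_natsum_cond => n _ _.
  by apply: integral_ge0 => x _; rewrite lee_fin ltW.
pose m1 := isMeasure.Build _ _ _ m m0 m_ge0 m_sa.
have m_fin : fin_num_fun m.
  move=> A mA; rewrite ge0_fin_numE//.
  apply: (@le_lt_trans _ _ (\int[nu]_x (phi x)%:E)%E).
    apply: ge0_subset_integral => // x _; by rewrite lee_fin ltW.
  have /integrableP[_] := iphi.
  by under eq_integral do rewrite /= ger0_norm ?ltW//.
pose M : {measure set T -> \bar R} := HB.pack m m1.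
pose m2 := Measure_isFinite.Build _ _ _ M m_fin.
pose M' : {finite_measure set T -> \bar R} := HB.pack m m1 m2.
exists M' => A mA /= mA0.
have : ae_eq nu A (EFin \o phi) (cst 0%E).
  apply/(ae_eq_integral_abs nu mA); first exact: measurable_funTS.
  rewrite -[RHS]mA0; apply: eq_integral => x _.
  by rewrite /= ger0_norm// ltW.
move=> [N [mN N0 subN]]; apply/eqP; rewrite -measure_le0 -N0.
apply: le_measure; rewrite ?inE// => x Ax; apply: subN => /= /(_ Ax) [].
by apply/eqP; rewrite gt_eqF.
Qed.

End sigma_finite_weight.

Section weak_convergence.
Context d (T : measurableType d) (R : realType).
Variable nu : {measure set T -> \bar R}.

Definition sqint (f : T -> R) : \bar R := (\int[nu]_t (f t ^+ 2)%:E)%E.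

Definition L2 (f : T -> R) : Prop :=
  measurable_fun setT f /\ (sqint f < +oo)%E.

Lemma sqint_ge0 (f : T -> R) : (0 <= sqint f)%E.
Proof. by apply: integral_ge0 => x _; rewrite lee_fin sqr_ge0. Qed.

Lemma L2_sqr_integrable (f : T -> R) : L2 f ->
  nu.-integrable setT (EFin \o (fun t => f t ^+ 2)).
Proof.
move=> [mf sf]; apply/integrableP; split.
  by apply/measurable_EFinP; exact: measurable_funX.
by under eq_integral do rewrite /= ger0_norm ?sqr_ge0//.
Qed.

Lemma L2_sqintE (f : T -> R) : L2 f -> sqint f = (\int[nu]_t f t ^+ 2)%:E.
Proof.
by move=> Lf; rewrite /Rintegral fineK//; exact: integrable_fin_num (L2_sqr_integrable Lf).
Qed.

Lemma L2M_integrable (f g : T -> R) : L2 f -> L2 g ->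
  nu.-integrable setT (EFin \o (fun t => f t * g t)).
Proof.
move=> Lf Lg.
apply: (le_integrable measurableT _ _
  (integrableD measurableT (L2_sqr_integrable Lf) (L2_sqr_integrable Lg))).
  by apply/measurable_EFinP; apply: measurable_funM; [exact: Lf.1|exact: Lg.1].
move=> t _ /=; rewrite lee_fin [leRHS]ger0_norm ?addr_ge0 ?sqr_ge0//.
have := sqr_ge0 (`|f t| - `|g t|).
rewrite normrM sqrrB !real_normK ?num_real//.
have : 0 <= `|f t| * `|g t| by rewrite mulr_ge0.
set x := `|f t| * `|g t|; lra.
Qed.

Lemma L2_bounded (f w : T -> R) : L2 f -> bounded_measurable w ->
  L2 (fun t => w t * f t).
Proof.
move=> Lf [mw [M wM]]; split; first by apply: measurable_funM => //; exact: Lf.1.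
apply: (@le_lt_trans _ _ (\int[nu]_t ((M ^+ 2)%:E * (f t ^+ 2)%:E))%E).
  apply: ge0_le_integral => //.
  - by move=> t _; rewrite lee_fin sqr_ge0.
  - apply/measurable_EFinP/measurable_funX/measurable_funM => //; exact: Lf.1.
  - by apply/measurable_EFinP; apply: measurable_funM => //; apply/measurable_funX; exact: Lf.1.
  - move=> t _; rewrite lee_fin exprMn ler_wpM2r ?sqr_ge0//.
    by rewrite -(real_normK (num_real (w t))) lerXn2r ?nnegrE// (le_trans _ (wM t)).
rewrite ge0_integralZl ?lee_fin ?sqr_ge0//.
- by rewrite lte_mul_pinfty ?lee_fin ?sqr_ge0//; exact: Lf.2.
- by apply/measurable_EFinP/measurable_funX; exact: Lf.1.
- by move=> t _; rewrite lee_fin sqr_ge0.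
Qed.

Lemma L2B_bound (f g : T -> R) (D : R) :
  measurable_fun setT f -> measurable_fun setT g ->
  (sqint f <= D%:E)%E -> (sqint g <= D%:E)%E ->
  (sqint (fun t => (f t - g t)%R) <= (4 * D)%:E)%E.
Proof.
move=> mf mg fD gD.
apply: (@le_trans _ _ (\int[nu]_t (2%:E * (f t ^+ 2)%:E + 2%:E * (g t ^+ 2)%:E))%E).
  apply: ge0_le_integral => //.
  - by move=> t _; rewrite lee_fin sqr_ge0.
  - by apply/measurable_EFinP/measurable_funX/measurable_funB.
  - by apply: emeasurable_funD; apply: measurable_funeM; apply/measurable_EFinP/measurable_funX.
  - move=> t _; rewrite -!EFinM -EFinD lee_fin -subr_ge0.
    by rewrite (_ : _ - _ = (f t + g t) ^+ 2) ?sqr_ge0//; ring.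
rewrite ge0_integralD//; first last.
- by apply: measurable_funeM; apply/measurable_EFinP/measurable_funX.
- by move=> t _; rewrite -EFinM lee_fin mulr_ge0 ?sqr_ge0.
- by apply: measurable_funeM; apply/measurable_EFinP/measurable_funX.
- by move=> t _; rewrite -EFinM lee_fin mulr_ge0 ?sqr_ge0.
rewrite !ge0_integralZl//; first last.
- by move=> t _; rewrite lee_fin sqr_ge0.
- by apply/measurable_EFinP/measurable_funX.
- by move=> t _; rewrite lee_fin sqr_ge0.
- by apply/measurable_EFinP/measurable_funX.
rewrite (_ : 4 * D = 2 * D + 2 * D); last by ring.
rewrite (_ : (2 * D + 2 * D)%:E = 2%:E * D%:E + 2%:E * D%:E)%E; last first.
  by rewrite -!EFinM -EFinD.
by apply: leeD; apply: lee_wpmul2l => //; rewrite lee_fin.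
Qed.

(* Truncating the difference [d = f_ k - f] at [M |h|] gives the pointwise bound
   [|h| |d| <= |h| min(|d|, M |h|) + d^2 / M]: dominated convergence applies to
   the first term and the second is uniformly small for large [M]. *)
Lemma weak_cvg_of_ae_bounded (f_ : nat -> T -> R) (f h : T -> R) (D : R) :
  (forall k, measurable_fun setT (f_ k)) -> measurable_fun setT f -> L2 h ->
  {ae nu, forall t, f_ ^~ t @ \oo --> f t} ->
  (forall k, (sqint (f_ k) <= D%:E)%E) ->
  L2 f /\ \int[nu]_t (h t * f_ k t) @[k --> \oo] --> \int[nu]_t (h t * f t).
Proof.
move=> mf_ mf Lh f_f fD.
have fD' : (sqint f <= D%:E)%E.
  apply: (@fatou_bound _ _ _ nu (fun k t => ((f_ k t) ^+ 2)%:E)) => //.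
  - by move=> k; apply/measurable_EFinP/measurable_funX.
  - by apply/measurable_EFinP/measurable_funX.
  - by move=> k t; rewrite lee_fin sqr_ge0.
  - by move=> t; rewrite lee_fin sqr_ge0.
  - apply: filterS f_f => t ft; apply: cvg_EFin; first exact: nearW.
    under eq_fun do rewrite expr2; rewrite expr2; exact: cvgM.
have Lf : L2 f by split => //; exact: (le_lt_trans fD' (ltry _)).
have Lf_ k : L2 (f_ k) by split => //; exact: (le_lt_trans (fD k) (ltry _)).
split => //.
have D0 : 0 <= D by rewrite -lee_fin; exact: le_trans (sqint_ge0 f) fD'.
apply/cvgrPdist_le => e e0.
(* The squared norm of the difference is at most [4 * D] by [L2B_bound], so the second term is at
   most [4 * D / M], hence at most [e / 2]; the 1 keeps [M] positive when [D = 0]. *)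
pose M := 8 * D / e + 1.
have M0 : 0 < M by rewrite ltr_wpDl// divr_ge0// ?mulr_ge0// ltW.
have De : 4 * D / M <= e / 2.
  rewrite ler_pdivrMr// /M mulrDr mulr1.
  rewrite (_ : e / 2 * (8 * D / e) = 4 * D); last by field; rewrite gt_eqF.
  by rewrite lerDl divr_ge0// ltW.
pose p_ k t : R := `|h t| * Num.min `|f_ k t - f t| (M * `|h t|).
have mh := Lh.1.
have mp k : measurable_fun setT (p_ k).
  apply: measurable_funM; first exact: measurableT_comp.
  apply: measurable_minr; first by apply: measurableT_comp => //; exact: measurable_funB.
  by apply: measurable_funM => //; exact: measurableT_comp.
have pM k t : 0 <= p_ k t <= M * h t ^+ 2.
  rewrite /p_ mulr_ge0//=; last by rewrite le_min normr_ge0 mulr_ge0// ltW.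
  have mr : Num.min `|f_ k t - f t| (M * `|h t|) <= M * `|h t|.
    by rewrite ge_min lexx orbT.
  rewrite (le_trans (ler_wpM2l _ mr))//.
  by rewrite mulrCA -expr2 real_normK ?num_real.
have iMh : nu.-integrable setT (EFin \o (fun t => M * h t ^+ 2)).
  by have := integrableZl measurableT M (L2_sqr_integrable Lh).
have [] := @dominated_Rintegral _ _ _ nu p_ (cst 0) (fun t => M * h t ^+ 2) => //.
- apply: filterS f_f => t ft.
  have c1 : `|f_ k t - f t| @[k --> \oo] --> (0 : R).
    rewrite -(@normr0 _ R) -(subrr (f t)).
    by apply: cvg_norm; apply: cvgB => //; exact: cvg_cst.
  apply: (@squeeze_cvgr _ _ _ _ (cst 0) (fun k => `|h t| * `|f_ k t - f t|)).
  + by apply: nearW => k; case/andP: (pM k t) => -> _ /=; rewrite /p_ ler_wpM2l// ge_min lexx.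
  + exact: cvg_cst.
  + by rewrite /= -(mulr0 `|h t|); apply: cvgMl_tmp.
- by move=> k t; case/andP: (pM k t) => ? ?; rewrite ger0_norm.
rewrite Rintegral_cst// mul0r => _ /cvgrPdist_le /(_ (e / 2)).
rewrite divr_gt0// => /(_ isT); apply: filterS => k.
rewrite sub0r normrN => pk.
have ihf := L2M_integrable Lh Lf.
have ihfk := L2M_integrable Lh (Lf_ k).
rewrite -RintegralB//.
have ihd := integrableB measurableT ihf ihfk.
have Ld : L2 (fun t => f_ k t - f t).
  split; first exact: measurable_funB.
  by apply: (le_lt_trans (L2B_bound _ _ (fD k) fD')) => //; rewrite ltry.
have ip : nu.-integrable setT (EFin \o p_ k).
  apply: (le_integrable measurableT _ _ iMh); first exact/measurable_EFinP.
  move=> t _ /=; rewrite lee_fin; case/andP: (pM k t) => ? ?.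
  by rewrite ger0_norm// ger0_norm// mulr_ge0 ?sqr_ge0// ltW.
have id2 : nu.-integrable setT (EFin \o (fun t => M^-1 * (f_ k t - f t) ^+ 2)).
  by have := integrableZl measurableT M^-1 (L2_sqr_integrable Ld).
apply: (le_trans (le_normr_Rintegral measurableT ihd)).
apply: (@le_trans _ _ (\int[nu]_t (p_ k t + M^-1 * (f_ k t - f t) ^+ 2))).
  apply: le_Rintegral => //.
  - exact: (integrable_norm ihd).
  - exact: (integrableD measurableT ip id2).
  - move=> t _; rewrite -mulrBr normrM distrC /p_.
    have [le|gt] := leP `|f_ k t - f t| (M * `|h t|).
      by rewrite lerDl mulr_ge0 ?sqr_ge0// invr_ge0 ltW.
    apply: (@le_trans _ _ (M^-1 * (f_ k t - f t) ^+ 2)); last first.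
      by rewrite lerDr mulr_ge0// mulr_ge0// ltW.
    rewrite -(real_normK (num_real (f_ k t - f t))) expr2 mulrA ler_wpM2r//.
    by rewrite mulrC ler_pdivlMr// mulrC ltW.
rewrite RintegralD// RintegralZl//; last exact: L2_sqr_integrable.
have : \int[nu]_t (f_ k t - f t) ^+ 2 <= 4 * D.
  by rewrite -lee_fin -L2_sqintE//; exact: L2B_bound.
rewrite -(ler_pM2l (_ : 0 < M^-1)) ?invr_gt0// => dk.
have := ler_norm (\int[nu]_t p_ k t).
move: De; rewrite mulrC => De.
by move: pk dk De; lra.
Qed.

End weak_convergence.

(** * Schur multipliers *)

Section schur_multiplier.
Context d (T : measurableType d) (R : realType).
Variable nu : {sigma_finite_measure set T -> \bar R}.

Local Notation L2 := (L2 nu).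
Local Notation sqint := (sqint nu).

Definition apply_op (K : T -> T -> R) (h : T -> R) (t : T) : R :=
  \int[nu]_s (K t s * h s).

Definition ae_integrable_op (K : T -> T -> R) (h : T -> R) : Prop :=
  {ae nu, forall t, nu.-integrable setT (fun s => (K t s * h s)%:E)}.

(** No integrability is assumed: the integral is the difference of those of the positive and
    negative parts, and Tonelli's theorem applies to each. *)
Lemma measurable_section_integral (f : T * T -> R) : measurable_fun setT f ->
  measurable_fun setT (fun t => (\int[nu]_s (f (t, s))%:E)%E).
Proof.
move=> mf; have mf' : measurable_fun setT (EFin \o f) by exact/measurable_EFinP.
under eq_fun do rewrite integralE.
apply: emeasurable_funB.
- rewrite (_ : (fun t => _) = fubini_F nu (EFin \o f)^\+%E); last first.
    apply/funext => t; apply: eq_integral => s _.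
    exact: (congr1 (fun g => g s) (funepos_comp (EFin \o f) (pair t))).
  by apply: measurable_fun_fubini_tonelli_F => //; exact: measurable_funepos.
- rewrite (_ : (fun t => _) = fubini_F nu (EFin \o f)^\-%E); last first.
    apply/funext => t; apply: eq_integral => s _.
    exact: (congr1 (fun g => g s) (funeneg_comp (EFin \o f) (pair t))).
  by apply: measurable_fun_fubini_tonelli_F => //; exact: measurable_funeneg.
Qed.

Lemma measurable_kernel_fun (K : T -> T -> R) (h : T -> R) :
  measurable_fun setT (fun p : T * T => K p.1 p.2) -> measurable_fun setT h ->
  measurable_fun setT (fun p : T * T => K p.1 p.2 * h p.2).
Proof.
move=> mK mh; apply: measurable_funM => //.
exact: (measurableT_comp mh (@measurable_snd _ _ T T)).
Qed.

Lemma measurable_apply_op (K : T -> T -> R) (h : T -> R) :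
  measurable_fun setT (fun p : T * T => K p.1 p.2) -> measurable_fun setT h ->
  measurable_fun setT (apply_op K h).
Proof.
move=> mK mh; apply: measurableT_comp; first exact: fine_measurable.
exact: (measurable_section_integral (measurable_kernel_fun mK mh)).
Qed.

Lemma measurable_kernel_section (K : T -> T -> R) (t : T) :
  measurable_fun setT (fun p : T * T => K p.1 p.2) ->
  measurable_fun setT (K t).
Proof. by move=> mK; exact: (measurableT_comp mK (pair1_measurable t)). Qed.

(** For almost every [t] the inner integrand is integrable and [h t] comes out of it. The resulting
    single integral is the one that is estimated and passed to the limit. *)
Lemma bilinear_formE (K : T -> T -> R) (h : T -> R) :
  measurable_fun setT (fun p : T * T => K p.1 p.2) -> measurable_fun setT h ->
  (forall s t, K s t = K t s) -> ae_integrable_op K h ->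
  (\int[nu]_t \int[nu]_s (K s t * h s * h t)%:E)%E =
  (\int[nu]_t (h t * apply_op K h t)%:E)%E.
Proof.
move=> mK mh sK iK; apply: ae_eq_integral => //.
- apply: (measurable_section_integral (f := fun p => K p.2 p.1 * h p.2 * h p.1)).
  apply: measurable_funM; last exact: (measurableT_comp mh (@measurable_fst _ _ T T)).
  under eq_fun do rewrite sK; exact: measurable_kernel_fun.
- by apply/measurable_EFinP/measurable_funM => //; exact: measurable_apply_op.
- apply: filterS iK => t it _.
  under eq_integral do rewrite sK EFinM.
  rewrite integralZr// muleC /apply_op EFinM /Rintegral fineK//.
  exact: integrable_fin_num.
Qed.

(** Of the partition only the finite factorisation is retained; the factors are bounded so that
    multiplying by them preserves [L2]. *)
Definition step_kernel (S : T -> T -> R) : Prop :=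
  exists n (w : nat -> T -> R), [/\ forall k, bounded_measurable (w k),
    forall t, \sum_(k < n) w k t ^+ 2 = 1 &
    forall s t, S s t = \sum_(k < n) w k s * w k t].

Lemma step_kernel_norm_le1 (S : T -> T -> R) (s t : T) :
  step_kernel S -> `|S s t| <= 1.
Proof.
move=> [n [w [_ w1 SE]]]; apply: psd_norm_le1.
  rewrite (_ : S = fun s t => \sum_(k < n) w k s * w k t).
    by apply: (psd_sum (G := fun k s t => w k s * w k t)) => k; exact: psd_rank1.
  by apply/funext => x; apply/funext => y.
by move=> x; rewrite SE -(w1 x); apply: eq_bigr => k _; rewrite expr2.
Qed.

Lemma measurable_step_kernel (S : T -> T -> R) : step_kernel S ->
  measurable_fun setT (fun p : T * T => S p.1 p.2).
Proof.
move=> [n [w [bw _ SE]]]; under eq_fun do rewrite SE.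
apply: measurable_sum => k; apply: measurable_funM.
- exact: (measurableT_comp (bw k).1 (@measurable_fst _ _ T T)).
- exact: (measurableT_comp (bw k).1 (@measurable_snd _ _ T T)).
Qed.

(** The errors, at most the inverse of [2 ^ k.+1], are summable, which upgrades convergence in mean
    to convergence almost everywhere. The conclusion is stated by sections because null sets are
    transferred from [mu] to [nu] one variable at a time. *)
Lemma psd_ae_step_kernel (mu : {finite_measure set T -> \bar R}) (G : T -> T -> R) :
  (forall A, measurable A -> mu A = 0%E -> nu A = 0%E) ->
  psd G -> (forall t, G t t = 1) ->
  measurable_fun setT (fun p : T * T => G p.1 p.2) ->
  exists S_ : nat -> T -> T -> R, (forall k, step_kernel (S_ k)) /\
    {ae nu, forall t, {ae nu, forall s, S_ ^~ t ^~ s @ \oo --> G t s}}.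
Proof.
move=> mu_nu pG G1 mG.
have ae_mu_nu (Q : T -> Prop) : {ae mu, forall t, Q t} -> {ae nu, forall t, Q t}.
  by move=> [N [mN N0 subN]]; exists N; split => //; exact: mu_nu.
have : forall k : nat, exists S, step_kernel S /\
    \int[(mu \x mu)%E]_p `|G p.1 p.2 - S p.1 p.2| <= 1 / (2 ^ k.+1)%:R.
  move=> k; have e0 : 0 < 1 / (2 ^ k.+1)%:R :> R by rewrite divr_gt0// ltr0n expn_gt0.
  have [I [iota [g [mi pg g1 ge]]]] := psd_step_approximation mu pG G1 mG e0.
  exists (fun s t => g (iota s) (iota t)); split => //.
  have [n [w [_ wg]]] := psd_gram (enum I) pg.
  exists n, (fun k t => w k (iota t)); split.
  - by move=> j; exact: (bounded_measurable_fin (w j) mi).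
  - by move=> t; rewrite -(g1 (iota t)) wg ?mem_enum.
  - by move=> s t; rewrite wg ?mem_enum.
move=> /choice [S_ HS]; exists S_; split; first by move=> k; exact: (HS k).1.
apply: (ae_mu_nu (fun t => {ae nu, forall s, S_ ^~ t ^~ s @ \oo --> G t s})).
suff : {ae (mu \x mu)%E, forall p : T * T, S_ ^~ p.1 ^~ p.2 @ \oo --> G p.1 p.2}.
  move=> /ae_product_section; apply: filterS => t; exact: ae_mu_nu.
pose D k (p : T * T) : R := `|G p.1 p.2 - S_ k p.1 p.2|.
have bD k : bounded_measurable (D k).
  apply: bounded_measurable_norm; apply: bounded_measurableB.
    by split => //; exists 1 => p; exact: psd_norm_le1.
  split; first exact: measurable_step_kernel (HS k).1.
  by exists 1 => p; apply: step_kernel_norm_le1; exact: (HS k).1.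
have mD k : measurable_fun setT (EFin \o D k) by apply/measurable_EFinP; exact: (bD k).1.
have D0 k p : (0 <= (D k p)%:E)%E by rewrite lee_fin /D normr_ge0.
(* The sum of all errors has finite integral, so it is finite almost everywhere and its terms tend
   to 0 there. *)
pose E (p : T * T) : \bar R := (\sum_(0 <= k <oo) (D k p)%:E)%E.
have mE : measurable_fun setT E.
  by apply: ge0_emeasurable_sum => [k p _ _|k _]; [exact: D0|exact: mD].
have iE : (mu \x mu)%E.-integrable setT E.
  apply/integrableP; split => //.
  rewrite (eq_integral E); last first.
    by move=> p _; rewrite gee0_abs//; apply: nneseries_ge0.
  rewrite /E integral_nneseries//.
  apply: (@le_lt_trans _ _ (\sum_(0 <= k <oo) (1 / (2 ^ k.+1)%:R)%:E)%E); last first.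
    by rewrite (le_lt_trans (epsilon_trick0 xpredT ler01))// ltry.
  apply: lee_nneseries => k _.
    by move=> _; apply: integral_ge0 => p _; exact: D0.
  rewrite -[leLHS]fineK ?lee_fin; first exact: (HS k).2.
  exact: integrable_fin_num (bounded_measurable_integrable_prod mu mu (bD k)).
apply: filterS (integrable_ae measurableT iE) => p /(_ Logic.I) Efin.
have Dlt : (\sum_(0 <= k <oo) (D k p)%:E < +oo)%E.
  by rewrite -ge0_fin_numE//; apply: nneseries_ge0.
have Dge k : 0 <= D k p by rewrite /D normr_ge0.
have := cvg_series_cvg_0 (nnseries_is_cvg Dge Dlt).
move=> D_0; apply/cvgrPdist_le => e e0.
move/cvgrPdist_le : D_0 => /(_ _ e0); apply: filterS => k.
by rewrite sub0r normrN /D normr_id.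
Qed.

Section kernel.
Variables (K : T -> T -> R) (C : R).
Hypothesis mK : measurable_fun setT (fun p : T * T => K p.1 p.2).
Hypothesis K_int : forall h, L2 h -> ae_integrable_op K h.
Hypothesis K_bound : forall h, L2 h ->
  (sqint (apply_op K h) <= C%:E * sqint h)%E.
Hypothesis C_ge0 : 0 <= C.

Lemma L2_apply_op (h : T -> R) : L2 h -> L2 (apply_op K h).
Proof.
move=> Lh; split; first by apply: measurable_apply_op => //; exact: Lh.1.
apply: (le_lt_trans (K_bound Lh)).
by rewrite lte_mul_pinfty ?lee_fin//; exact: Lh.2.
Qed.

Lemma Schur_integrable (G : T -> T -> R) (h : T -> R) :
  measurable_fun setT (fun p : T * T => G p.1 p.2) ->
  (forall s t, `|G s t| <= 1) -> L2 h ->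
  ae_integrable_op (fun t s => K t s * G t s) h.
Proof.
move=> mG G1 Lh; apply: filterS (K_int Lh) => t it.
apply: (le_integrable measurableT _ _ it).
  apply/measurable_EFinP/measurable_funM; last exact: Lh.1.
  by apply: measurable_funM; exact: measurable_kernel_section.
by move=> s _; rewrite lee_fin mulrAC normrM ler_piMr.
Qed.

Lemma apply_op_step (n : nat) (w : nat -> T -> R) (S : T -> T -> R) (h : T -> R) :
  (forall k, bounded_measurable (w k)) ->
  (forall s t, S s t = \sum_(k < n) w k s * w k t) -> L2 h ->
  {ae nu, forall t, apply_op (fun t s => K t s * S t s) h t =
    \sum_(k < n) w k t * apply_op K (fun s => w k s * h s) t}.
Proof.
move=> bw SE Lh.
have : {ae nu, forall t, forall k, nu.-integrable setT (fun s => (K t s * (w k s * h s))%:E)}.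
  by apply: ae_foralln => k; apply: K_int; exact: L2_bounded.
apply: filterS => t it; rewrite /apply_op.
transitivity (\int[nu]_s \sum_(k < n) w k t * (K t s * (w k s * h s))).
  apply: eq_Rintegral => s _; rewrite SE mulr_sumr mulr_suml.
  by apply: eq_bigr => k _; ring.
rewrite (@Rintegral_sum _ _ _ nu _ (index_enum 'I_n) (fun k s => w k t * (K t s * (w k s * h s)))).
  by apply: eq_bigr => k _; rewrite RintegralZl//; exact: it.
by move=> k; have := integrableZl measurableT (w k t) (it k).
Qed.

(** The squared distance from [x] to its projection [X * w] on the unit vector [w] is
    nonnegative. *)
Lemma sqr_sum_weighted (n : nat) (w x : nat -> R) : \sum_(k < n) w k ^+ 2 = 1 ->
  (\sum_(k < n) w k * x k) ^+ 2 <= \sum_(k < n) x k ^+ 2.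
Proof.
move=> w1; set X := \sum_(k < n) w k * x k.
have : 0 <= \sum_(k < n) (x k - X * w k) ^+ 2 by apply: sumr_ge0 => k _; exact: sqr_ge0.
have -> : \sum_(k < n) (x k - X * w k) ^+ 2 =
    \sum_(k < n) x k ^+ 2 - X * 2 * X + X ^+ 2 * \sum_(k < n) w k ^+ 2.
  have -> : X * 2 * X = \sum_(k < n) X * 2 * (w k * x k) by rewrite -mulr_sumr.
  rewrite mulr_sumr -sumrB -big_split /=.
  by apply: eq_bigr => k _; ring.
by rewrite w1; lra.
Qed.

Lemma sqint_sum (n : nat) (f : nat -> T -> R) :
  (forall k, measurable_fun setT (f k)) ->
  (\int[nu]_t (\sum_(k < n) f k t ^+ 2)%:E = \sum_(k < n) sqint (f k))%E.
Proof.
move=> mf; under eq_integral do rewrite -sumEFin.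
rewrite ge0_integral_sum//.
- by move=> k; apply/measurable_EFinP/measurable_funX.
- by move=> k t _; rewrite lee_fin sqr_ge0.
Qed.

(** Cauchy-Schwarz against the unit vector of the [w k t] bounds the square by the sum of squares of
    [K] applied to the [w k * h], and the [w k * h] share out the squared norm of [h]. The constant
    is the same for all step kernels, as weak convergence requires. *)
Lemma step_op_bound (S : T -> T -> R) (h : T -> R) : step_kernel S -> L2 h ->
  (sqint (apply_op (fun t s => K t s * S t s)%R h) <= C%:E * sqint h)%E.
Proof.
move=> /[dup] sS [n [w [bw w1 SE]]] Lh.
have Lwh k : L2 (fun s => w k s * h s) by exact: L2_bounded.
have mh := Lh.1.
have mKS : measurable_fun setT (fun p : T * T => K p.1 p.2 * S p.1 p.2).
  by apply: measurable_funM => //; exact: measurable_step_kernel.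
apply: (@le_trans _ _ (\int[nu]_t
    (\sum_(k < n) apply_op K (fun s => w k s * h s) t ^+ 2)%:E)%E).
  apply: ae_ge0_le_integral => //.
  - by move=> t _; rewrite lee_fin sqr_ge0.
  - by apply/measurable_EFinP/measurable_funX; apply: measurable_apply_op.
  - by move=> t _; rewrite lee_fin sumr_ge0// => k _; exact: sqr_ge0.
  - apply/measurable_EFinP/measurable_sum => k; apply/measurable_funX.
    exact: (L2_apply_op (Lwh k)).1.
  - apply: filterS (apply_op_step bw SE Lh) => t -> _; rewrite lee_fin.
    exact: (@sqr_sum_weighted n (w ^~ t)
      (fun k => apply_op K (fun s => w k s * h s) t) (w1 t)).
rewrite (sqint_sum n (f := fun k => apply_op K (fun s => w k s * h s))); last first.
  by move=> k; exact: (L2_apply_op (Lwh k)).1.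
apply: (@le_trans _ _ (\sum_(k < n) C%:E * sqint (fun s => w k s * h s)%R)%E).
  by apply: lee_sum => k _; exact: K_bound.
rewrite -ge0_sume_distrr; last by move=> k _; exact: sqint_ge0.
rewrite -(sqint_sum n (f := fun k s => w k s * h s)); last by move=> k; exact: (Lwh k).1.
rewrite le_eqVlt; apply/orP; left; apply/eqP; congr (_ * _)%E.
apply: eq_integral => t _; congr EFin.
by under eq_bigr do rewrite exprMn; rewrite -mulr_suml w1 mul1r.
Qed.

Variable lambda : R.
Hypothesis K_lower : forall g, L2 g ->
  lambda * \int[nu]_t g t ^+ 2 <= \int[nu]_t (g t * apply_op K g t).

Lemma step_op_lower (S : T -> T -> R) (h : T -> R) : step_kernel S -> L2 h ->
  lambda * \int[nu]_t h t ^+ 2 <=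
  \int[nu]_t (h t * apply_op (fun t s => K t s * S t s) h t).
Proof.
move=> /[dup] sS [n [w [bw w1 SE]]] Lh.
have Lwh k : L2 (fun s => w k s * h s) by exact: L2_bounded.
have mh := Lh.1.
have mKS : measurable_fun setT (fun p : T * T => K p.1 p.2 * S p.1 p.2).
  by apply: measurable_funM => //; exact: measurable_step_kernel.
have iwh k := L2_sqr_integrable (Lwh k).
have iform k := L2M_integrable (Lwh k) (L2_apply_op (Lwh k)).
have -> : \int[nu]_t h t ^+ 2 = \sum_(k < n) \int[nu]_t (w k t * h t) ^+ 2.
  rewrite -(@Rintegral_sum _ _ _ nu _ (index_enum 'I_n) (fun k t => (w k t * h t) ^+ 2));
    last by move=> k; exact: iwh.
  apply: eq_Rintegral => t _.
  by under eq_bigr do rewrite exprMn; rewrite -mulr_suml w1 mul1r.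
have -> : \int[nu]_t (h t * apply_op (fun t s => K t s * S t s) h t) =
    \sum_(k < n) \int[nu]_t ((w k t * h t) * apply_op K (fun s => w k s * h s) t).
  rewrite -(@Rintegral_sum _ _ _ nu _ (index_enum 'I_n)
    (fun k t => (w k t * h t) * apply_op K (fun s => w k s * h s) t));
    last by move=> k; exact: iform.
  congr fine; apply: ae_eq_integral => //.
  - by apply/measurable_EFinP/measurable_funM => //; exact: measurable_apply_op.
  - apply/measurable_EFinP/measurable_sum => k; apply: measurable_funM; first exact: (Lwh k).1.
    exact: (L2_apply_op (Lwh k)).1.
  - apply: filterS (apply_op_step bw SE Lh) => t -> _.
    by rewrite mulr_sumr; congr EFin; apply: eq_bigr => k _; ring.
by rewrite mulr_sumr; apply: ler_sum => k _; exact: K_lower.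
Qed.

(** At almost every [t], dominated convergence with bound [|K t s * h s|] gives convergence of the
    operators applied to [h]; the uniform bound on their norms turns it into weak convergence, under
    which the inequality survives. *)
Lemma Schur_multiplier_lower (mu : {finite_measure set T -> \bar R})
    (G : T -> T -> R) (h : T -> R) :
  (forall A, measurable A -> mu A = 0%E -> nu A = 0%E) ->
  psd G -> (forall t, G t t = 1) ->
  measurable_fun setT (fun p : T * T => G p.1 p.2) -> L2 h ->
  L2 (apply_op (fun t s => K t s * G t s) h) /\
  lambda * \int[nu]_t h t ^+ 2 <=
  \int[nu]_t (h t * apply_op (fun t s => K t s * G t s) h t).
Proof.
move=> mu_nu pG G1 mG Lh.
have [S_ [stepS cvS]] := psd_ae_step_kernel mu_nu pG G1 mG.
have mh := Lh.1.
have mKG : measurable_fun setT (fun p : T * T => K p.1 p.2 * G p.1 p.2).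
  exact: measurable_funM.
have mKS k : measurable_fun setT (fun p : T * T => K p.1 p.2 * S_ k p.1 p.2).
  by apply: measurable_funM => //; exact: measurable_step_kernel.
have cv : {ae nu, forall t, (fun k => apply_op (fun t s => K t s * S_ k t s) h t) @ \oo -->
    apply_op (fun t s => K t s * G t s) h t}.
  apply: filterS2 cvS (K_int Lh) => t cvt it.
  have mKt := measurable_kernel_section t mK.
  have [|||||_ c] := @dominated_Rintegral _ _ _ nu
    (fun k s => K t s * S_ k t s * h s) (fun s => K t s * G t s * h s)
    (fun s => `|K t s * h s|).
  - move=> k; apply: measurable_funM => //; apply: measurable_funM => //.
    by apply: measurable_kernel_section; exact: measurable_step_kernel.
  - apply: measurable_funM => //; apply: measurable_funM => //.
    exact: measurable_kernel_section.
  - by apply: filterS cvt => s c; apply: cvgMr_tmp; apply: cvgMl_tmp.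
  - exact: (integrable_norm it).
  - by move=> k s; rewrite mulrAC normrM ler_piMr// step_kernel_norm_le1.
  - exact: c.
have := @weak_cvg_of_ae_bounded _ _ _ nu
  (fun k => apply_op (fun t s => K t s * S_ k t s) h)
  (apply_op (fun t s => K t s * G t s) h) h (C * \int[nu]_t h t ^+ 2).
case=> //.
- by move=> k; exact: measurable_apply_op.
- exact: measurable_apply_op.
- by move=> k; rewrite EFinM -L2_sqintE//; exact: step_op_bound.
move=> LKG c; split => //.
rewrite -(cvg_lim (@Rhausdorff _) c).
apply: limr_ge; first exact: cvgP c.
by apply: nearW => k; exact: step_op_lower.
Qed.

End kernel.
End schur_multiplier.

(** * Translation between [Lnorm] and squared integrals *)

Section L2_norm.
Context d (T : measurableType d) (R : realType).
Variable nu : {measure set T -> \bar R}.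

Lemma Lnorm2_sqr (f : T -> \bar R) :
  ('N[nu]_2%:E[f] `^ 2)%E = (\int[nu]_t `|f t| `^ 2)%E.
Proof. by rewrite poweR_Lnorm. Qed.

Lemma Lnorm2_EFin_sqr (h : T -> R) :
  ('N[nu]_2%:E[EFin \o h] `^ 2)%E = sqint nu h.
Proof.
rewrite Lnorm2_sqr; apply: eq_integral => t _.
by rewrite /= ?poweR_EFin powR_mulrn ?normr_ge0// real_normK ?num_real.
Qed.

Lemma Lnorm2_EFin (h : T -> R) :
  ('N[nu]_2%:E[EFin \o h] = sqint nu h `^ 2^-1)%E.
Proof.
by rewrite -Lnorm2_EFin_sqr -poweRrM mulfV// poweRe1// Lnorm_ge0.
Qed.

Lemma L2_sphereE (h : T -> R) :
  L2_sphere nu h <-> measurable_fun setT h /\ sqint nu h = 1%E.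
Proof.
rewrite /L2_sphere /=; split=> -[mh h1]; split => //.
  by rewrite -Lnorm2_EFin_sqr h1 poweR1r.
by rewrite Lnorm2_EFin h1 poweR1r.
Qed.

Lemma L2_Lfun (h : T -> R) : L2 nu h -> h \in Lfun nu 2%:E.
Proof.
move=> [mh sh]; rewrite inE; apply/andP; split; rewrite inE//=.
by rewrite /finite_norm Lnorm2_EFin poweR_lty.
Qed.

End L2_norm.

Section Schur_forms.
Context d (T : measurableType d) (R : realType).
Variable nu : {sigma_finite_measure set T -> \bar R}.

Lemma bounded_kernel_operator_L2 (K : T -> T -> R) :
  measurable_fun setT (fun p : T * T => K p.1 p.2) ->
  bounded_kernel_operator nu K -> exists C : R, [/\ 0 <= C,
    forall h, L2 nu h -> ae_integrable_op nu K h &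
    forall h, L2 nu h -> (sqint nu (apply_op nu K h) <= C%:E * sqint nu h)%E].
Proof.
move=> mK [C bK]; exists (C ^+ 2); split; first exact: sqr_ge0.
  by move=> h /L2_Lfun /bK[].
move=> h Lh; have [ih bh] := bK _ (L2_Lfun Lh).
have -> : sqint nu (apply_op nu K h) =
    ('N[nu]_2%:E[kernel_operator nu K h] `^ 2)%E.
  rewrite Lnorm2_sqr; apply: ae_eq_integral => //.
  - by apply/measurable_EFinP/measurable_funX/measurable_apply_op => //; exact: Lh.1.
  - apply: (measurableT_comp (measurable_poweR _)).
    apply: measurableT_comp => //.
    exact: (measurable_section_integral nu (measurable_kernel_fun mK Lh.1)).
  - apply: filterS ih => t it _.
    rewrite /kernel_operator -[X in `|X|%E]fineK; last exact: integrable_fin_num.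
    by rewrite abse_EFin poweR_EFin powR_mulrn ?normr_ge0// real_normK ?num_real.
have N0 : (0 <= 'N[nu]_2%:E[EFin \o h])%E by exact: Lnorm_ge0.
(* The given [C] may be negative, so its modulus replaces it before squaring. *)
apply: (@le_trans _ _ ((`|C|%:E * 'N[nu]_2%:E[EFin \o h]) `^ 2)%E).
  rewrite gt0_ler_poweR// ?in_itv/= ?leey ?andbT ?Lnorm_ge0//.
    by rewrite mule_ge0// lee_fin normr_ge0.
  by apply: (le_trans bh); rewrite lee_wpmul2r// lee_fin ler_norm.
rewrite poweRM ?lee_fin ?normr_ge0// Lnorm2_EFin_sqr poweR_EFin.
by rewrite powR_mulrn ?normr_ge0// real_normK ?num_real.
Qed.

Section forms.
Variables (K : T -> T -> R) (C : R).
Hypothesis mK : measurable_fun setT (fun p : T * T => K p.1 p.2).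
Hypothesis K_sym : forall s t, K s t = K t s.
Hypothesis K_int : forall h, L2 nu h -> ae_integrable_op nu K h.
Hypothesis K_bound : forall h, L2 nu h ->
  (sqint nu (apply_op nu K h) <= C%:E * sqint nu h)%E.
Hypothesis C_ge0 : 0 <= C.
Variables (mu : {finite_measure set T -> \bar R}) (G : T -> T -> R).
Hypothesis mu_nu : forall A, measurable A -> mu A = 0%E -> nu A = 0%E.
Hypothesis pG : psd G.
Hypothesis G1 : forall t, G t t = 1.
Hypothesis mG : measurable_fun setT (fun p : T * T => G p.1 p.2).

Lemma L2_sphere_L2 (h : T -> R) : L2_sphere nu h -> L2 nu h.
Proof. by move=> /L2_sphereE[mh h1]; split => //; rewrite h1 ltry. Qed.

Lemma form_EFin (h : T -> R) : L2 nu h ->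
  (\int[nu]_t \int[nu]_s (K s t * h s * h t)%:E)%E =
  (\int[nu]_t (h t * apply_op nu K h t))%:E.
Proof.
move=> Lh; rewrite bilinear_formE//; [|exact: Lh.1|exact: K_int].
rewrite /Rintegral fineK//; apply: integrable_fin_num => //.
exact: (L2M_integrable Lh (L2_apply_op mK K_bound C_ge0 Lh)).
Qed.

(** Homogeneity: [g] is divided by its norm. If the norm is 0, then [g] vanishes almost everywhere
    and both sides are 0. *)
Lemma sphere_lower_bound (lambda : R) :
  (forall g, L2_sphere nu g ->
    (lambda%:E <= \int[nu]_t \int[nu]_s (K s t * g s * g t)%:E)%E) ->
  forall g, L2 nu g ->
    lambda * \int[nu]_t g t ^+ 2 <= \int[nu]_t (g t * apply_op nu K g t).
Proof.
move=> Hl g Lg; set q := \int[nu]_t g t ^+ 2.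
have LKg := L2_apply_op mK K_bound C_ge0 Lg.
have q0 : 0 <= q by apply: Rintegral_ge0 => t _; exact: sqr_ge0.
have [q_eq0|q_neq0] := eqVneq q 0.
  rewrite q_eq0 mulr0 (_ : \int[nu]_t _ = 0)//.
  have : sqint nu g = 0%E by rewrite L2_sqintE// -/q q_eq0.
  have mg2 : measurable_fun setT (fun t => (g t ^+ 2)%:E).
    by apply/measurable_EFinP/measurable_funX; exact: Lg.1.
  rewrite /sqint (eq_integral (fun t => `|(g t ^+ 2)%:E|%E)); last first.
    by move=> t _; rewrite gee0_abs// lee_fin sqr_ge0.
  move/(ae_eq_integral_abs nu measurableT mg2) => g0.
  rewrite /Rintegral (ae_eq_integral (cst 0%E)) ?integral0//.
    by apply/measurable_EFinP/measurable_funM; [exact: Lg.1|exact: LKg.1].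
  apply: filterS g0 => t /(_ Logic.I) /= [] /eqP.
  by rewrite sqrf_eq0 => /eqP -> _; rewrite mul0r.
have q_gt0 : 0 < q by rewrite lt_neqAle eq_sym q_neq0.
pose c := (Num.sqrt q)^-1.
have c2 : c ^+ 2 = q^-1 by rewrite /c exprVn sqr_sqrtr.
pose g1 t := c * g t.
have Lg1 : L2 nu g1 by apply: L2_bounded => //; exact: bounded_measurable_cst.
have sg1 : sqint nu g1 = 1%E.
  rewrite L2_sqintE// /g1; under eq_Rintegral do rewrite exprMn.
  rewrite RintegralZl//; last exact: L2_sqr_integrable.
  by rewrite c2 -/q mulVf.
have /Hl : L2_sphere nu g1 by apply/L2_sphereE; split => //; exact: Lg1.1.
rewrite form_EFin// lee_fin.
have -> : \int[nu]_t (g1 t * apply_op nu K g1 t) =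
    q^-1 * \int[nu]_t (g t * apply_op nu K g t).
  rewrite -RintegralZl//; last exact: L2M_integrable.
  congr fine; apply: ae_eq_integral => //.
  - apply/measurable_EFinP/measurable_funM; first exact: Lg1.1.
    by apply: measurable_apply_op => //; exact: Lg1.1.
  - apply/measurable_EFinP/measurable_funM => //.
    by apply: measurable_funM; [exact: Lg.1|exact: LKg.1].
  - apply: filterS (K_int Lg) => t it _; congr EFin.
    have -> : apply_op nu K g1 t = c * apply_op nu K g t.
      rewrite /apply_op -RintegralZl//; apply: eq_Rintegral => s _.
      by rewrite /g1 mulrCA.
    by rewrite /g1 -c2; ring.
by rewrite mulrC ler_pdivlMr.
Qed.

Lemma Schur_form_lower (lambda : R) :
  (forall g, L2_sphere nu g ->
    (lambda%:E <= \int[nu]_t \int[nu]_s (K s t * g s * g t)%:E)%E) ->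
  forall h, L2_sphere nu h ->
    (lambda%:E <= \int[nu]_t \int[nu]_s (K s t * G s t * h s * h t)%:E)%E.
Proof.
move=> Hl h Sh; have Lh := L2_sphere_L2 Sh.
have G_le1 s t : `|G s t| <= 1 by exact: psd_norm_le1.
have [LKG le] := Schur_multiplier_lower mK K_int K_bound C_ge0
  (sphere_lower_bound Hl) mu_nu pG G1 mG Lh.
have mKG : measurable_fun setT (fun p : T * T => K p.1 p.2 * G p.1 p.2).
  exact: measurable_funM.
rewrite (bilinear_formE mKG Lh.1); last 2 first.
- by move=> s t; rewrite K_sym pG.1.
- exact: (Schur_integrable mK K_int mG G_le1 Lh).
rewrite -[leRHS]fineK; last first.
  by apply: integrable_fin_num => //; exact: (L2M_integrable Lh LKG).
rewrite lee_fin; move: le.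
have -> : \int[nu]_t h t ^+ 2 = 1.
  by have /L2_sphereE[_ h1] := Sh; rewrite /Rintegral -/(sqint nu h) h1.
by rewrite mulr1.
Qed.

End forms.
End Schur_forms.

(** * Density of polynomials *)

Section exponential_series.
Variable R : realType.

Lemma exp_partial_sum_le (x : R) (n : nat) : 0 <= x ->
  \sum_(k < n) x ^+ k / k`!%:R <= expR x.
Proof.
move=> x0; have c := is_cvg_series_exp_coeff x.
have := nondecreasing_cvgn_le _ c n.
rewrite -[X in _ <= X]/(expR x) /series /= big_mkord; apply.
apply/nondecreasing_seqP => k; rewrite /series /= big_nat_recr//= lerDl.
by rewrite /exp_coeff /= divr_ge0// exprn_ge0.
Qed.

Lemma power_series_partial_le (c : nat -> R) (u x : R) (n : nat) : 0 <= u ->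
  (forall k, `|c k| <= u ^+ k / k`!%:R) ->
  `|\sum_(k < n) c k * x ^+ k| <= expR (u * `|x|).
Proof.
move=> u0 cu; rewrite (le_trans (ler_norm_sum _ _ _))//.
apply: le_trans (exp_partial_sum_le n _); last by rewrite mulr_ge0.
apply: ler_sum => k _; rewrite normrM normrX exprMn mulrAC.
by rewrite ler_wpM2r// exprn_ge0.
Qed.

Lemma expR_series (x : R) : \sum_(k < n) x ^+ k / k`!%:R @[n --> \oo] --> expR x.
Proof.
have : series (exp_coeff x) @ \oo --> expR x by exact: is_cvg_series_exp_coeff.
apply: cvg_trans; apply: near_eq_cvg; apply: nearW => n.
by rewrite /series /= big_mkord.
Qed.

Lemma expr_le_fact_exp (x : R) (m : nat) : 0 <= x -> x ^+ m <= m`!%:R * expR x.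
Proof.
move=> x0; rewrite mulrC -ler_pdivrMr ?ltr0n ?fact_gt0//.
apply: le_trans (exp_partial_sum_le m.+1 x0).
rewrite big_ord_recr /= lerDr; apply: sumr_ge0 => k _.
by rewrite divr_ge0// exprn_ge0.
Qed.

Definition sin_coef (k : nat) : R := (odd k)%:R * (-1) ^+ k.-1./2 / k`!%:R.
Definition cos_coef (k : nat) : R := (~~ odd k)%:R * (-1) ^+ k./2 / k`!%:R.

Lemma sin_power_series (u x : R) :
  \sum_(k < n) (sin_coef k * u ^+ k) * x ^+ k @[n --> \oo] --> sin (u * x).
Proof.
have : series (sin_coeff (u * x)) @ \oo --> sin (u * x).
  by rewrite unlock; exact: is_cvg_series_sin_coeff.
apply: cvg_trans; apply: near_eq_cvg; apply: nearW => n.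
rewrite /series /= big_mkord; apply: eq_bigr => k _.
by rewrite /sin_coeff /sin_coef /= exprMn; ring.
Qed.

Lemma cos_power_series (u x : R) :
  \sum_(k < n) (cos_coef k * u ^+ k) * x ^+ k @[n --> \oo] --> cos (u * x).
Proof.
have : series (cos_coeff (u * x)) @ \oo --> cos (u * x).
  by rewrite unlock; exact: is_cvg_series_cos_coeff.
apply: cvg_trans; apply: near_eq_cvg; apply: nearW => n.
rewrite /series /= big_mkord; apply: eq_bigr => k _.
rewrite /cos_coeff /cos_coef /= exprMn.
rewrite -exprnP.
by move: ((~~ odd k)%:R : R) => b; ring.
Qed.

Lemma sin_coef_le (u : R) (k : nat) :
  `|sin_coef k * u ^+ k| <= `|u| ^+ k / k`!%:R.
Proof.
rewrite /sin_coef !normrM normfV normrX normrN1 expr1n mulr1 normrX.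
rewrite (ger0_norm (ler0n _ _)) [X in _ / X * _]ger0_norm// mulrC mulrA.
by rewrite ler_wpM2r// ler_piMr ?exprn_ge0//; case: odd.
Qed.

Lemma cos_coef_le (u : R) (k : nat) :
  `|cos_coef k * u ^+ k| <= `|u| ^+ k / k`!%:R.
Proof.
rewrite /cos_coef !normrM normfV normrX normrN1 expr1n mulr1 normrX.
rewrite (ger0_norm (ler0n _ _)) [X in _ / X * _]ger0_norm// mulrC mulrA.
by rewrite ler_wpM2r// ler_piMr ?exprn_ge0//; case: odd.
Qed.

End exponential_series.

Section polynomial_density.
Context d (Omega : measurableType d) (R : realType).
Variable P : probability Omega R.
Variable U : Omega -> R.
Hypothesis mU : measurable_fun setT U.
Hypothesis U_exp : forall lambda : R,
  P.-integrable setT (fun w => (expR (lambda * `|U w|))%:E).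

(** The class contains the polynomials and is stable under products; the exponential moments of [U]
    make all its members square integrable after composition with [U]. *)
Definition exp_bounded (f : R -> R) : Prop := measurable_fun setT f /\
  exists A lambda : R, [/\ 0 <= A, 0 <= lambda &
    forall x, `|f x| <= A * expR (lambda * `|x|)].

Lemma exp_boundedD (f g : R -> R) : exp_bounded f -> exp_bounded g ->
  exp_bounded (fun x => f x + g x).
Proof.
move=> [mf [A [a [A0 a0 fA]]]] [mg [B [b [B0 b0 gB]]]]; split.
  exact: measurable_funD.
exists (A + B), (a + b); split; rewrite ?addr_ge0// => x.
rewrite (le_trans (ler_normD _ _))// mulrDl lerD//.
  by rewrite (le_trans (fA x))// ler_wpM2l// ler_expR ler_wpM2r// lerDl.
by rewrite (le_trans (gB x))// ler_wpM2l// ler_expR ler_wpM2r// lerDr.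
Qed.

Lemma exp_boundedM (f g : R -> R) : exp_bounded f -> exp_bounded g ->
  exp_bounded (fun x => f x * g x).
Proof.
move=> [mf [A [a [A0 a0 fA]]]] [mg [B [b [B0 b0 gB]]]]; split.
  exact: measurable_funM.
exists (A * B), (a + b); split; rewrite ?addr_ge0 ?mulr_ge0// => x.
by rewrite normrM mulrDl expRD mulrACA ler_pM.
Qed.

Lemma exp_bounded_bounded (f : R -> R) : bounded_measurable f -> exp_bounded f.
Proof.
move=> [mf [M fM]]; split => //; exists `|M|, 0; split => // x.
by rewrite mul0r expR0 mulr1 (le_trans (fM x))// ler_norm.
Qed.

Lemma exp_bounded_exprn (m : nat) : exp_bounded (fun x => x ^+ m).
Proof.
split; first exact: measurable_funX.
exists m`!%:R, 1; split => // x.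
by rewrite mul1r normrX expr_le_fact_exp.
Qed.

Lemma exp_bounded_horner (p : {poly R}) : exp_bounded (fun x => p.[x]).
Proof.
elim/poly_ind: p => [|p c IH].
  under eq_fun do rewrite horner0.
  exact/exp_bounded_bounded/bounded_measurable_cst.
under eq_fun do rewrite hornerMXaddC; apply: exp_boundedD.
  by apply: exp_boundedM => //; exact: (exp_bounded_exprn 1).
exact/exp_bounded_bounded/bounded_measurable_cst.
Qed.

Lemma exp_bounded_integrable (f : R -> R) : exp_bounded f ->
  P.-integrable setT (EFin \o (fun w => f (U w))).
Proof.
move=> [mf [A [a [A0 a0 fA]]]].
apply: (le_integrable measurableT _ _ (integrableZl measurableT A (U_exp a))).
  by apply/measurable_EFinP; exact: measurableT_comp.
move=> w _; rewrite -EFinM /= lee_fin [leRHS]ger0_norm ?mulr_ge0 ?expR_ge0//.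
Qed.

Lemma exp_bounded_L2 (f : R -> R) : exp_bounded f -> L2 P (f \o U).
Proof.
move=> bf; split; first by apply: measurableT_comp => //; exact: bf.1.
have /integrableP[_] := exp_bounded_integrable (exp_boundedM bf bf).
apply: le_lt_trans; apply: ge0_le_integral => //.
- by move=> w _; rewrite lee_fin sqr_ge0.
- by apply/measurable_EFinP/measurable_funX/measurableT_comp => //; exact: bf.1.
- apply: measurableT_comp => //; apply/measurable_EFinP.
  by apply: measurable_funM; apply: measurableT_comp => //; exact: bf.1.
- by move=> w _; rewrite /= lee_fin expr2 ler_norm.
Qed.

Definition poly_approx (f : R -> R) : Prop :=
  [/\ measurable_fun setT f, L2 P (f \o U) &
  forall e : R, 0 < e ->
    exists p : {poly R}, \int[P]_w (f (U w) - p.[U w]) ^+ 2 <= e].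

Lemma L2D (f g : Omega -> R) : L2 P f -> L2 P g -> L2 P (fun w => f w + g w).
Proof.
move=> Lf Lg; split; first by apply: measurable_funD; [exact: Lf.1|exact: Lg.1].
pose D := Num.max (\int[P]_w f w ^+ 2) (\int[P]_w g w ^+ 2).
have Lg' : L2 P (fun w => -1 * g w) by apply: L2_bounded => //; exact: bounded_measurable_cst.
have -> : sqint P (fun w => f w + g w) = sqint P (fun w => f w - -1 * g w).
  by apply: eq_integral => w _; congr EFin; ring.
apply: le_lt_trans (L2B_bound (D := D) Lf.1 Lg'.1 _ _) (ltry _).
- by rewrite L2_sqintE// lee_fin le_max lexx.
- rewrite (_ : sqint P _ = sqint P g); last by apply: eq_integral => w _; congr EFin; ring.
  by rewrite L2_sqintE// lee_fin le_max lexx orbT.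
Qed.

Lemma L2Z (c : R) (f : Omega -> R) : L2 P f -> L2 P (fun w => c * f w).
Proof. by move=> Lf; apply: L2_bounded => //; exact: bounded_measurable_cst. Qed.

Lemma L2B (f g : Omega -> R) : L2 P f -> L2 P g -> L2 P (fun w => f w - g w).
Proof.
move=> Lf Lg; under eq_fun do rewrite -mulN1r.
exact/L2D/L2Z.
Qed.

Lemma sqr_sum_bound (f g h : Omega -> R) (e1 e2 : R) :
  L2 P f -> L2 P g -> L2 P h ->
  \int[P]_w (f w - g w) ^+ 2 <= e1 -> \int[P]_w (g w - h w) ^+ 2 <= e2 ->
  \int[P]_w (f w - h w) ^+ 2 <= 2 * e1 + 2 * e2.
Proof.
move=> Lf Lg Lh i1 i2.
have j1 := L2_sqr_integrable (L2B Lf Lg).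
have j2 := L2_sqr_integrable (L2B Lg Lh).
have j3 := L2_sqr_integrable (L2B Lf Lh).
have k1 := integrableZl measurableT 2 j1.
have k2 := integrableZl measurableT 2 j2.
apply: (@le_trans _ _ (\int[P]_w (2 * (f w - g w) ^+ 2 + 2 * (g w - h w) ^+ 2))).
  apply: le_Rintegral => //; first exact: (integrableD measurableT k1 k2).
  move=> w _; rewrite -subr_ge0.
  by rewrite (_ : _ - _ = (f w - 2 * g w + h w) ^+ 2) ?sqr_ge0//; ring.
by rewrite RintegralD// !RintegralZl//; lra.
Qed.

Lemma poly_approx_horner (p : {poly R}) : poly_approx (fun x => p.[x]).
Proof.
have bp := exp_bounded_horner p; split; [exact: bp.1|exact: exp_bounded_L2|].
move=> e e0; exists p; under eq_Rintegral do rewrite subrr expr0n.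
by rewrite Rintegral_cst// mul0r ltW.
Qed.

Lemma poly_approx_linear (a : R) (f g : R -> R) :
  poly_approx f -> poly_approx g -> poly_approx (fun x => a * f x + g x).
Proof.
move=> [mf Lf hf] [mg Lg hg].
have Lafg : L2 P ((fun x => a * f x + g x) \o U) by exact: (L2D (L2Z a Lf) Lg).
split => //.
  by apply: measurable_funD => //; exact: measurable_funM.
move=> e e0.
have a1 : 0 < 4 * (a ^+ 2 + 1) by rewrite mulr_gt0// ltr_wpDl// sqr_ge0.
have [p hp] := hf (e / (4 * (a ^+ 2 + 1))) ltac:(by rewrite divr_gt0).
have [q hq] := hg (e / 4) ltac:(by rewrite divr_gt0).
exists (a *: p + q).
have Lp := exp_bounded_L2 (exp_bounded_horner p).
have Lq := exp_bounded_L2 (exp_bounded_horner q).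
have Lapq : L2 P (fun w => (a *: p + q).[U w]) := exp_bounded_L2 (exp_bounded_horner _).
apply: le_trans (@sqr_sum_bound (fun w => a * f (U w) + g (U w))
  (fun w => a * p.[U w] + g (U w)) (fun w => (a *: p + q).[U w])
  (a ^+ 2 * (e / (4 * (a ^+ 2 + 1)))) (e / 4) Lafg (L2D (L2Z a Lp) Lg) Lapq
  _ _) _.
- rewrite (_ : (\int[P]_w _) = \int[P]_w (a ^+ 2 * (f (U w) - p.[U w]) ^+ 2)); last first.
    by apply: eq_Rintegral => w _; ring.
  rewrite RintegralZl//; last exact: L2_sqr_integrable (L2B Lf Lp).
  by rewrite ler_wpM2l// sqr_ge0.
- rewrite (_ : (\int[P]_w _) = \int[P]_w ((g (U w) - q.[U w]) ^+ 2))//.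
  by apply: eq_Rintegral => w _; rewrite hornerD hornerZ; ring.
- suff : a ^+ 2 * (e / (4 * (a ^+ 2 + 1))) <= e / 4 by lra.
  rewrite (_ : a ^+ 2 * _ = e / 4 * (a ^+ 2 / (a ^+ 2 + 1))); last first.
    by field; rewrite gt_eqF// ltr_wpDl// sqr_ge0.
  by rewrite ler_piMr ?divr_ge0 ?ltW// ltr_pdivrMr ?mul1r ?ltrDl// ltr_wpDl// sqr_ge0.
Qed.

Lemma poly_approx_cst (c : R) : poly_approx (cst c).
Proof. by have := poly_approx_horner c%:P; under eq_fun do rewrite hornerC. Qed.

Lemma poly_approx_sum (n : nat) (c : nat -> R) (f : nat -> R -> R) :
  (forall k, poly_approx (f k)) ->
  poly_approx (fun x => \sum_(k < n) c k * f k x).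
Proof.
move=> af; elim: n => [|n IH].
  by under eq_fun do rewrite big_ord0; exact: poly_approx_cst.
under eq_fun do rewrite big_ord_recr /= addrC.
exact: poly_approx_linear.
Qed.

(** The closure property behind the whole chain from polynomials to arbitrary functions:
    [(f_ n - f) ^ 2] is dominated by [4 * g ^ 2], so pointwise convergence becomes convergence in
    mean square. *)
Lemma poly_approx_dominated (f_ : nat -> R -> R) (f g : R -> R) :
  (forall n, poly_approx (f_ n)) -> (forall x, f_ ^~ x @ \oo --> f x) ->
  (forall n x, `|f_ n x| <= g x) -> L2 P (g \o U) -> poly_approx f.
Proof.
move=> af f_f fg Lg.
have mf : measurable_fun setT f.
  by apply: (@measurable_fun_cvg _ _ _ setT f_) => [n|x _]; [case: (af n)|exact: f_f].
have fg' x : `|f x| <= g x.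
  have c : `|f_ n x| @[n --> \oo] --> `|f x| by exact: cvg_norm.
  rewrite -(cvg_lim (@norm_hausdorff _ _) c).
  by apply: limr_le; [exact: cvgP c|exact: nearW].
have Lf : L2 P (f \o U).
  split; first exact: measurableT_comp.
  apply: le_lt_trans Lg.2; apply: ge0_le_integral => //.
  - by move=> w _; rewrite lee_fin sqr_ge0.
  - by apply/measurable_EFinP/measurable_funX/measurableT_comp.
  - by apply/measurable_EFinP/measurable_funX; exact: Lg.1.
  - move=> w _; rewrite lee_fin /= -(real_normK (num_real (f _))).
    by rewrite lerXn2r// nnegrE// (le_trans _ (fg' _)).
split => // e e0.
have [] := @dominated_Rintegral _ _ _ P (fun n w => (f_ n (U w) - f (U w)) ^+ 2)
  (cst 0) (fun w => 4 * (g (U w)) ^+ 2).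
- move=> n; apply/measurable_funX/measurable_funB; apply: measurableT_comp => //.
  by case: (af n).
- by [].
- apply: aeW => w /=.
  rewrite (_ : 0 = (f (U w) - f (U w)) ^+ 2); last by rewrite subrr expr0n.
  under eq_fun do rewrite expr2; rewrite expr2.
  by apply: cvgM; apply: cvgB => //; exact: cvg_cst.
- by have := integrableZl measurableT 4 (L2_sqr_integrable Lg).
- move=> n w; rewrite ger0_norm ?sqr_ge0// -(real_normK (num_real (_ - _))).
  rewrite (_ : 4 * g (U w) ^+ 2 = (g (U w) + g (U w)) ^+ 2); last by ring.
  rewrite lerXn2r ?nnegrE ?addr_ge0 ?(le_trans _ (fg' _))//.
  by rewrite (le_trans (ler_normB _ _))// lerD.
(* [sqr_sum_bound] doubles each of the two errors, hence the quarters. *)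
rewrite Rintegral_cst// mul0r => _ /cvgrPdist_le /(_ (e / 4)).
case; first by rewrite divr_gt0.
move=> n _ /(_ n (leqnn n)); rewrite /= sub0r normrN => hn.
have [_ Lfn /(_ (e / 4) ltac:(by rewrite divr_gt0)) [p hp]] := af n.
exists p.
have Lp := exp_bounded_L2 (exp_bounded_horner p).
have h1 : \int[P]_w (f (U w) - f_ n (U w)) ^+ 2 <= e / 4.
  rewrite (_ : \int[P]_w _ = \int[P]_w (f_ n (U w) - f (U w)) ^+ 2).
    exact: le_trans (ler_norm _) hn.
  by apply: eq_Rintegral => w _; rewrite -sqrrN opprB.
have := sqr_sum_bound Lf Lfn Lp h1 hp.
by move/le_trans; apply; lra.
Qed.

(** Having all [f x * x ^+ m] approximable allows [f] to be multiplied by a power series term by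
    term, and the product inherits the property. *)
Definition poly_approx_mul (f : R -> R) : Prop :=
  exp_bounded f /\ forall m, poly_approx (fun x => f x * x ^+ m).

Lemma poly_approx_mul1 : poly_approx_mul (cst 1).
Proof.
split; first exact/exp_bounded_bounded/bounded_measurable_cst.
move=> m; have := poly_approx_horner 'X^m.
by under eq_fun do rewrite hornerXn -[_ ^+ m]mul1r.
Qed.

Lemma poly_approx_mul_linear (a : R) (f g : R -> R) :
  poly_approx_mul f -> poly_approx_mul g ->
  poly_approx_mul (fun x => a * f x + g x).
Proof.
move=> [bf af] [bg ag]; split.
  apply: exp_boundedD => //; apply: exp_boundedM => //.
  exact/exp_bounded_bounded/bounded_measurable_cst.
move=> m; under eq_fun do rewrite mulrDl -mulrA; exact: poly_approx_linear.
Qed.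

(** The partial sums are dominated by [expR (u * |x|)], which remains square integrable after
    multiplication by [f x * x ^+ m]. *)
Lemma poly_approx_mul_series (f F : R -> R) (c : nat -> R) (u : R) :
  poly_approx_mul f -> measurable_fun setT F -> 0 <= u ->
  (forall k, `|c k| <= u ^+ k / k`!%:R) ->
  (forall x, \sum_(k < n) c k * x ^+ k @[n --> \oo] --> F x) ->
  poly_approx_mul (fun x => f x * F x).
Proof.
move=> [bf af] mF u0 cu cF.
have be : exp_bounded (fun x => expR (u * `|x|)).
  split; first by apply: measurableT_comp => //; apply: measurable_funM => //; exact: measurableT_comp.
  by exists 1, u; split => // x; rewrite mul1r ger0_norm ?expR_ge0.
have Fe x : `|F x| <= expR (u * `|x|).
  have cv : `|\sum_(k < n) c k * x ^+ k| @[n --> \oo] --> `|F x| by exact: cvg_norm.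
  rewrite -(cvg_lim (@norm_hausdorff _ _) cv).
  apply: limr_le; [exact: cvgP cv|apply: nearW => n].
  exact: power_series_partial_le.
have bF : exp_bounded F.
  split => //; exists 1, u; split => // x; by rewrite mul1r.
split; first exact: exp_boundedM.
move=> m.
apply: (@poly_approx_dominated
  (fun n x => \sum_(k < n) c k * (f x * x ^+ (m + k))) _
  (fun x => `|f x| * `|x ^+ m| * expR (u * `|x|))).
- move=> n.
  exact: (@poly_approx_sum n c (fun k x => f x * x ^+ (m + k))).
- move=> x; rewrite (_ : (fun n => _) =
      (fun n => f x * x ^+ m * \sum_(k < n) c k * x ^+ k)).
    by rewrite mulrAC; exact: cvgMl_tmp.
  apply/funext => n; rewrite mulr_sumr; apply: eq_bigr => k _.
  by rewrite exprD; ring.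
- move=> n x; rewrite (_ : \sum_(k < n) _ = f x * x ^+ m * \sum_(k < n) c k * x ^+ k).
    by rewrite !normrM ler_wpM2l ?mulr_ge0// power_series_partial_le.
  rewrite mulr_sumr; apply: eq_bigr => k _; by rewrite exprD; ring.
- apply: exp_bounded_L2; apply: exp_boundedM => //.
  have norm_eb (h : R -> R) : exp_bounded h -> exp_bounded (fun x => `|h x|).
    move=> [mh [A [a [A0 a0 hA]]]]; split; first exact: measurableT_comp.
    by exists A, a; split => // x; rewrite normr_id.
  apply: exp_boundedM; first exact: norm_eb.
  exact: norm_eb (exp_bounded_exprn m).
Qed.

Lemma poly_approx_mul_sin (f : R -> R) (u a : R) : poly_approx_mul f ->
  poly_approx_mul (fun x => f x * sin (u * (x - a))).
Proof.
move=> Wf.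
have msin : measurable_fun setT (fun x : R => sin (u * x)).
  apply: measurableT_comp; last exact: measurable_funM.
  exact: (continuous_measurable_fun (@continuous_sin R)).
have mcos : measurable_fun setT (fun x : R => cos (u * x)).
  apply: measurableT_comp; last exact: measurable_funM.
  exact: (continuous_measurable_fun (@continuous_cos R)).
have Ws : poly_approx_mul (fun x => f x * sin (u * x)).
  apply: (poly_approx_mul_series Wf msin (normr_ge0 u) (sin_coef_le u)).
  exact: sin_power_series.
have Wc : poly_approx_mul (fun x => f x * cos (u * x)).
  apply: (poly_approx_mul_series Wf mcos (normr_ge0 u) (cos_coef_le u)).
  exact: cos_power_series.
(* [W0] concerns the zero function; it closes the combination of [Ws] and [Wc] given by the
   subtraction formula for the sine. *)
have W0 := poly_approx_mul_linear (-1) Wc Wc.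
have := poly_approx_mul_linear (cos (u * a)) Ws
  (poly_approx_mul_linear (- sin (u * a)) Wc W0).
congr poly_approx_mul; apply/funext => x.
by rewrite mulrBr sinB; ring.
Qed.

(** A bounded [f] with approximable powers can be substituted into the exponential series; powers of
    the result are again such exponentials, so the substitution can be iterated. *)
Definition poly_approx_powers (f : R -> R) : Prop :=
  bounded_measurable f /\ forall n, poly_approx (fun x => f x ^+ n).

Lemma poly_approx_powers_sin (u a : R) :
  poly_approx_powers (fun x => sin (u * (x - a))).
Proof.
split.
  split; last by exists 1 => x; rewrite ler_norml sin_geN1 sin_le1.
  apply: measurableT_comp; first exact: (continuous_measurable_fun (@continuous_sin R)).
  by apply: measurable_funM => //; exact: measurable_funB.
move=> n; suff [_ /(_ 0%N)] : poly_approx_mul (fun x => sin (u * (x - a)) ^+ n).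
  by under eq_fun do rewrite expr0 mulr1.
elim: n => [|n IH]; first exact: poly_approx_mul1.
under eq_fun do rewrite exprSr; exact: poly_approx_mul_sin.
Qed.

Lemma poly_approx_powers_exp (f : R -> R) (c : R) : poly_approx_powers f ->
  poly_approx_powers (fun x => expR (c * f x)).
Proof.
move=> [[mf [M fM]] af].
have be (a : R) : bounded_measurable (fun x => expR (a * f x)).
  split; first by apply: measurableT_comp => //; exact: measurable_funM.
  exists (expR (`|a| * M)) => x; rewrite ger0_norm ?expR_ge0// ler_expR.
  by rewrite (le_trans (ler_norm _))// normrM ler_wpM2l.
split; first exact: be.
move=> n; under eq_fun do rewrite -expRM_natl mulrA.
set a := n%:R * c.
apply: (@poly_approx_dominated
  (fun n x => \sum_(k < n) (a ^+ k / k`!%:R) * f x ^+ k) _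
  (fun x => expR (`|a| * M))).
- move=> j.
  exact: (@poly_approx_sum j (fun k => a ^+ k / k`!%:R) (fun k x => f x ^+ k)).
- move=> x; have := @expR_series R (a * f x).
  apply: cvg_trans; apply: near_eq_cvg; apply: nearW => j.
  by apply: eq_bigr => k _; rewrite exprMn; ring.
- move=> j x; apply: (@le_trans _ _ (expR (`|a| * `|f x|))).
    apply: (@power_series_partial_le R (fun k => a ^+ k / k`!%:R)) => // k.
    by rewrite normrM normrX normfV (ger0_norm (ler0n _ _)).
  by rewrite ler_expR ler_wpM2l// ?fM.
- exact/exp_bounded_L2/exp_bounded_bounded/bounded_measurable_cst.
Qed.

(* [exp (- k exp (- k^2 y))] tends to [1] if [0 < y] and to [0] otherwise. *)
Lemma poly_approx_positive_part (f : R -> R) : poly_approx_powers f ->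
  poly_approx (fun x => ((0 < f x)%R : bool)%:R).
Proof.
move=> pf; have [[mf _] _] := pf.
apply: (@poly_approx_dominated
  (fun k x => expR (- k.+1%:R * expR (- k.+1%:R ^+ 2 * f x))) _ (fun=> 1)).
- move=> k; have [_ /(_ 1%N)] :=
    poly_approx_powers_exp (- k.+1%:R) (poly_approx_powers_exp (- k.+1%:R ^+ 2) pf).
  by under eq_fun do rewrite expr1.
- move=> x; case: ltP => fx /=.
  + apply: (@squeeze_cvgr _ _ _ _ (fun k => 1 - (f x)^-1 * harmonic k) (cst 1)).
    * apply: nearW => k; apply/andP; split; last first.
        by rewrite /= expR_le1 mulNr oppr_le0 mulr_ge0// expR_ge0.
      apply: le_trans (expR_ge1Dx _); rewrite mulNr lerD2l lerN2 /harmonic /=.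
      set t := k.+1%:R; have t0 : 0 < t by rewrite ltr0n.
      have h : expR (- t ^+ 2 * f x) <= (t ^+ 2 * f x)^-1.
        have tf : 0 < t ^+ 2 * f x by rewrite mulr_gt0// exprn_gt0.
        rewrite mulNr expRN lef_pV2 ?posrE ?expR_gt0//.
        by rewrite (le_trans _ (expR_ge1Dx _))// lerDr.
      apply: (le_trans (ler_wpM2l (ltW t0) h)).
      by rewrite le_eqVlt; apply/orP; left; apply/eqP; field; rewrite !gt_eqF.
    * rewrite -[X in _ --> X]subr0 -(mulr0 (f x)^-1).
      apply: cvgB; first exact: cvg_cst.
      by apply: cvgMl_tmp; exact: cvg_harmonic.
    * exact: cvg_cst.
  + apply: (@squeeze_cvgr _ _ _ _ (cst 0) (@harmonic R)).
    * apply: nearW => k; rewrite expR_ge0 /= /harmonic /= mulNr expRN.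
      rewrite lef_pV2 ?posrE ?expR_gt0 ?ltr0n//.
      set t := k.+1%:R; have t0 : 0 < t by rewrite ltr0n.
      apply: (@le_trans _ _ (expR t)).
        by rewrite (le_trans _ (expR_ge1Dx _))// lerDr.
      rewrite ler_expR; apply: ler_peMr; first exact: ltW.
      rewrite -[leLHS]expR0 ler_expR mulNr oppr_ge0.
      by rewrite pmulr_rle0// exprn_gt0.
    * exact: cvg_cst.
    * exact: cvg_harmonic.
- by move=> k x; rewrite ger0_norm ?expR_ge0.
- exact/exp_bounded_L2/exp_bounded_bounded/bounded_measurable_cst.
Qed.

(** The sine of [(x - a) / (n + 1)] has the sign of [x - a] as soon as [|x - a| < (n + 1) * pi], and
    unlike [x - a] it is bounded, as [poly_approx_positive_part] requires. *)
Lemma poly_approx_ray (a : R) : poly_approx \1_(`]a, +oo[%classic).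
Proof.
apply: (@poly_approx_dominated
  (fun n x => ((0 < sin (n.+1%:R^-1 * (x - a)))%R : bool)%:R) _ (fun=> 1)).
- by move=> n; exact/poly_approx_positive_part/poly_approx_powers_sin.
- move=> x; rewrite indicE; apply: cvg_near_cst.
  exists (Num.truncn (`|x - a| / pi)).+1 => // n /= Nn.
  have small : `|n.+1%:R^-1 * (x - a)| < pi.
    rewrite normrM ger0_norm// mulrC ltr_pdivrMr ?ltr0n// mulrC.
    rewrite -ltr_pdivrMr ?pi_gt0// (lt_trans (truncnS_gt _))// ltr_nat.
    exact: leq_trans Nn _.
  rewrite mem_setE in_itv/= andbT; have [ax|xa] := ltP a x.
    rewrite sin_gt0_pi//= (le_lt_trans (ler_norm _) small) andbT.
    by rewrite mulr_gt0 ?invr_gt0 ?ltr0n ?subr_gt0.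
  rewrite ltNge -oppr_ge0 -sinN sin_ge0_pi//= -mulrN opprB.
  rewrite mulr_ge0 ?subr_ge0//= ltW// (le_lt_trans _ small)//.
  by rewrite -[X in _ <= `|X|]opprK normrN -mulrN opprB ler_norm.
- by move=> n x; case: (0 < _); rewrite ?normr1 ?normr0.
- exact/exp_bounded_L2/exp_bounded_bounded/bounded_measurable_cst.
Qed.

Lemma poly_approx_bounded (f : R -> R) : bounded_measurable f -> poly_approx f.
Proof.
move=> [mf [M fM]].
pose proof (@functional_monotone_class _ R R (@RGenOInfty.G R) poly_approx) as H.
refine (H _ _ _ _ _ _ f M mf fM).
- exact: RGenOInfty.measurableE.
- move=> _ _ [x ->] [y ->]; exists (Num.max x y).
  by apply/seteqP; split => z /=; rewrite !in_itv/= !andbT gt_max;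
    [move=> [-> ->]|move=> /andP[-> ->]].
- exact: poly_approx_cst.
- exact: poly_approx_linear.
- by move=> _ [a ->]; exact: poly_approx_ray.
- move=> f_ g K af mf_ fK cf.
  apply: (@poly_approx_dominated f_ g (fun=> K)) => //.
  exact/exp_bounded_L2/exp_bounded_bounded/bounded_measurable_cst.
Qed.

(** [f] is cut off outside the set where its modulus is at most [n]; the modulus of [f]
    dominates. *)
Theorem polynomials_dense (f : R -> R) : measurable_fun setT f ->
  L2 P (f \o U) -> poly_approx f.
Proof.
move=> mf Lf.
apply: (@poly_approx_dominated (fun n x => f x * \1_[set x | `|f x| <= n%:R] x)
  _ (fun x => `|f x|)).
- move=> n; apply: poly_approx_bounded.
  have mA : measurable [set x | `|f x| <= n%:R].
    have mnf : measurable_fun setT (fun x => `|f x|) by exact: measurableT_comp.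
    rewrite (_ : [set x | _] = setT `&` (fun x => `|f x|) @^-1` `]-oo, n%:R]).
      by apply: mnf => //; exact: measurable_itv.
    by apply/seteqP; split=> x /=; rewrite in_itv/=; [split|move=> []].
  split; first by apply: measurable_funM => //; exact: measurable_indic.
  exists n%:R => x; rewrite indicE; have [|_] := boolP (x \in _).
    by rewrite inE /= mulr1.
  by rewrite mulr0 normr0.
- move=> x; apply: cvg_near_cst; exists (Num.truncn `|f x|).+1 => // n /= fn.
  rewrite indicE mem_set ?mulr1//=.
  by rewrite (le_trans (ltW (truncnS_gt _)))// ler_nat.
- move=> n x; rewrite indicE; case: (x \in _); rewrite ?mulr1// mulr0 normr0//.
- split; first exact: (measurableT_comp (@normr_measurable R setT) Lf.1).
  rewrite (_ : sqint P _ = sqint P (f \o U)); first exact: Lf.2.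
  by apply: eq_integral => w _; rewrite /= real_normK ?num_real.
Qed.

End polynomial_density.

(** * Gaussian moments *)

Section gaussian_moments.
Variable R : realType.

(** The Radon-Nikodym derivative of the normal law and [normal_pdf] have equal integrals over all
    measurable sets, hence agree almost everywhere. *)
Lemma integral_normal_prob (m s : R) (f : R -> \bar R) :
  measurable_fun setT f -> (forall x, (0 <= f x)%E) ->
  (\int[normal_prob m s]_x f x =
   \int[lebesgue_measure]_x (f x * (normal_pdf m s x)%:E))%E.
Proof.
move=> mf f0; have dom := @normal_prob_dominates R m s.
rewrite -(Radon_Nikodym_SigmaFinite.change_of_variables dom)//=.
apply: ae_eq_integral => //.
- apply: emeasurable_funM => //.
  exact: measurable_int (Radon_Nikodym_SigmaFinite.f_integrable dom).
- by apply: emeasurable_funM => //; apply/measurable_EFinP; exact: measurable_normal_pdf.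
- apply: ae_eqe_mul2l; apply: integral_ae_eq => //.
  + exact: Radon_Nikodym_SigmaFinite.f_integrable.
  + by apply/measurable_EFinP; exact: measurable_normal_pdf.
  + by move=> A _ mA; rewrite -Radon_Nikodym_SigmaFinite.f_integral.
Qed.

Lemma normal_prob_mgf (m s t : R) : s != 0 ->
  (\int[normal_prob m s]_x (expR (t * (x - m)))%:E =
   (expR (s ^+ 2 * t ^+ 2 / 2))%:E)%E.
Proof.
move=> s0.
have me : measurable_fun setT (fun x : R => expR (t * (x - m))).
  by apply: measurableT_comp => //; apply: measurable_funM => //; exact: measurable_funB.
have mE : measurable_fun setT (fun x : R => (expR (t * (x - m)))%:E).
  exact/measurable_EFinP.
rewrite (integral_normal_prob m s mE); last by move=> x; rewrite lee_fin expR_ge0.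
(* Completing the square: the exponential tilt moves the mean by [t * s ^+ 2]. *)
have -> : (fun x => (expR (t * (x - m)))%:E * (normal_pdf m s x)%:E)%E =
    (fun x => (expR (s ^+ 2 * t ^+ 2 / 2))%:E * (normal_pdf (m + t * s ^+ 2) s x)%:E)%E.
  apply/funext => x; rewrite -!EFinM; congr EFin.
  rewrite !normal_pdfE// mulrCA [RHS]mulrCA; congr (_ * _).
  by rewrite /normal_fun -!expRD; congr expR; field.
rewrite integralZl//; last exact: integrable_normal_pdf.
by rewrite integral_normal_pdf mule1.
Qed.

(** Convergence at [t = 1] bounds the coefficients by some [M]. If those before [m] vanish, dividing
    by [t ^+ m] leaves [|c m|] at most [M * (t / (1 - t))], which is small with [t]. *)
Lemma power_series_eq0 (c : nat -> R) :
  (forall t, \sum_(k < n) c k * t ^+ k @[n --> \oo] --> 0) -> forall k, c k = 0.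
Proof.
move=> c0.
have [M cM] : exists M, forall k, `|c k| <= M.
  have : cvgn (series c).
    apply/cvg_ex; exists 0; have := c0 1; apply: cvg_trans; apply: near_eq_cvg.
    apply: nearW => n; rewrite /series /= big_mkord; apply: eq_bigr => k _.
    by rewrite expr1n mulr1.
  move=> /cvg_series_cvg_0 /cvgP /cvg_seq_bounded [B [_ hB]].
  by exists (B + 1) => k; apply: hB => //; rewrite ltrDl.
have M0 : 0 <= M := le_trans (normr_ge0 _) (cM 0%N).
elim/ltn_ind => m IH; apply/eqP; rewrite -normr_le0.
have small (t : R) : 0 < t -> t < 1 -> `|c m| <= M * (t / (1 - t)).
  move=> t0 t1; have t1' : 0 < 1 - t by rewrite subr_gt0.
  have cv : `|\sum_(k < m.+1 + n) c k * t ^+ k - c m * t ^+ m| @[n --> \oo] -->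
      `|c m * t ^+ m|.
    have : \sum_(k < m.+1 + n) c k * t ^+ k @[n --> \oo] --> 0.
      have := c0 t; rewrite -(cvg_shiftn m.+1) /=.
      by under eq_fun do rewrite addnC.
    move=> /(cvgB (cvg_cst (c m * t ^+ m))) h; have := cvg_norm h.
    rewrite subr0 => /(_ _); apply: cvg_trans; apply: near_eq_cvg; apply: nearW => n.
    by rewrite /= distrC.
  have tail n : `|\sum_(k < m.+1 + n) c k * t ^+ k - c m * t ^+ m| <=
      M * (t / (1 - t)) * t ^+ m.
    rewrite big_split_ord /= big_ord_recr /= big1 ?add0r; last first.
      by move=> k _; rewrite IH// mul0r.
    rewrite addrAC subrr add0r (le_trans (ler_norm_sum _ _ _))//.
    have : \sum_(k < n) t ^+ k <= (1 - t)^-1.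
      rewrite -[leRHS]mul1r ler_pdivlMr// mulrC.
      rewrite -[X in X * _]opprB mulNr -subrX1 opprB gerBl exprn_ge0//.
      exact: ltW.
    move=> /(ler_wpM2l M0) /(ler_wpM2r (ltW (exprn_gt0 m.+1 t0))) h.
    apply: (@le_trans _ _ (M * (\sum_(k < n) t ^+ k) * t ^+ m.+1)); last first.
      by rewrite (le_trans h)// exprS !mulrA (mulrAC M t).
    rewrite mulr_sumr mulr_suml; apply: ler_sum => k _.
    rewrite normrM -mulrA -exprD addnC ler_pM//.
    by rewrite ger0_norm// exprn_ge0// ltW.
  have : `|c m * t ^+ m| <= M * (t / (1 - t)) * t ^+ m.
    rewrite -(cvg_lim (@norm_hausdorff _ _) cv).
    by apply: limr_le; [exact: cvgP cv|exact: nearW].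
  by rewrite normrM (ger0_norm (exprn_ge0 m (ltW t0))) ler_pM2r ?exprn_gt0.
apply/ler_addgt0Pr => e e0; rewrite add0r.
(* This is the solution of [t / (1 - t) = e / (M + 1)]. *)
pose t : R := e / (M + e + 1).
have D0 : 0 < M + e + 1 by rewrite addr_gt0// ltr_wpDl.
have t0 : 0 < t by rewrite divr_gt0.
have t1 : t < 1 by rewrite ltr_pdivrMr// mul1r; lra.
apply: le_trans (small t t0 t1) _.
have -> : t / (1 - t) = e / (M + 1).
  by rewrite /t; field; rewrite !gt_eqF//; lra.
by rewrite mulrCA ler_piMr ?ltW// ltr_pdivrMr ?mul1r; lra.
Qed.

(** Taylor coefficients of [expR (v * t ^+ 2 / 2)], the moment generating function of the centered
    normal law of variance [v]; multiplied by the factorial of [k] they are its moments. *)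
Definition gauss_coef (v : R) (k : nat) : R :=
  (~~ odd k)%:R * (v / 2) ^+ k./2 / (k./2)`!%:R.

Lemma gauss_coef_recursion (v : R) (k : nat) :
  k.+2`!%:R * gauss_coef v k.+2 = k.+1%:R * v * (k`!%:R * gauss_coef v k).
Proof.
rewrite /gauss_coef /= negbK; have [ok|ek] := boolP (odd k); first by rewrite !mul0r !mulr0.
rewrite !mul1r exprS (factS k./2) (factS k.+1) (factS k) !natrM.
have -> : k.+2%:R = 2 * (k./2).+1%:R :> R.
  by rewrite -natrM mul2n doubleS even_halfK.
have f0 : (k./2)`!%:R != 0 :> R by rewrite pnatr_eq0 -lt0n fact_gt0.
have h0 : k./2.+1%:R != 0 :> R by rewrite pnatr_eq0.
move: f0 h0; move: ((k./2)`!%:R : R) (k./2.+1%:R : R) => a b a0 b0.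
by field; rewrite a0 b0.
Qed.

Lemma gauss_coef_series (v t : R) :
  \sum_(k < n) gauss_coef v k * t ^+ k @[n --> \oo] --> expR (v * t ^+ 2 / 2).
Proof.
(* Odd terms vanish, and [uphalf n] counts the even indices below [n]. *)
have E n : \sum_(k < n) gauss_coef v k * t ^+ k =
    \sum_(j < uphalf n) (v * t ^+ 2 / 2) ^+ j / j`!%:R.
  elim: n => [|n IH]; first by rewrite !big_ord0.
  rewrite big_ord_recr /= IH uphalf_half /gauss_coef.
  have [on|en] := boolP (odd n); first by rewrite !mul0r addr0 add1n.
  rewrite add0n big_ord_recr /= mul1r; congr (_ + _).
  rewrite -[X in t ^+ X](even_halfK en) -mul2n exprM [v * _ / _]mulrAC exprMn.
  by rewrite !exprMn [LHS]mulrAC.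
under eq_fun do rewrite E.
have u : uphalf @ \oo --> \oo.
  apply/cvgnyPge => A; exists (A.*2) => // n /= An.
  by rewrite -(uphalf_double A) uphalf_leq.
exact: (cvg_comp _ _ u (@expR_series R (v * t ^+ 2 / 2))).
Qed.

Context d (Omega : measurableType d) (P : probability Omega R).

(** One formula covers the degenerate laws: for [s = 0] the law is the Dirac mass at [m] and both
    sides are 1. *)
Lemma gaussian_mgf (Z : Omega -> R) : measurable_fun setT Z -> gaussian_rv P Z ->
  exists m s, forall t, (\int[P]_w (expR (t * (Z w - m)))%:E =
    (expR (s ^+ 2 * t ^+ 2 / 2))%:E)%E.
Proof.
move=> mZ [m [s [s0 ZA]]]; exists m, s => t.
pose f (x : R) := (expR (t * (x - m)))%:E.
have mf : measurable_fun setT f.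
  apply/measurable_EFinP; apply: measurableT_comp => //.
  by apply: measurable_funM => //; exact: measurable_funB.
have f0 x : (0 <= f x)%E by rewrite lee_fin expR_ge0.
have [se|sn] := eqVneq s 0.
  rewrite -[LHS](@ge0_integral_pushforward _ _ _ _ _ Z mZ P setT f)//.
  rewrite (@eq_measure_integral _ _ _ _ \d_m); last first.
    by move=> A mA _; have := ZA A mA; rewrite se eqxx.
  rewrite integral_dirac// diracT mul1e /f subrr mulr0 se.
  by rewrite expr0n /= !mul0r.
rewrite -(@normal_prob_mgf m s t sn).
rewrite -[LHS](@ge0_integral_pushforward _ _ _ (measurableTypeR R) _ Z mZ P setT f)//.
by apply: eq_measure_integral => A mA _; have := ZA A mA; rewrite (negbTE sn).
Qed.

(** The exponential of [lambda * |z|] is at most the sum of those of [lambda * z] and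
    [- lambda * z]. *)
Lemma gaussian_exp_integrable (Z : Omega -> R) :
  measurable_fun setT Z -> gaussian_rv P Z ->
  forall lambda : R, P.-integrable setT (fun w => (expR (lambda * `|Z w|))%:E).
Proof.
move=> mZ gZ lambda; have [m [s mgf]] := gaussian_mgf mZ gZ.
have int t : P.-integrable setT (fun w => (expR (t * Z w))%:E).
  have h : P.-integrable setT (fun w => (expR (t * (Z w - m)))%:E).
    apply/integrableP; split.
      apply/measurable_EFinP; apply: measurableT_comp => //.
      by apply: measurable_funM => //; exact: measurable_funB.
    under eq_integral do rewrite gee0_abs ?lee_fin ?expR_ge0//.
    by rewrite mgf ltry.
  have := integrableZl measurableT (expR (t * m)) h.
  apply: eq_integrable => // w _; rewrite -EFinM -expRD; congr (expR _)%:E; ring.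
apply: (le_integrable measurableT _ _ (integrableD measurableT (int lambda) (int (- lambda)))).
  apply/measurable_EFinP; apply: measurableT_comp => //.
  by apply: measurable_funM => //; exact: measurableT_comp.
move=> w _; rewrite /= lee_fin (ger0_norm (expR_ge0 _)).
rewrite [leRHS]ger0_norm ?addr_ge0 ?expR_ge0//.
case: (ger0P (Z w)) => _; first by rewrite lerDl expR_ge0.
by rewrite mulrN -mulNr lerDr expR_ge0.
Qed.

(** Expanding the moment generating function in powers of [t] identifies the moments. The variance
    enters only as a second moment, so that for [a * X + Y] the recursion becomes an identity
    between polynomials in [a]. *)
Lemma centered_gaussian_moments (Z : Omega -> R) :
  measurable_fun setT Z -> gaussian_rv P Z -> \int[P]_w Z w = 0 ->
  forall k, \int[P]_w Z w ^+ k.+2 =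
    k.+1%:R * \int[P]_w Z w ^+ 2 * \int[P]_w Z w ^+ k.
Proof.
move=> mZ gZ Z0; have [m [s mgf]] := gaussian_mgf mZ gZ.
pose V w := Z w - m.
have mV : measurable_fun setT V by exact: measurable_funB.
have Vexp (lambda : R) : P.-integrable setT (fun w => (expR (lambda * `|V w|))%:E).
  have := integrableZl measurableT (expR (`|lambda| * `|m|))
    (gaussian_exp_integrable mZ gZ `|lambda|).
  apply: le_integrable => //.
    apply/measurable_EFinP; apply: measurableT_comp => //.
    by apply: measurable_funM => //; exact: measurableT_comp.
  move=> w _; rewrite /= lee_fin (ger0_norm (expR_ge0 _)) [leRHS]ger0_norm ?mulr_ge0 ?expR_ge0//.
  rewrite -expRD ler_expR -mulrDr.
  rewrite (le_trans (ler_wpM2r (normr_ge0 _) (ler_norm lambda)))// ler_wpM2l//.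
  by rewrite addrC ler_normB.
have Vint k : P.-integrable setT (fun w => (V w ^+ k)%:E).
  exact: (exp_bounded_integrable mV Vexp (exp_bounded_exprn _ k)).
have VE k : \int[P]_w V w ^+ k = k`!%:R * gauss_coef (s ^+ 2) k.
  suff : (\int[P]_w V w ^+ k) / k`!%:R - gauss_coef (s ^+ 2) k = 0.
    move=> /eqP; rewrite subr_eq0 => /eqP <-.
    by rewrite mulrC divfK// pnatr_eq0 -lt0n fact_gt0.
  move: k; apply: (@power_series_eq0
    (fun k => (\int[P]_w V w ^+ k) / k`!%:R - gauss_coef (s ^+ 2) k)) => t.
  rewrite (_ : (fun n => _) = (fun n => \int[P]_w (\sum_(k < n) (t * V w) ^+ k / k`!%:R)
      - \sum_(k < n) gauss_coef (s ^+ 2) k * t ^+ k)); last first.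
    apply/funext => n; rewrite (_ : \int[P]_w _ =
        \sum_(k < n) (\int[P]_w V w ^+ k) / k`!%:R * t ^+ k).
      by rewrite -sumrB; apply: eq_bigr => k _; rewrite mulrBl.
    rewrite (@Rintegral_sum _ _ _ P _ (index_enum 'I_n)
      (fun k w => (t * V w) ^+ k / k`!%:R)).
      apply: eq_bigr => k _.
      under eq_Rintegral do rewrite exprMn mulrAC.
      by rewrite (RintegralZl _ measurableT (Vint k)) mulrC mulrCA mulrC.
    move=> k; have := integrableZl measurableT (t ^+ k / k`!%:R) (Vint k).
    by apply: eq_integrable => // w _; rewrite /= -EFinM exprMn mulrAC.
  suff c : \int[P]_w (\sum_(k < n) (t * V w) ^+ k / k`!%:R) @[n --> \oo] -->
      expR (s ^+ 2 * t ^+ 2 / 2).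
    by have h := cvgB c (@gauss_coef_series (s ^+ 2) t); rewrite subrr in h; exact: h.
  have -> : expR (s ^+ 2 * t ^+ 2 / 2) = \int[P]_w expR (t * V w).
    by rewrite /Rintegral mgf.
  have [] := @dominated_Rintegral _ _ _ P
    (fun n w => \sum_(k < n) (t * V w) ^+ k / k`!%:R)
    (fun w => expR (t * V w)) (fun w => expR (`|t| * `|V w|)); last by [].
  - move=> n; apply: measurable_sum => k; apply: measurable_funM => //.
    by apply: measurable_funX; exact: measurable_funM.
  - by apply: measurableT_comp => //; exact: measurable_funM.
  - by apply: aeW => w; exact: expR_series.
  - exact: Vexp.
  - move=> n w; apply: le_trans (ler_norm_sum _ _ _) _.
    apply: le_trans (exp_partial_sum_le n _); last by rewrite mulr_ge0.
    by apply: ler_sum => k _; rewrite normrM normrX normrM normfV (ger0_norm (ler0n _ _)).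
have m0 : m = 0.
  have : \int[P]_w V w = 0.
    have := VE 1%N; rewrite /gauss_coef /= !mul0r mulr0.
    by under eq_Rintegral do rewrite expr1.
  have Zint : P.-integrable setT (EFin \o Z).
    exact: (exp_bounded_integrable mZ (gaussian_exp_integrable mZ gZ) (exp_bounded_exprn _ 1)).
  rewrite RintegralB//; last exact: finite_measure_integrable_cst.
  rewrite Z0 sub0r Rintegral_cst// => /eqP; rewrite oppr_eq0.
  have P1 : fine (P setT) = 1 by rewrite probability_setT.
  by rewrite [fine _]P1 mulr1 => /eqP.
have VZ : V = Z by apply/funext => w; rewrite /V m0 subr0.
move: VE; rewrite VZ => VE k; rewrite !VE gauss_coef_recursion.
congr (_ * _ * _); rewrite /gauss_coef /=.
by rewrite expr1 !mul1r divr1 factS mulrC divfK.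
Qed.

End gaussian_moments.

(** * Hermite polynomials and Mehler's formula *)

Section hermite.
Variable R : realType.

(** Probabilists' Hermite polynomials, orthogonal for the standard normal law. *)
Fixpoint hermite (m : nat) : {poly R} :=
  if m is n.+1 then 'X * hermite n - (hermite n)^`() else 1.

Lemma size_hermite (m : nat) : size (hermite m) = m.+1.
Proof.
elim: m => [|m IH] /=; first by rewrite size_poly1.
have h0 : hermite m != 0 by rewrite -size_poly_eq0 IH.
have sX : size ('X * hermite m) = m.+2 by rewrite mulrC size_mulX// IH.
rewrite size_polyDl sX// size_polyN.
by apply: ltn_trans (lt_size_deriv h0) _; rewrite IH.
Qed.

Lemma hermite_monic (m : nat) : (hermite m)`_m = 1.
Proof.
elim: m => [|m IH] /=; first by rewrite coef1.
rewrite coefB coefXM /= IH nth_default ?subr0//.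
have h0 : hermite m != 0 by rewrite -size_poly_eq0 size_hermite.
by apply: ltnW; have := lt_size_deriv h0; rewrite size_hermite.
Qed.

Lemma hermite_span (n : nat) (p : {poly R}) : (size p <= n)%N ->
  exists c : nat -> R, p = \sum_(m < n) c m *: hermite m.
Proof.
elim: n p => [|n IH] p sp.
  by exists (fun=> 0); rewrite big_ord0; apply/eqP; rewrite -size_poly_leq0.
have [] := IH (p - p`_n *: hermite n).
  apply/leq_sizeP => j; rewrite leq_eqVlt => /orP[/eqP <-|nj].
    by rewrite coefB coefZ hermite_monic mulr1 subrr.
  rewrite coefB coefZ (nth_default _ (leq_trans sp nj)).
  by rewrite (@nth_default _ _ (hermite n)) ?size_hermite// mulr0 subrr.
move=> c pc; exists (fun m => if (m < n)%N then c m else p`_n).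
rewrite big_ord_recr /= ltnn -[LHS](subrK (p`_n *: hermite n)) pc; congr (_ + _).
by apply: eq_bigr => m _; rewrite ltn_ord.
Qed.

Lemma poly_linear_ind (Q : {poly R} -> Prop) :
  Q 0 -> (forall a p q, Q p -> Q q -> Q (a *: p + q)) -> (forall i, Q 'X^i) ->
  forall p, Q p.
Proof.
move=> Q0 Qlin QX p; rewrite -[p]coefK poly_def.
by apply: (big_ind Q) => // [x y Qx Qy|i _];
  [rewrite -[x]scale1r; exact: Qlin|rewrite -[_ *: _]addr0; exact: Qlin].
Qed.

Lemma horner_eq0 (p : {poly R}) : (forall t, p.[t] = 0) -> p = 0.
Proof.
move=> p0; apply/polyP => k; rewrite coef0.
apply: (@power_series_eq0 R (fun k => p`_k)) => t.
apply: cvg_near_cst; exists (size p) => // n /= pn.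
by rewrite -(horner_coef_wide t pn) p0.
Qed.

End hermite.

(** * Mixed moments of a centered Gaussian pair *)

Section bivariate.
Context d (Omega : measurableType d) (R : realType) (P : probability Omega R).
Variables X Y : Omega -> R.
Hypotheses (mX : measurable_fun setT X) (mY : measurable_fun setT Y).
Hypothesis XY_gaussian : forall a b : R, gaussian_rv P (fun w => a * X w + b * Y w).
Hypotheses (EX : \int[P]_w X w = 0) (EY : \int[P]_w Y w = 0).
Hypotheses (EX2 : \int[P]_w X w ^+ 2 = 1) (EY2 : \int[P]_w Y w ^+ 2 = 1).

Let r := \int[P]_w (X w * Y w).

Let gX : gaussian_rv P X.
Proof.
rewrite (_ : X = fun w => 1 * X w + 0 * Y w); first exact: XY_gaussian.
by apply/funext => w; rewrite mul1r mul0r addr0.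
Qed.

Let gY : gaussian_rv P Y.
Proof.
rewrite (_ : Y = fun w => 0 * X w + 1 * Y w); first exact: XY_gaussian.
by apply/funext => w; rewrite mul1r mul0r add0r.
Qed.

Let L2X (p : {poly R}) : L2 P (fun w => p.[X w]).
Proof. exact: (exp_bounded_L2 mX (gaussian_exp_integrable mX gX) (exp_bounded_horner p)). Qed.

Let L2Y (p : {poly R}) : L2 P (fun w => p.[Y w]).
Proof. exact: (exp_bounded_L2 mY (gaussian_exp_integrable mY gY) (exp_bounded_horner p)). Qed.

Let moment (i j : nat) : R := \int[P]_w (X w ^+ i * Y w ^+ j).

Let moment_int (i j : nat) :
  P.-integrable setT (EFin \o (fun w => X w ^+ i * Y w ^+ j)).
Proof.
have := L2M_integrable (L2X 'X^i) (L2Y 'X^j).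
by apply: eq_integrable => // w _; rewrite /= !hornerXn.
Qed.

(** Gaussianity is given for linear combinations of [X] and [Y]. This polynomial in [a] is the
    moment of order [k] of [a * X + Y]; the mixed moments are read off its coefficients. *)
Let mpoly (k : nat) : {poly R} :=
  \poly_(i < k.+1) ('C(k, i)%:R * moment i (k - i)).

Let mpoly_coef (k i : nat) : (mpoly k)`_i = 'C(k, i)%:R * moment i (k - i).
Proof. by rewrite coef_poly ltnS; case: leqP => // ki; rewrite bin_small// mul0r. Qed.

Let mpolyE (k : nat) (a : R) :
  (mpoly k).[a] = \int[P]_w (a * X w + 1 * Y w) ^+ k.
Proof.
rewrite (_ : (fun w => (a * X w + 1 * Y w) ^+ k) =
    fun w => \sum_(i < k.+1) ('C(k, i)%:R * a ^+ i) * (X w ^+ i * Y w ^+ (k - i))).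
  rewrite (@Rintegral_sum _ _ _ P _ (index_enum 'I_k.+1)
    (fun i w => ('C(k, i)%:R * a ^+ i) * (X w ^+ i * Y w ^+ (k - i)))).
    rewrite horner_poly; apply: eq_bigr => i _.
    by rewrite (RintegralZl _ measurableT (moment_int i (k - i))) mulrAC.
  move=> i; have := integrableZl measurableT ('C(k, i)%:R * a ^+ i) (moment_int i (k - i)).
  exact: eq_integrable.
apply/funext => w; rewrite mul1r addrC exprDn; apply: eq_bigr => i _.
by rewrite exprMn -mulr_natl; ring.
Qed.

Let mpoly_recursion (k : nat) : mpoly k.+2 = k.+1%:R *: (mpoly 2 * mpoly k).
Proof.
apply/eqP; rewrite -subr_eq0; apply/eqP/horner_eq0 => a.
rewrite hornerD hornerN hornerZ hornerM !mpolyE mulrA; apply/eqP; rewrite subr_eq0.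
apply/eqP/centered_gaussian_moments => //.
  by apply: measurable_funD; exact: measurable_funM.
have iX : P.-integrable setT (EFin \o X).
  by have := moment_int 1 0; apply: eq_integrable => // w _ /=; rewrite expr1 mulr1.
have iY : P.-integrable setT (EFin \o Y).
  by have := moment_int 0 1; apply: eq_integrable => // w _ /=; rewrite expr1 mul1r.
have aX := integrableZl measurableT a iX; have bY := integrableZl measurableT 1 iY.
rewrite RintegralD// (RintegralZl _ measurableT iX) (RintegralZl _ measurableT iY).
by rewrite EX EY !mulr0 addr0.
Qed.

Let moment00 : moment 0 0 = 1.
Proof.
rewrite /moment; under eq_Rintegral do rewrite !expr0 mul1r.
have P1 : fine (P setT) = 1 by rewrite probability_setT.
by rewrite Rintegral_cst// mul1r [fine _]P1.
Qed.

Let moment10 : moment 1 0 = 0.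
Proof. by rewrite -EX; apply: eq_Rintegral => w _; rewrite expr1 mulr1. Qed.

Let moment01 : moment 0 1 = 0.
Proof. by rewrite -EY; apply: eq_Rintegral => w _; rewrite expr1 mul1r. Qed.

Let moment11 : moment 1 1 = r. Proof. by []. Qed.

Let moment20 : moment 2 0 = 1.
Proof. by rewrite -EX2; apply: eq_Rintegral => w _; rewrite mulr1. Qed.

Let moment02 : moment 0 2 = 1.
Proof. by rewrite -EY2; apply: eq_Rintegral => w _; rewrite mul1r. Qed.

Let mpoly0 : mpoly 0 = 1.
Proof.
apply/polyP => -[|i]; rewrite mpoly_coef coef1 /=; last by rewrite bin0n mul0r.
by rewrite bin0 mul1r moment00.
Qed.

Let mpoly1 : mpoly 1 = 0.
Proof.
apply/polyP => -[|[|i]]; rewrite mpoly_coef coef0 /= ?moment01 ?moment10 ?mulr0//.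
by rewrite bin_small// mul0r.
Qed.

Let mpoly2 : mpoly 2 = 'X^2 + (2 * r) *: 'X + 1.
Proof.
apply/polyP => -[|[|[|i]]]; rewrite mpoly_coef !coefD coefXn coefZ coefX coef1 /=.
- by rewrite moment02 mulr0 !add0r mulr1.
- by rewrite moment11 mulr1 add0r addr0.
- by rewrite moment20 mulr0 !addr0 mulr1.
- by rewrite bin_small// mulr0 mul0r !addr0.
Qed.

(** Differentiation in [a] amounts to integration by parts for powers of [a * X + Y], with [a + r]
    the covariance of [X] and [a * X + Y]. It follows from the moment recursion by induction in
    steps of two. *)
Let mpoly_deriv (k : nat) :
  (mpoly k.+2)^`() = (k.+2 * k.+1)%:R *: (('X + r%:P) * mpoly k).
Proof.
have d2 : (mpoly 2)^`() = 2%:R *: ('X + r%:P).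
  rewrite mpoly2 !derivD derivXn derivZ derivX -[1 in X in _ + X]polyC1 derivC addr0.
  by rewrite /= expr1 -!mul_polyC polyCM mulr1; ring.
elim/ltn_ind: k => -[|[|k]] IH.
- by rewrite d2 mpoly0 mulr1.
- by rewrite mpoly_recursion mpoly1 !mulr0 scaler0 deriv0 scaler0.
- rewrite mpoly_recursion derivZ derivM d2 IH//.
  rewrite -!mul_polyC !natrM !polyCM.
  have := congr1 (fun p => ('X + r%:P) * p) (mpoly_recursion k).
  rewrite -mul_polyC => e.
  transitivity (k.+3%:R%:P * ((2%:R%:P + k.+2%:R%:P) * (('X + r%:P) * mpoly k.+2))).
    transitivity (k.+3%:R%:P * (2%:R%:P * (('X + r%:P) * mpoly k.+2) +
      k.+2%:R%:P * (('X + r%:P) * (k.+1%:R%:P * (mpoly 2 * mpoly k))))).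
      by ring.
    by rewrite -e; ring.
  by rewrite -polyCD -natrD add2n; ring.
Qed.

(** Coefficient of degree [i] in [mpoly_deriv], with [i + j = k + 1]. When [i] or [j] is 0 its
    predecessor is truncated, but the factor in front is 0. *)
Let stein_moment (i j : nat) :
  moment i.+1 j = i%:R * moment i.-1 j + j%:R * r * moment i j.-1.
Proof.
have [/eqP|] := posnP (i + j)%N.
  rewrite addn_eq0 => /andP[/eqP -> /eqP ->].
  by rewrite moment10 !mul0r addr0.
rewrite -[(0 < _)%N]/(0 < _)%N => ij0.
have [k ijk] : exists k, (i + j)%N = k.+1 by exists (i + j).-1; rewrite prednK.
have ik : (i <= k.+1)%N by rewrite -ijk leq_addr.
have kj : j = (k.+1 - i)%N by rewrite -ijk addKn.
have := congr1 (fun p : {poly R} => p`_i) (mpoly_deriv k).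
rewrite /= coef_deriv mpoly_coef coefZ mulrDl coefD coefXM coefCM !mpoly_coef.
have -> : (k.+2 - i.+1)%N = j by rewrite kj subSS.
rewrite -[LHS]mulr_natl => E.
have C0 : 'C(k.+1, i)%:R != 0 :> R by rewrite pnatr_eq0 -lt0n bin_gt0.
have F1 : i.+1%:R * 'C(k.+2, i.+1)%:R = k.+2%:R * 'C(k.+1, i)%:R :> R.
  by rewrite -!natrM mul_bin_diag.
have F3 : k.+1%:R * 'C(k, i)%:R = j%:R * 'C(k.+1, i)%:R :> R.
  by rewrite -!natrM kj mul_bin_down.
have k2 : k.+2%:R != 0 :> R by rewrite pnatr_eq0.
apply: (mulfI (mulf_neq0 k2 C0)).
rewrite -[X in X * _ = _]F1 -[LHS]mulrA E natrM.
have -> : moment i (k - i) = moment i j.-1.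
  by rewrite kj -subn1 -subnDA addn1 subSS.
case: i => [|i] in ij0 ijk ik kj E C0 F1 F3 *.
  rewrite /= add0r mul0r add0r.
  transitivity (k.+2%:R * r * moment 0 j.-1 * (k.+1%:R * 'C(k, 0)%:R)); first by ring.
  by rewrite F3; ring.
have F2 : i.+1%:R * 'C(k.+1, i.+1)%:R = k.+1%:R * 'C(k, i)%:R :> R.
  by rewrite -!natrM mul_bin_diag.
have -> : (k - i)%N = j by rewrite kj subSS.
rewrite /=.
transitivity (k.+2%:R * (moment i j * (k.+1%:R * 'C(k, i)%:R) +
  r * moment i.+1 j.-1 * (k.+1%:R * 'C(k, i.+1)%:R))); first by ring.
by rewrite F3 -F2; ring.
Qed.

Let L2XY_int (p q : {poly R}) :
  P.-integrable setT (EFin \o (fun w => p.[X w] * q.[Y w])).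
Proof. exact: L2M_integrable. Qed.

Let pairing (p q : {poly R}) : R := \int[P]_w (p.[X w] * q.[Y w]).

Let pairing_linear_l (a : R) (p p' q : {poly R}) :
  pairing (a *: p + p') q = a * pairing p q + pairing p' q.
Proof.
rewrite /pairing -(RintegralZl a measurableT (L2XY_int p q)) -RintegralD//.
  by apply: eq_Rintegral => w _; rewrite hornerD hornerZ mulrDl mulrA.
exact: (integrableZl measurableT a (L2XY_int p q)).
Qed.

Let pairing_linear_r (a : R) (p q q' : {poly R}) :
  pairing p (a *: q + q') = a * pairing p q + pairing p q'.
Proof.
rewrite /pairing -(RintegralZl a measurableT (L2XY_int p q)) -RintegralD//.
  by apply: eq_Rintegral => w _; rewrite hornerD hornerZ mulrDr mulrCA.
exact: (integrableZl measurableT a (L2XY_int p q)).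
Qed.

Let pairing0l (q : {poly R}) : pairing 0 q = 0.
Proof.
by rewrite -[RHS](subrr (pairing 0 q)) -{2}[0]addr0 -{2}(scale1r 0) pairing_linear_l mul1r; ring.
Qed.

Let pairing0r (p : {poly R}) : pairing p 0 = 0.
Proof.
rewrite /pairing; under eq_Rintegral do rewrite horner0 mulr0.
by rewrite Rintegral_cst// mul0r.
Qed.

(** Both sides are bilinear in [p] and [q]; on monomials the identity is [stein_moment]. *)
Lemma gaussian_integration_by_parts (p q : {poly R}) :
  \int[P]_w (('X * p).[X w] * q.[Y w]) =
  \int[P]_w (p^`().[X w] * q.[Y w]) + r * \int[P]_w (p.[X w] * q^`().[Y w]).
Proof.
rewrite -/(pairing ('X * p) q) -/(pairing p^`() q) -/(pairing p q^`()).
elim/poly_linear_ind: p => [|a p p' IHp IHp'|i].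
- by rewrite mulr0 deriv0 !pairing0l mulr0 addr0.
- rewrite mulrDr -scalerAr derivD derivZ !pairing_linear_l IHp IHp'; ring.
elim/poly_linear_ind: q => [|a q q' IHq IHq'|j].
- by rewrite deriv0 !pairing0r mulr0 addr0.
- rewrite derivD derivZ !pairing_linear_r IHq IHq'; ring.
have mE (a b : nat) : pairing 'X^a 'X^b = moment a b.
  by apply: eq_Rintegral => w _; rewrite !hornerXn.
have nE (a b c : nat) : pairing ('X^a *+ c) 'X^b = c%:R * moment a b.
  by rewrite -scaler_nat -[_ *: _]addr0 pairing_linear_l pairing0l addr0 mE.
have nE' (a b c : nat) : pairing 'X^a ('X^b *+ c) = c%:R * moment a b.
  by rewrite -scaler_nat -[_ *: _]addr0 pairing_linear_r pairing0r addr0 mE.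
by rewrite -exprS !derivXn mE nE nE' stein_moment; ring.
Qed.

(** Integration by parts cancels the derivative in the recursion of [hermite] and moves one
    derivative onto [q] at the price of a factor [r], once for each of the [m] steps. *)
Lemma hermite_pairing (m : nat) (q : {poly R}) :
  \int[P]_w ((hermite R m).[X w] * q.[Y w]) = r ^+ m * \int[P]_w q^`(m).[Y w].
Proof.
elim: m q => [|m IH] q.
  by rewrite mul1r; apply: eq_Rintegral => w _; rewrite hornerC mul1r.
rewrite -/(pairing _ _) /= -[_ - _]addrC -scaleN1r pairing_linear_l /pairing.
by rewrite gaussian_integration_by_parts IH -derivSn exprS; ring.
Qed.

End bivariate.

Section hermite_orthogonality.
Context d (Omega : measurableType d) (R : realType) (P : probability Omega R).

(** Case [Y = X], [r = 1] of [hermite_pairing]: with the larger index first, the other polynomial is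
    differentiated to 0, or to a factorial when the indices agree. *)
Lemma hermite_orthogonal (X : Omega -> R) (m n : nat) :
  measurable_fun setT X -> (forall a : R, gaussian_rv P (fun w => a * X w)) ->
  \int[P]_w X w = 0 -> \int[P]_w X w ^+ 2 = 1 ->
  \int[P]_w ((hermite R m).[X w] * (hermite R n).[X w]) =
  (m == n)%:R * m`!%:R.
Proof.
move=> mX gX EX EX2.
have gXX a b : gaussian_rv P (fun w => a * X w + b * X w).
  by under eq_fun do rewrite -mulrDl.
have r1 : \int[P]_w (X w * X w) = 1 by rewrite -EX2; apply: eq_Rintegral.
have P1 : fine (P setT) = 1 by rewrite probability_setT.
have H k l : (k <= l)%N ->
    \int[P]_w ((hermite R l).[X w] * (hermite R k).[X w]) = (l == k)%:R * l`!%:R.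
  move=> kl; rewrite (hermite_pairing mX mX gXX EX EX EX2 EX2) r1 expr1n mul1r.
  have [->|lk] := eqVneq l k.
    rewrite mul1r (_ : (hermite R k)^`(k) = k`!%:R%:P).
      by under eq_Rintegral do rewrite hornerC; rewrite Rintegral_cst// [fine _]P1 mulr1.
    apply/polyP => -[|i]; rewrite coef_derivn coefC /=.
      by rewrite addn0 hermite_monic ffactnn.
    by rewrite nth_default ?mul0rn// size_hermite addnS ltnS leq_addr.
  rewrite mul0r derivn_poly0; last by rewrite size_hermite ltn_neqAle eq_sym lk.
  by under eq_Rintegral do rewrite horner0; rewrite Rintegral_cst// mul0r.
case: (leqP n m) => [|/ltnW] mn; first exact: H.
rewrite eq_sym; have := H _ _ mn.
under eq_Rintegral do rewrite mulrC.
by move=> ->; case: eqP => [->//|_]; rewrite !mul0r.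
Qed.

(** [hermite_pairing] leaves the mean of a derivative in [Y] alone, which the same identity for the
    pair [(Y, Y)] evaluates. *)
Lemma hermite_cross (X Y : Omega -> R) (m n : nat) :
  measurable_fun setT X -> measurable_fun setT Y ->
  (forall a b : R, gaussian_rv P (fun w => a * X w + b * Y w)) ->
  \int[P]_w X w = 0 -> \int[P]_w Y w = 0 ->
  \int[P]_w X w ^+ 2 = 1 -> \int[P]_w Y w ^+ 2 = 1 ->
  \int[P]_w ((hermite R m).[X w] * (hermite R n).[Y w]) =
  (m == n)%:R * m`!%:R * (\int[P]_w (X w * Y w)) ^+ m.
Proof.
move=> mX mY gXY EX EY EX2 EY2.
have gY a : gaussian_rv P (fun w => a * Y w).
  rewrite (_ : (fun w => _) = fun w => 0 * X w + a * Y w); first exact: gXY.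
  by apply/funext => w; rewrite mul0r add0r.
have gYY a b : gaussian_rv P (fun w => a * Y w + b * Y w).
  by under eq_fun do rewrite -mulrDl.
have r1 : \int[P]_w (Y w * Y w) = 1 by rewrite -EY2; apply: eq_Rintegral.
rewrite (hermite_pairing mX mY gXY EX EY EX2 EY2) mulrC; congr (_ * _).
rewrite -(hermite_orthogonal m n mY gY EY EY2).
by rewrite (hermite_pairing mY mY gYY EY EY EY2 EY2) r1 expr1n mul1r.
Qed.

End hermite_orthogonality.

Section cauchy_schwarz.
Context d (Omega : measurableType d) (R : realType) (P : probability Omega R).

Lemma Rintegral_L2_linear (a : R) (F G H : Omega -> R) :
  L2 P F -> L2 P G -> L2 P H ->
  \int[P]_w ((a * F w + G w) * H w) =
  a * \int[P]_w (F w * H w) + \int[P]_w (G w * H w).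
Proof.
move=> LF LG LH; have iFH := L2M_integrable LF LH; have iGH := L2M_integrable LG LH.
rewrite -(RintegralZl a measurableT iFH) -RintegralD//.
  by apply: eq_Rintegral => w _; ring.
exact: (integrableZl measurableT a iFH).
Qed.

Lemma Rintegral_sqr_ge0 (F : Omega -> R) : 0 <= \int[P]_w F w ^+ 2.
Proof. by apply: Rintegral_ge0 => w _; exact: sqr_ge0. Qed.

Lemma Rintegral_sqrE (F : Omega -> R) :
  \int[P]_w F w ^+ 2 = \int[P]_w (F w * F w).
Proof. by []. Qed.

Lemma cauchy_schwarz_Rintegral (F G : Omega -> R) : L2 P F -> L2 P G ->
  `|\int[P]_w (F w * G w)| <= Num.sqrt ((\int[P]_w F w ^+ 2) * \int[P]_w G w ^+ 2).
Proof.
move=> LF LG.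
have GC : \int[P]_w (G w * F w) = \int[P]_w (F w * G w).
  by apply: eq_Rintegral => w _; rewrite mulrC.
have quad a b : 0 <= a ^+ 2 * \int[P]_w F w ^+ 2 +
    a * b * (\int[P]_w (F w * G w)) *+ 2 + b ^+ 2 * \int[P]_w G w ^+ 2.
  apply: le_trans (Rintegral_sqr_ge0 (fun w => a * F w + b * G w)) _.
  have LbG := L2Z b LG; have LaF := L2Z a LF.
  rewrite Rintegral_sqrE (Rintegral_L2_linear a LF LbG (L2D LaF LbG)).
  have e1 : \int[P]_w (F w * (a * F w + b * G w)) =
      a * \int[P]_w F w ^+ 2 + b * \int[P]_w (F w * G w).
    rewrite -GC Rintegral_sqrE.
    under eq_Rintegral do rewrite mulrC.
    rewrite (Rintegral_L2_linear a LF LbG LF); congr (_ + _).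
    under eq_Rintegral do rewrite -mulrA.
    by rewrite (RintegralZl b measurableT (L2M_integrable LG LF)).
  have e2 : \int[P]_w (b * G w * (a * F w + b * G w)) =
      b * (a * \int[P]_w (F w * G w) + b * \int[P]_w G w ^+ 2).
    under eq_Rintegral do rewrite -mulrA.
    rewrite (RintegralZl b measurableT (L2M_integrable LG (L2D LaF LbG))).
    rewrite Rintegral_sqrE; congr (_ * _).
    under eq_Rintegral do rewrite mulrC.
    rewrite (Rintegral_L2_linear a LF LbG LG); congr (_ + _).
    under eq_Rintegral do rewrite -mulrA.
    by rewrite (RintegralZl b measurableT (L2M_integrable LG LG)).
  by rewrite e1 e2 le_eqVlt; apply/orP; left; apply/eqP; ring.
have := quad; have := Rintegral_sqr_ge0 F; have := Rintegral_sqr_ge0 G.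
move: (\int[P]_w F w ^+ 2) (\int[P]_w G w ^+ 2) (\int[P]_w (F w * G w)).
move=> A B C B0 A0 q.
rewrite -sqrtr_sqr ler_sqrt ?mulr_ge0//.
move: B0; rewrite le_eqVlt => /orP[/eqP B0|B0].
  have [->|C0] := eqVneq C 0; first by rewrite expr0n /= -B0 mulr0.
  have := q 1 (- (A + 1) / (2 * C)).
  rewrite -B0 mulr0 addr0 expr1n !mul1r.
  have -> : A + - (A + 1) / (2 * C) * C *+ 2 = -1 by field.
  by rewrite oppr_ge0 ler10.
rewrite -(ler_pM2r B0) -subr_ge0.
(* The quadratic form at [(B, - C)] is [B * (A * B - C ^+ 2)]. *)
have := q B (- C); congr (0 <= _); ring.
Qed.

End cauchy_schwarz.

(** * Hermite expansions, Parseval's identity and Mehler's formula *)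

Section hermite_expansion.
Context d (Omega : measurableType d) (R : realType) (P : probability Omega R).
Variables (T : Type) (X : T -> Omega -> R).
Hypothesis mX : forall t, measurable_fun setT (X t).
Hypothesis X_gaussian : forall s t (a b : R),
  gaussian_rv P (fun w => a * X s w + b * X t w).
Hypothesis EX : forall t, \int[P]_w X t w = 0.
Hypothesis EX2 : forall t, \int[P]_w X t w ^+ 2 = 1.

Let r s t := \int[P]_w (X s w * X t w).

Definition hermite1 (m : nat) : {poly R} := (Num.sqrt m`!%:R)^-1 *: hermite R m.

Definition hermite_coef (f : R -> R) (t : T) (m : nat) : R :=
  \int[P]_w ((hermite1 m).[X t w] * f (X t w)).

Let X_exp t (lambda : R) : P.-integrable setT (fun w => (expR (lambda * `|X t w|))%:E).
Proof.
apply: gaussian_exp_integrable => //.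
rewrite (_ : X t = fun w => 1 * X t w + 0 * X t w); first exact: X_gaussian.
by apply/funext => w; rewrite mul1r mul0r addr0.
Qed.

Let L2_horner (p : {poly R}) t : L2 P (fun w => p.[X t w]).
Proof. exact: (exp_bounded_L2 (mX t) (X_exp t) (exp_bounded_horner p)). Qed.

Let fact_sqrt_neq0 (m : nat) : Num.sqrt m`!%:R != 0 :> R.
Proof. by rewrite gt_eqF// sqrtr_gt0 ltr0n fact_gt0. Qed.

Lemma hermite1_cross (m n : nat) s t :
  \int[P]_w ((hermite1 m).[X s w] * (hermite1 n).[X t w]) = (m == n)%:R * r s t ^+ m.
Proof.
rewrite (_ : \int[P]_w _ = \int[P]_w ((Num.sqrt m`!%:R)^-1 * (Num.sqrt n`!%:R)^-1 *
    ((hermite R m).[X s w] * (hermite R n).[X t w]))); last first.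
  by apply: eq_Rintegral => w _; rewrite !hornerZ; ring.
rewrite (RintegralZl _ measurableT (L2M_integrable (L2_horner _ s) (L2_horner _ t))).
rewrite hermite_cross//; case: eqVneq => [<-|_]; last by rewrite !mul0r mulr0.
rewrite !mul1r mulrA -[X in _ * X * _](@sqr_sqrtr R)// expr2.
rewrite -/(r s t); move: (fact_sqrt_neq0 m) (r s t ^+ m).
by move: (Num.sqrt _) => q q0 z; field.
Qed.

Lemma hermite_sum_cross (a b : nat -> R) (n : nat) s t :
  \int[P]_w ((\sum_(m < n) a m *: hermite1 m).[X s w] *
             (\sum_(m < n) b m *: hermite1 m).[X t w]) =
  \sum_(m < n) a m * b m * r s t ^+ m.
Proof.
have i0 m l := L2M_integrable (L2_horner (hermite1 m) s) (L2_horner (hermite1 l) t).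
have i1 m l : P.-integrable setT (EFin \o
    (fun w => a m * b l * ((hermite1 m).[X s w] * (hermite1 l).[X t w]))).
  exact: (integrableZl measurableT (a m * b l) (i0 m l)).
rewrite (_ : \int[P]_w _ = \int[P]_w \sum_(m < n) \sum_(l < n)
    (a m * b l * ((hermite1 m).[X s w] * (hermite1 l).[X t w]))); last first.
  apply: eq_Rintegral => w _; rewrite !horner_sum mulr_suml.
  apply: eq_bigr => m _; rewrite mulr_sumr; apply: eq_bigr => l _.
  by rewrite !hornerZ; ring.
rewrite (@Rintegral_sum _ _ _ P _ (index_enum 'I_n) (fun m w => \sum_(l < n)
    (a m * b l * ((hermite1 m).[X s w] * (hermite1 l).[X t w])))).
  apply: eq_bigr => m _.
  rewrite (@Rintegral_sum _ _ _ P _ (index_enum 'I_n) (fun l w =>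
    (a m * b l * ((hermite1 m).[X s w] * (hermite1 l).[X t w])))); last by move=> l.
  rewrite (bigD1 m)//= (RintegralZl _ measurableT (i0 m m)) hermite1_cross eqxx mul1r.
  rewrite big1 ?addr0// => l lm.
  rewrite (RintegralZl _ measurableT (i0 m l)) hermite1_cross.
  by rewrite (negbTE (_ : (m : nat) != l)) ?mul0r ?mulr0// eq_sym.
move=> m; rewrite (_ : EFin \o _ = fun w => (\sum_(l < n)
    (a m * b l * ((hermite1 m).[X s w] * (hermite1 l).[X t w]))%:E)%E).
  by apply: integrable_sum => // l _; exact: i1.
by apply/funext => w /=; rewrite sumEFin.
Qed.

(** Pythagoras around the orthogonal projection: with [c] the Hermite coefficients it yields
    Bessel's inequality, with any other [c] the optimality of the projection. *)
Lemma hermite_sum_distance (f : R -> R) (c : nat -> R) (n : nat) t :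
  L2 P (fun w => f (X t w)) ->
  \int[P]_w (f (X t w) - (\sum_(m < n) c m *: hermite1 m).[X t w]) ^+ 2 =
  \int[P]_w f (X t w) ^+ 2 - \sum_(m < n) hermite_coef f t m ^+ 2 +
  \sum_(m < n) (c m - hermite_coef f t m) ^+ 2.
Proof.
move=> Lf; set p := \sum_(m < n) _.
have Lp := L2_horner p t.
have rtt : r t t = 1 by rewrite /r -(EX2 t).
have fp : \int[P]_w (f (X t w) * p.[X t w]) = \sum_(m < n) c m * hermite_coef f t m.
  have i0 m := L2M_integrable (L2_horner (hermite1 m) t) Lf.
  rewrite (_ : \int[P]_w _ =
      \int[P]_w \sum_(m < n) c m * ((hermite1 m).[X t w] * f (X t w))); last first.
    apply: eq_Rintegral => w _; rewrite horner_sum mulr_sumr.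
    by apply: eq_bigr => m _; rewrite hornerZ; ring.
  rewrite (@Rintegral_sum _ _ _ P _ (index_enum 'I_n)
      (fun m w => c m * ((hermite1 m).[X t w] * f (X t w)))).
    by apply: eq_bigr => m _; rewrite (RintegralZl _ measurableT (i0 m)).
  by move=> m; exact: (integrableZl measurableT (c m) (i0 m)).
have pp : \int[P]_w (p.[X t w] * p.[X t w]) = \sum_(m < n) c m ^+ 2.
  rewrite hermite_sum_cross; apply: eq_bigr => m _.
  by rewrite rtt expr1n mulr1.
rewrite (_ : \int[P]_w _ = \int[P]_w (1 * f (X t w) ^+ 2 +
    (-2 * (f (X t w) * p.[X t w]) + p.[X t w] * p.[X t w]))); last first.
  by apply: eq_Rintegral => w _; ring.
have i1 := L2M_integrable Lf Lp; have i2 := L2M_integrable Lp Lp.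
have i3 := integrableZl measurableT (-2) i1.
have i4 := L2_sqr_integrable Lf.
rewrite RintegralD//; [|exact: (integrableZl measurableT 1 i4)|exact: (integrableD measurableT i3 i2)].
rewrite RintegralD// (RintegralZl _ measurableT i1) (RintegralZl _ measurableT i4).
rewrite fp pp mul1r -addrA; congr (_ + _).
rewrite mulr_sumr -big_split /= -sumrN -big_split /=.
by apply: eq_bigr => m _; ring.
Qed.

(** Bessel's inequality bounds the partial sums. A polynomial within [e] in mean square, expanded in
    Hermite polynomials, is no closer than the projection, so the missing mass is at most [e]. *)
Lemma hermite_parseval (f : R -> R) t : measurable_fun setT f ->
  L2 P (fun w => f (X t w)) ->
  \sum_(m < n) hermite_coef f t m ^+ 2 @[n --> \oo] --> \int[P]_w f (X t w) ^+ 2.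
Proof.
move=> mf Lf.
have bessel n : \sum_(m < n) hermite_coef f t m ^+ 2 <= \int[P]_w f (X t w) ^+ 2.
  have := hermite_sum_distance (hermite_coef f t) n Lf.
  rewrite [X in _ + X]big1 ?addr0; last by move=> m _; rewrite subrr expr0n.
  by move=> e; rewrite -subr_ge0 -e Rintegral_sqr_ge0.
apply/cvgrPdist_le => e e0.
have [_ _ /(_ e e0) [p hp]] := polynomials_dense (mX t) (X_exp t) mf Lf.
have [c pc] := hermite_span (leqnn (size p)).
pose c' m := c m * Num.sqrt m`!%:R.
have pc' : p = \sum_(m < size p) c' m *: hermite1 m.
  rewrite {1}pc; apply: eq_bigr => m _.
  by rewrite /c' /hermite1 scalerA mulfK.
exists (size p) => // n /= pn.
rewrite ger0_norm; last by rewrite subr_ge0; exact: bessel.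
rewrite lerBlDl.
have := hermite_sum_distance c' (size p) Lf; rewrite -pc' => pd.
have : \sum_(m < size p) hermite_coef f t m ^+ 2 <= \sum_(m < n) hermite_coef f t m ^+ 2.
  rewrite -(subnKC pn) big_split_ord /= lerDl.
  by apply: sumr_ge0 => m _; exact: sqr_ge0.
have : 0 <= \sum_(m < size p) (c' m - hermite_coef f t m) ^+ 2.
  by apply: sumr_ge0 => m _; exact: sqr_ge0.
by move: hp; rewrite pd; lra.
Qed.

(** For Hermite partial sums this is [hermite_sum_cross]. The error splits as
    [(f - S) * g + S * (g - S')], and Cauchy-Schwarz, with Bessel's bound on [S], makes both parts
    tend to 0. *)
Lemma mehler (f g : R -> R) s t :
  measurable_fun setT f -> measurable_fun setT g ->
  L2 P (fun w => f (X s w)) -> L2 P (fun w => g (X t w)) ->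
  \sum_(m < n) hermite_coef f s m * hermite_coef g t m * r s t ^+ m @[n --> \oo] -->
  \int[P]_w (f (X s w) * g (X t w)).
Proof.
move=> mf mg Lf Lg.
pose S n := \sum_(m < n) hermite_coef f s m *: hermite1 m.
pose S' n := \sum_(m < n) hermite_coef g t m *: hermite1 m.
pose D n := \int[P]_w (f (X s w) - (S n).[X s w]) ^+ 2.
pose D' n := \int[P]_w (g (X t w) - (S' n).[X t w]) ^+ 2.
have dist0 h u : measurable_fun setT h -> L2 P (fun w => h (X u w)) ->
    \int[P]_w (h (X u w) - (\sum_(m < n) hermite_coef h u m *: hermite1 m).[X u w]) ^+ 2
    @[n --> \oo] --> 0.
  move=> mh Lh.
  have := cvgB (cvg_cst (\int[P]_w h (X u w) ^+ 2)) (hermite_parseval mh Lh).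
  rewrite subrr => /(_ _ _); apply: cvg_trans; apply: near_eq_cvg; apply: nearW => n.
  rewrite hermite_sum_distance// [X in _ = _ + X]big1 ?addr0//.
  by move=> m _; rewrite subrr expr0n.
have D0 : D @ \oo --> 0 by exact: dist0.
have D'0 : D' @ \oo --> 0 by exact: dist0.
pose A := \int[P]_w f (X s w) ^+ 2; pose B := \int[P]_w g (X t w) ^+ 2.
have sqrt0 (u : nat -> R) (k : R) : u @ \oo --> 0 -> Num.sqrt (u n * k) @[n --> \oo] --> 0.
  move=> u0; rewrite -[X in _ --> X]sqrtr0 -[X in Num.sqrt X](mul0r k).
  apply: (@cvg_comp _ _ _ (fun n => u n * k) (@Num.sqrt R)).
    exact: cvgMr_tmp u0.
  exact: sqrt_continuous.
have E0 : Num.sqrt (D n * B) + Num.sqrt (D' n * A) @[n --> \oo] --> 0.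
  by rewrite -[X in _ --> X]addr0; apply: cvgD; exact: sqrt0.
apply/cvgrPdist_le => e e0.
move/cvgrPdist_le : E0 => /(_ e e0) [N _ EN]; exists N => // n /= Nn.
have := EN n Nn; rewrite /= sub0r normrN ger0_norm ?addr_ge0//; apply: le_trans.
have LS := L2_horner (S n) s; have LS' := L2_horner (S' n) t.
have <- : \int[P]_w ((S n).[X s w] * (S' n).[X t w]) =
    \sum_(m < n) hermite_coef f s m * hermite_coef g t m * r s t ^+ m.
  exact: hermite_sum_cross.
have -> : \int[P]_w (f (X s w) * g (X t w)) - \int[P]_w ((S n).[X s w] * (S' n).[X t w]) =
    \int[P]_w ((f (X s w) - (S n).[X s w]) * g (X t w)) +
    \int[P]_w ((S n).[X s w] * (g (X t w) - (S' n).[X t w])).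
  rewrite -RintegralB; [|exact: measurableT|exact: L2M_integrable|exact: L2M_integrable].
  rewrite -RintegralD; [|exact: measurableT|exact: (L2M_integrable (L2B Lf LS) Lg)|
    exact: (L2M_integrable LS (L2B Lg LS'))].
  by apply: eq_Rintegral => w _; ring.
apply: le_trans (ler_normD _ _) _; apply: lerD.
  exact: (cauchy_schwarz_Rintegral (L2B Lf LS) Lg).
apply: le_trans (cauchy_schwarz_Rintegral LS (L2B Lg LS')) _.
rewrite ler_sqrt ?mulr_ge0 ?Rintegral_sqr_ge0// mulrC ler_wpM2l ?Rintegral_sqr_ge0//.
have rss : r s s = 1 by rewrite /r -(EX2 s).
rewrite Rintegral_sqrE hermite_sum_cross.
have := hermite_sum_distance (hermite_coef f s) n Lf.
rewrite [X in _ + X]big1 ?addr0; last by move=> m _; rewrite subrr expr0n.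
move=> h; rewrite -subr_ge0; have := Rintegral_sqr_ge0 P (fun w => f (X s w) - (S n).[X s w]).
rewrite h; congr (0 <= _ - _); apply: eq_bigr => m _.
by rewrite rss expr1n mulr1.
Qed.

End hermite_expansion.

(** * Upper bounds for Schur multipliers *)

Section Schur_upper.
Context d (T : measurableType d) (R : realType).
Variable nu : {sigma_finite_measure set T -> \bar R}.

Lemma ae_integrable_opN (K : T -> T -> R) (h : T -> R) :
  ae_integrable_op nu K h -> ae_integrable_op nu (fun s t => - K s t) h.
Proof.
apply: filterS => t it; have := integrableZl measurableT (-1) it.
by apply: eq_integrable => // s _; rewrite -EFinM mulN1r mulNr.
Qed.

Lemma ae_apply_opN (K : T -> T -> R) (h : T -> R) : ae_integrable_op nu K h ->
  {ae nu, forall t, apply_op nu (fun s t => - K s t) h t = - apply_op nu K h t}.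
Proof.
apply: filterS => t it; rewrite /apply_op -mulN1r -(RintegralZl _ measurableT it).
by apply: eq_Rintegral => s _; rewrite mulN1r mulNr.
Qed.

Lemma bilinear_formN (K : T -> T -> R) (h : T -> R) :
  measurable_fun setT (fun p : T * T => K p.1 p.2) -> L2 nu h ->
  (forall s t, K s t = K t s) -> ae_integrable_op nu K h ->
  L2 nu (apply_op nu K h) ->
  (\int[nu]_t \int[nu]_s (- K s t * h s * h t)%:E =
   - \int[nu]_t \int[nu]_s (K s t * h s * h t)%:E)%E.
Proof.
move=> mK Lh sK iK LK; rewrite (bilinear_formE mK Lh.1 sK iK).
have mNK : measurable_fun setT (fun p : T * T => - K p.1 p.2).
  exact: (measurableT_comp (@oppr_measurable R setT) mK).
rewrite (bilinear_formE mNK Lh.1); last 2 first.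
- by move=> s t; rewrite sK.
- exact: ae_integrable_opN.
have i := L2M_integrable Lh LK.
rewrite -mulN1e -[RHS](integralZl measurableT i (-1)).
apply: ae_eq_integral => //.
- apply/measurable_EFinP/measurable_funM; first exact: Lh.1.
  by apply: measurable_apply_op mNK _; exact: Lh.1.
- apply: measurable_int; exact: (integrableZl measurableT (-1) i).
- apply: filterS (ae_apply_opN iK) => t -> _.
  by rewrite -EFinM mulN1r mulrN.
Qed.

(** The lower bound is applied to the negated kernel and [- lambda]; negating the kernel negates the
    form. *)
Lemma Schur_form_upper (K : T -> T -> R) (C : R)
    (mu : {finite_measure set T -> \bar R}) (G : T -> T -> R) (lambda : R) :
  measurable_fun setT (fun p : T * T => K p.1 p.2) ->
  (forall s t, K s t = K t s) ->
  (forall h, L2 nu h -> ae_integrable_op nu K h) ->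
  (forall h, L2 nu h -> (sqint nu (apply_op nu K h) <= C%:E * sqint nu h)%E) ->
  0 <= C ->
  (forall A, measurable A -> mu A = 0%E -> nu A = 0%E) ->
  psd G -> (forall t, G t t = 1) ->
  measurable_fun setT (fun p : T * T => G p.1 p.2) ->
  (forall g, L2_sphere nu g ->
    (\int[nu]_t \int[nu]_s (K s t * g s * g t)%:E <= lambda%:E)%E) ->
  forall h, L2_sphere nu h ->
    (\int[nu]_t \int[nu]_s (K s t * G s t * h s * h t)%:E <= lambda%:E)%E.
Proof.
move=> mK sK iK bK C0 mu_nu pG G1 mG Hl h Sh; have Lh := L2_sphere_L2 Sh.
pose N s t := - K s t.
have mN : measurable_fun setT (fun p : T * T => N p.1 p.2).
  exact: (measurableT_comp (@oppr_measurable R setT) mK).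
have sN s t : N s t = N t s by rewrite /N sK.
have iN g : L2 nu g -> ae_integrable_op nu N g.
  by move=> /iK; exact: ae_integrable_opN.
have bN g : L2 nu g -> (sqint nu (apply_op nu N g) <= C%:E * sqint nu g)%E.
  move=> Lg; apply: le_trans (bK _ Lg).
  rewrite le_eqVlt; apply/orP; left; apply/eqP; apply: ae_eq_integral => //.
  - by apply/measurable_EFinP/measurable_funX/measurable_apply_op => //; exact: Lg.1.
  - by apply/measurable_EFinP/measurable_funX/measurable_apply_op => //; exact: Lg.1.
  - by apply: filterS (ae_apply_opN (iK _ Lg)) => t -> _; rewrite sqrrN.
have G_le1 s t : `|G s t| <= 1 by exact: psd_norm_le1.
have lower g : L2_sphere nu g ->
    ((- lambda)%:E <= \int[nu]_t \int[nu]_s (N s t * g s * g t)%:E)%E.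
  move=> Sg; have Lg := L2_sphere_L2 Sg.
  rewrite (bilinear_formN mK Lg sK (iK _ Lg) (L2_apply_op mK bK C0 Lg)).
  by rewrite EFinN leeN2; exact: Hl.
have := Schur_form_lower mN sN iN bN C0 mu_nu pG G1 mG lower Sh.
have mNG : measurable_fun setT (fun p : T * T => N p.1 p.2 * G p.1 p.2).
  exact: measurable_funM.
have [LNG _] := Schur_multiplier_lower mN iN bN C0 (sphere_lower_bound mN sN iN bN C0 lower)
  mu_nu pG G1 mG Lh.
have iNG := Schur_integrable mN iN mG G_le1 Lh.
have sNG s t : N s t * G s t = N t s * G t s by rewrite sN pG.1.
have := bilinear_formN mNG Lh sNG iNG LNG.
under eq_integral do under eq_integral do rewrite -mulNr opprK.
move=> ->; by rewrite EFinN leeNl.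
Qed.

End Schur_upper.

(** * Extreme correlations of a Gaussian process *)

Section centered_correlation.
Context d (Omega : measurableType d) (R : realType) (P : probability Omega R).

Lemma fine_expectation (U : Omega -> R) : fine 'E_P[U] = \int[P]_w U w.
Proof. by rewrite unlock. Qed.

Lemma covariance_centered (U V : Omega -> R) :
  ('E_P[U] = 0 -> 'E_P[V] = 0 -> covariance P U V = \int[P]_w (U w * V w)%:E)%E.
Proof.
move=> EU EV; rewrite unlock EU EV unlock.
by apply: eq_integral => w _; rewrite !fctE /= !subr0.
Qed.

Lemma correlation_centered (U V : Omega -> R) :
  ('E_P[U] = 0)%E -> ('E_P[V] = 0)%E ->
  correlation P U V = \int[P]_w (U w * V w) /
    (Num.sqrt (\int[P]_w U w ^+ 2) * Num.sqrt (\int[P]_w V w ^+ 2)).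
Proof.
by move=> EU EV; rewrite /correlation /variance !covariance_centered.
Qed.

End centered_correlation.

Section gaussian_process.
Context {dT : measure_display} (T : measurableType dT).
Context {d : measure_display} (Omega : measurableType d) (R : realType).
Variables (nu : {sigma_finite_measure set T -> \bar R}) (P : probability Omega R).
Variables (X : T -> {RV P >-> R}) (W : T -> T -> R).
Hypothesis X_gaussian : forall s t : T, bivariate_gaussian (X s) (X t).
Hypothesis X_regular : regular_process nu X W.

Let Xf (t : T) : Omega -> R := X t.
Let r s t := \int[P]_w (Xf s w * Xf t w).
Let K s t := r s t * W s t.

Let mX t : measurable_fun setT (Xf t).
Proof. exact: measurable_funPT. Qed.

Let EX t : \int[P]_w Xf t w = 0.
Proof. by rewrite -fine_expectation (rp_mean X_regular). Qed.

Let EX2 t : \int[P]_w Xf t w ^+ 2 = 1.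
Proof. by rewrite -fine_expectation (rp_moment2 X_regular). Qed.

Let gX s t (a b : R) : gaussian_rv P (fun w => a * Xf s w + b * Xf t w).
Proof. exact: X_gaussian. Qed.

Let L2X t : L2 P (Xf t).
Proof.
split; first exact: mX.
by have := rp_moment2 X_regular t; rewrite unlock /sqint => ->; rewrite ltry.
Qed.

Let gX1 t : gaussian_rv P (Xf t).
Proof.
have := gX t t 1 0; congr gaussian_rv.
by apply/funext => w; rewrite mul1r mul0r addr0.
Qed.

Let X_exp t := gaussian_exp_integrable (mX t) (gX1 t).

(** The moments do not depend on [t], which makes those of a linear family measurable in [t]. *)
Let X_moment t (k : nat) : \int[P]_w Xf t w ^+ k = k`!%:R * gauss_coef 1 k.
Proof.
elim/ltn_ind: k => -[|[|k]] IH.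
- have P1 : fine (P setT) = 1 by rewrite probability_setT.
  by rewrite Rintegral_cst// [fine _]P1 /gauss_coef /= expr0 mulr1 divr1 mulr1.
- under eq_Rintegral do rewrite expr1.
  by rewrite EX /gauss_coef /= !mul0r mulr0.
- rewrite centered_gaussian_moments// EX2 mulr1 IH//.
  by rewrite gauss_coef_recursion mulr1.
Qed.

Let rtt t : r t t = 1. Proof. exact: EX2. Qed.

Let covariance_psd : psd r.
Proof.
split=> [s t|l]; first by apply: eq_Rintegral => w _; rewrite mulrC.
have i0 (p q : R * T) : P.-integrable setT
    (EFin \o (fun w => p.1 * q.1 * (Xf p.2 w * Xf q.2 w))).
  exact: (integrableZl measurableT (p.1 * q.1) (L2M_integrable (L2X p.2) (L2X q.2))).
have -> : \sum_(p <- l) \sum_(q <- l) p.1 * q.1 * r p.2 q.2 =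
    \int[P]_w (\sum_(p <- l) p.1 * Xf p.2 w) ^+ 2.
  transitivity (\int[P]_w \sum_(p <- l) \sum_(q <- l) p.1 * q.1 * (Xf p.2 w * Xf q.2 w)).
    rewrite (@Rintegral_sum _ _ _ P _ l (fun p w =>
      \sum_(q <- l) p.1 * q.1 * (Xf p.2 w * Xf q.2 w))).
      apply: eq_bigr => p _.
      rewrite (@Rintegral_sum _ _ _ P _ l (fun q w =>
        p.1 * q.1 * (Xf p.2 w * Xf q.2 w))) => [|q]; last exact: i0.
      apply: eq_bigr => q _.
      by rewrite (RintegralZl _ measurableT (L2M_integrable (L2X p.2) (L2X q.2))).
    move=> p; rewrite (_ : EFin \o _ = fun w => (\sum_(q <- l)
        (p.1 * q.1 * (Xf p.2 w * Xf q.2 w))%:E)%E).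
      by apply: integrable_sum => // q _; exact: i0.
    by apply/funext => w /=; rewrite sumEFin.
  apply: eq_Rintegral => w _; rewrite expr2 mulr_suml; apply: eq_bigr => p _.
  by rewrite mulr_sumr; apply: eq_bigr => q _; ring.
exact: Rintegral_sqr_ge0.
Qed.

Let fineE s t : fine 'E_P[fun w => X s w * X t w] = r s t.
Proof. exact: fine_expectation. Qed.

Let m_r : measurable_fun setT (fun p : T * T => r p.1 p.2).
Proof.
under eq_fun do rewrite -fineE.
by apply: measurableT_comp; [exact: fine_measurable|exact: rp_meas_moment X_regular].
Qed.

Let mK : measurable_fun setT (fun p : T * T => K p.1 p.2).
Proof. by apply: measurable_funM => //; exact: rp_meas_weight X_regular. Qed.

Let K_sym s t : K s t = K t s.
Proof. by rewrite /K covariance_psd.1 (rp_weight_sym X_regular). Qed.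

Let K_bounded : bounded_kernel_operator nu K.
Proof.
have := rp_bounded X_regular; congr bounded_kernel_operator.
by apply/funext => s; apply/funext => t; rewrite fineE.
Qed.

Let linear_formE (h : T -> R) : linear_form nu X W h =
  (\int[nu]_t \int[nu]_s (K s t * h s * h t)%:E)%E.
Proof.
apply: eq_integral => t _; apply: eq_integral => s _.
rewrite (correlation_centered (rp_mean X_regular s) (rp_mean X_regular t)) //.
by rewrite !EX2 sqrtr1 mulr1 divr1.
Qed.

Section nonlinear.
Variable f : T -> R -> R.
Hypothesis f_admissible : admissible_family nu X W f.

(** Kept extended-valued because admissibility lets [M t] be infinite on a null set; there [Mf t] is
    the default value 0. *)
Let M t : \bar R := 'E_P[fun w => f t (X t w) ^+ 2].
Let Mf t : R := \int[P]_w f t (Xf t w) ^+ 2.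

Let L2f t : (M t < +oo)%E -> L2 P (fun w => f t (Xf t w)).
Proof.
move=> Mt; split; first by apply: measurableT_comp; [exact: af_meas f_admissible t|exact: mX].
by move: Mt; rewrite /M unlock.
Qed.

Let M_eq t : (M t < +oo)%E -> M t = (Mf t)%:E.
Proof. by move=> Mt; rewrite /M unlock -(L2_sqintE (L2f Mt)). Qed.

Let Mf_gt0 t : (M t < +oo)%E -> 0 < Mf t.
Proof. by move=> Mt; rewrite -lte_fin -M_eq//; exact: af_moment2_gt0 f_admissible t. Qed.

Let coef t m := hermite_coef P Xf (f t) t m.

Let coef0 t : coef t 0 = 0.
Proof.
transitivity (fine 'E_P[fun w => f t (X t w)]); last by rewrite (af_mean f_admissible).
rewrite fine_expectation; apply: eq_Rintegral => w _.
by rewrite /hermite1 /= fact0 sqrtr1 invr1 scale1r hornerC mul1r.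
Qed.

(* On the null set where [f t (X t)] is not square integrable, the sequence
   is replaced by that of the identity function. *)
Let alpha (m : nat) t : R :=
  if (M t < +oo)%E then coef t m.+1 / Num.sqrt (Mf t) else (m == 0%N)%:R.

(** Parseval's identity divided by [Mf t], with indices shifted by one because [coef t 0] vanishes.
    On the exceptional set the first term alone is 1. *)
Let alpha_sqr_sum t : \sum_(m < n) alpha m t ^+ 2 @[n --> \oo] --> (1 : R).
Proof.
have [Mt|Mt] := boolP (M t < +oo)%E; last first.
  apply: cvg_near_cst; exists 1%N => // -[//|n] _ /=.
  rewrite big_ord_recl /alpha (negbTE Mt) big1 ?addr0 ?expr1n// => i _.
  by rewrite expr0n.
have M0 := Mf_gt0 Mt.
have h := hermite_parseval mX gX EX EX2 (af_meas f_admissible t) (L2f Mt).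
have := @cvgMr_tmp R nat \oo _ _ _ (Mf t)^-1 h; rewrite divff ?gt_eqF//.
move=> /(_ _); rewrite -cvg_shiftS; apply: cvg_trans; apply: near_eq_cvg; apply: nearW => n.
rewrite /= big_ord_recl -/(coef t 0) coef0 expr0n add0r mulr_suml.
apply: eq_bigr => m _; by rewrite /alpha Mt expr_div_n sqr_sqrtr//; exact: ltW.
Qed.

Let Gn n s t := \sum_(m < n) alpha m s * alpha m t * r s t ^+ m.
Let G s t := lim (Gn n s t @[n --> \oo]).

Let r_le1 s t : `|r s t| <= 1.
Proof. exact: psd_norm_le1 covariance_psd rtt. Qed.

(** Absolute convergence: powers of [r] have modulus at most 1, and [|x * y|] is at most
    [(x ^+ 2 + y ^+ 2) / 2]. *)
Let Gn_cvg s t : Gn n s t @[n --> \oo] --> G s t.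
Proof.
pose u m := alpha m s * alpha m t * r s t ^+ m.
have Gu : Gn ^~ s ^~ t = series u.
  by apply/funext => n; rewrite /Gn /series /= big_mkord.
suff c : cvgn (series u) by rewrite -Gu in c.
apply: normed_cvg.
have [l hl] : exists l : R, series (fun m => (alpha m s ^+ 2 + alpha m t ^+ 2) / 2) @ \oo --> l.
  exists ((1 + 1) / 2).
  have := @cvgMr_tmp R nat \oo _ _ _ 2^-1 (cvgD (@alpha_sqr_sum s) (@alpha_sqr_sum t)).
  move=> /(_ _ _); apply: cvg_trans; apply: near_eq_cvg; apply: nearW => n.
  by rewrite /series /= big_mkord -mulr_suml big_split.
apply: (series_le_cvg _ _ _ (cvgP l hl)) => m.
- exact: normr_ge0.
- by rewrite divr_ge0// addr_ge0// sqr_ge0.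
- rewrite /= /u normrM normrX.
  apply: (@le_trans _ _ (`|alpha m s * alpha m t|)).
    by rewrite ler_piMr// exprn_ile1.
  rewrite normrM -(real_normK (num_real (alpha m s))) -(real_normK (num_real (alpha m t))).
  by have := sqr_ge0 (`|alpha m s| - `|alpha m t|); lra.
Qed.

Let pG : psd G.
Proof.
apply: (@psd_cvg R T Gn) => [n|]; last exact: Gn_cvg.
apply: (psd_sum (G := fun m s t => alpha m s * alpha m t * r s t ^+ m)) => m.
apply: (@psdM R T (fun s t => alpha m s * alpha m t)); first exact: psd_rank1.
exact: psd_exp covariance_psd.
Qed.

Let G1 t : G t t = 1.
Proof.
apply: (cvg_unique _ (@Gn_cvg t t)) => //.
have := @alpha_sqr_sum t; apply: cvg_trans; apply: near_eq_cvg; apply: nearW => n.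
by apply: eq_bigr => m _; rewrite rtt expr1n mulr1 expr2.
Qed.

Let mM : measurable_fun setT M.
Proof. exact: measurable_int (af_moment2_int f_admissible). Qed.

Let m_moment (k : nat) :
  measurable_fun setT (fun t => fine 'E_P[fun w => X t w ^+ k * f t (X t w)]).
Proof.
apply: measurableT_comp; first exact: fine_measurable.
(* Admissibility concerns exponents at least 1; for exponent 0 the moment is the mean, which is
   0. *)
case: k => [|k]; last exact: (af_meas_moment f_admissible).
rewrite (_ : (fun t => _) = cst 0%E)//.
apply/funext => t; rewrite -(af_mean f_admissible t); congr expectation.
by apply/funext => w; rewrite expr0 mul1r.
Qed.

Let coef_moment t m : (M t < +oo)%E -> coef t m =
  \sum_(k < size (hermite1 R m)) (hermite1 R m)`_k *
    fine 'E_P[fun w => X t w ^+ k * f t (X t w)].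
Proof.
move=> Mt; have Lf := L2f Mt.
have LX k : L2 P (fun w => Xf t w ^+ k).
  exact: (exp_bounded_L2 (mX t) (X_exp t) (exp_bounded_exprn R k)).
have i0 k := L2M_integrable (LX k) Lf.
rewrite /coef /hermite_coef (_ : \int[P]_w _ = \int[P]_w \sum_(k < size (hermite1 R m))
    (hermite1 R m)`_k * (Xf t w ^+ k * f t (Xf t w))); last first.
  apply: eq_Rintegral => w _; rewrite horner_coef mulr_suml.
  by apply: eq_bigr => k _; rewrite mulrA.
rewrite (@Rintegral_sum _ _ _ P _ (index_enum 'I_(size (hermite1 R m)))
  (fun k w => (hermite1 R m)`_k * (Xf t w ^+ k * f t (Xf t w)))).
  apply: eq_bigr => k _; rewrite (RintegralZl _ measurableT (i0 k)).
  by rewrite fine_expectation.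
by move=> k; exact: (integrableZl measurableT _ (i0 k)).
Qed.

(** A Hermite coefficient is a finite combination of moments of [f t (X t)] against powers of [X t],
    measurable in [t] by admissibility. Measurability of [G] is obtained in this way and not by
    dividing the correlation by [r], which may vanish. *)
Let m_alpha m : measurable_fun setT (alpha m).
Proof.
pose c t := \sum_(k < size (hermite1 R m.+1)) (hermite1 R m.+1)`_k *
    fine 'E_P[fun w => X t w ^+ k * f t (X t w)].
rewrite (_ : alpha m = fun t => if (M t < +oo)%E then c t * (fine (M t)) `^ (- 2^-1)
    else (m == 0%N)%:R); last first.
  apply/funext => t; rewrite /alpha; case: ifPn => // Mt.
  by rewrite coef_moment// powRN powR12_sqrt M_eq// ltW// Mf_gt0.
apply: measurable_fun_ifT => //.
- apply: measurable_fun_lte => //; exact: measurable_cst.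
- apply: measurable_funM.
    by apply: measurable_sum => k; apply: measurable_funM.
  apply: (measurableT_comp (@measurable_powR R (- 2^-1))).
  by apply: measurableT_comp; [exact: fine_measurable|exact: mM].
Qed.

Let mG : measurable_fun setT (fun p : T * T => G p.1 p.2).
Proof.
apply: (@measurable_fun_cvg _ _ _ setT (fun n (p : T * T) => Gn n p.1 p.2)) => [n|p _].
  apply: measurable_sum => m; apply: measurable_funM; last exact: measurable_funX.
  apply: measurable_funM.
  - exact: (measurableT_comp (m_alpha m) (@measurable_fst _ _ T T)).
  - exact: (measurableT_comp (m_alpha m) (@measurable_snd _ _ T T)).
exact: Gn_cvg.
Qed.

(** Mehler's series divided by the norms: its term of index 0 vanishes, and one factor [r s t] is
    taken out of all the others. *)
Let correlationE s t : (M s < +oo)%E -> (M t < +oo)%E ->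
  correlation P (f s \o X s) (f t \o X t) = r s t * G s t.
Proof.
move=> Ms Mt.
rewrite (correlation_centered (af_mean f_admissible s) (af_mean f_admissible t)).
have h := mehler mX gX EX EX2 (af_meas f_admissible s) (af_meas f_admissible t)
  (L2f Ms) (L2f Mt).
have c1 := @cvgMr_tmp R nat \oo eventually_filter _ _ (Num.sqrt (Mf s) * Num.sqrt (Mf t))^-1 h.
have c2 := @cvgMl_tmp R nat \oo eventually_filter _ (r s t) _ (@Gn_cvg s t).
rewrite -cvg_shiftS in c1; apply: (cvg_unique _ c1) => //.
apply: cvg_trans c2; apply: near_eq_cvg; apply: nearW => n.
rewrite /= big_ord_recl -/(coef s 0) coef0 !mul0r add0r mulr_suml mulr_sumr.
apply: eq_bigr => m _; rewrite /alpha Ms Mt exprS invfM.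
rewrite /coef /bump /= -/(r s t).
by ring.
Qed.

Let ae_finite : {ae nu, forall t, (M t < +oo)%E}.
Proof.
apply: filterS (integrable_ae measurableT (af_moment2_int f_admissible)) => t /(_ Logic.I).
by rewrite -/(M t) ltey_eq => ->.
Qed.

(** [correlationE] can fail only for [s] or [t] in a null set, which is discarded in each of the two
    integrals in turn. *)
Let nonlinear_formE (h : T -> R) : measurable_fun setT h ->
  nonlinear_form nu X W f h =
  (\int[nu]_t \int[nu]_s (K s t * G s t * h s * h t)%:E)%E.
Proof.
move=> mh.
have mfst := measurableT_comp mh (@measurable_fst _ _ T T).
have msnd := measurableT_comp mh (@measurable_snd _ _ T T).
have m1 : measurable_fun setT (fun p : T * T =>
    correlation P (f p.1 \o X p.1) (f p.2 \o X p.2) * W p.1 p.2 * h p.1 * h p.2).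
  apply: measurable_funM => //; apply: measurable_funM => //.
  exact: af_meas_kernel f_admissible.
have m2 : measurable_fun setT (fun p : T * T => K p.1 p.2 * G p.1 p.2 * h p.1 * h p.2).
  by apply: measurable_funM => //; apply: measurable_funM => //; exact: measurable_funM.
have swap (g : T * T -> R) : measurable_fun setT g ->
    measurable_fun setT (fun p : T * T => g (p.2, p.1)).
  by move=> mg; exact: (measurableT_comp mg (@measurable_swap _ _ T T)).
apply: ae_eq_integral => //.
- exact: (measurable_section_integral nu (swap _ m1)).
- exact: (measurable_section_integral nu (swap _ m2)).
apply: filterS ae_finite => t Mt _; apply: ae_eq_integral => //.
- by apply/measurable_EFinP; exact: (measurableT_comp m1 (pair2_measurable t)).
- by apply/measurable_EFinP; exact: (measurableT_comp m2 (pair2_measurable t)).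
apply: filterS ae_finite => s Ms _; congr EFin.
by rewrite /comp -/(f s \o X s) -/(f t \o X t) correlationE// /K; ring.
Qed.

Variable mu : {finite_measure set T -> \bar R}.
Hypothesis mu_nu : forall A, measurable A -> mu A = 0%E -> nu A = 0%E.

Lemma nonlinear_form_lower (lambda : R) :
  (forall g, L2_sphere nu g -> (lambda%:E <= linear_form nu X W g)%E) ->
  forall h, L2_sphere nu h -> (lambda%:E <= nonlinear_form nu X W f h)%E.
Proof.
move=> Hl h Sh; have [C [C0 iK bK]] := bounded_kernel_operator_L2 mK K_bounded.
rewrite nonlinear_formE; last exact: Sh.1.
apply: (Schur_form_lower mK K_sym iK bK C0 mu_nu pG G1 mG _ Sh) => g Sg.
by rewrite -linear_formE; exact: Hl.
Qed.

Lemma nonlinear_form_upper (lambda : R) :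
  (forall g, L2_sphere nu g -> (linear_form nu X W g <= lambda%:E)%E) ->
  forall h, L2_sphere nu h -> (nonlinear_form nu X W f h <= lambda%:E)%E.
Proof.
move=> Hl h Sh; have [C [C0 iK bK]] := bounded_kernel_operator_L2 mK K_bounded.
rewrite nonlinear_formE; last exact: Sh.1.
apply: (Schur_form_upper mK K_sym iK bK C0 mu_nu pG G1 mG _ Sh) => g Sg.
by rewrite -linear_formE; exact: Hl.
Qed.

End nonlinear.
(** As soon as the sphere has a point, this excludes -oo as supremum and +oo as infimum. *)
Lemma linear_form_fin_num (h : T -> R) : L2_sphere nu h ->
  linear_form nu X W h \is a fin_num.
Proof.
move=> Sh; have [C [C0 iK bK]] := bounded_kernel_operator_L2 mK K_bounded.
by rewrite linear_formE (form_EFin mK K_sym iK bK C0 (L2_sphere_L2 Sh)).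
Qed.

Section linear_family.
Variable c : T -> R.
Hypotheses (mc : measurable_fun setT c) (c_gt0 : forall t, 0 < c t).
Hypothesis c_int : nu.-integrable setT (fun t => (c t ^+ 2)%:E).

Let expect_scaled t (k : nat) :
  'E_P[fun w => (X t w ^+ k * (c t * X t w))%R]%E =
  (c t * (k.+1`!%:R * gauss_coef 1 k.+1))%:E.
Proof.
have iX : P.-integrable setT (EFin \o (fun w => Xf t w ^+ k.+1)).
  exact: (exp_bounded_integrable (mX t) (X_exp t) (exp_bounded_exprn R k.+1)).
rewrite -(X_moment t) -(RintegralZl (c t) measurableT iX) unlock /Rintegral fineK.
  by apply: eq_integral => w _; rewrite mulrCA exprSr.
exact: (integrable_fin_num measurableT (integrableZl measurableT (c t) iX)).
Qed.

Let expect_scaled_mean t : 'E_P[fun w => (c t * X t w)%R]%E = 0%E.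
Proof.
transitivity ('E_P[fun w => (X t w ^+ 0 * (c t * X t w))%R]%E).
  by congr expectation; apply/funext => w; rewrite expr0 mul1r.
by rewrite expect_scaled /gauss_coef /= !mul0r !mulr0.
Qed.

Let expect_scaled_sqr t : 'E_P[fun w => ((c t * X t w) ^+ 2)%R]%E = (c t ^+ 2)%:E.
Proof.
have iX := L2_sqr_integrable (L2X t).
transitivity ((c t ^+ 2)%:E * \int[P]_w (Xf t w ^+ 2)%:E)%E.
  rewrite -(integralZl measurableT iX) unlock.
  by apply: eq_integral => w _; rewrite exprMn.
by have := rp_moment2 X_regular t; rewrite unlock => ->; rewrite mule1.
Qed.

Let correlation_scaled s t :
  correlation P (fun w => c s * X s w) (fun w => c t * X t w) =
  correlation P (X s) (X t).
Proof.
rewrite (correlation_centered (expect_scaled_mean s) (expect_scaled_mean t)).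
rewrite (correlation_centered (rp_mean X_regular s) (rp_mean X_regular t)).
rewrite !EX2 sqrtr1 mulr1 divr1.
have sq u : \int[P]_w (c u * X u w) ^+ 2 = c u ^+ 2.
  by rewrite -fine_expectation expect_scaled_sqr.
rewrite !sq !sqrtr_sqr !ger0_norm ?ltW//.
rewrite (_ : \int[P]_w _ = \int[P]_w (c s * c t * (Xf s w * Xf t w))); last first.
  by apply: eq_Rintegral => w _; rewrite mulrACA.
rewrite (RintegralZl _ measurableT (L2M_integrable (L2X s) (L2X t))).
by rewrite mulrAC divff ?mul1r// mulf_neq0// gt_eqF.
Qed.

Lemma linear_family_admissible : admissible_family nu X W (fun t x => c t * x).
Proof.
split.
- by move=> t; exact: measurable_funM.
- exact: expect_scaled_mean.
- by move=> t; rewrite expect_scaled_sqr lte_fin exprn_gt0.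
- by under eq_fun do rewrite expect_scaled_sqr.
- move=> m _; under eq_fun do rewrite expect_scaled.
  by apply/measurable_EFinP; exact: measurable_funM.
- under eq_fun do rewrite [correlation _ _ _]correlation_scaled.
  move: mK; congr measurable_fun; apply/funext => p; congr (_ * _).
  rewrite (correlation_centered (rp_mean X_regular p.1) (rp_mean X_regular p.2)).
  by rewrite !EX2 sqrtr1 mulr1 divr1.
Qed.

Lemma linear_family_form (h : T -> R) :
  nonlinear_form nu X W (fun t x => c t * x) h = linear_form nu X W h.
Proof.
apply: eq_integral => t _; apply: eq_integral => s _.
by rewrite [correlation _ _ _]correlation_scaled.
Qed.

End linear_family.

(** The family of identity functions may fail to be admissible: its second moments integrate to the
    total mass of [nu], possibly infinite. Taking for [c] the square root of an integrable positive
    function repairs this and leaves correlations unchanged. *)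
Lemma linear_family_exists : exists f, admissible_family nu X W f /\
  forall h, nonlinear_form nu X W f h = linear_form nu X W h.
Proof.
have [B [mB _ B_cover B_fin _]] := rp_exhaustion X_regular.
have [phi [mphi phi0 iphi]] := exists_positive_integrable mB B_fin B_cover.
pose c t := Num.sqrt (phi t).
have c0 t : 0 < c t by rewrite sqrtr_gt0.
have mc : measurable_fun setT c.
  rewrite (_ : c = fun t => phi t `^ 2^-1); last first.
    by apply/funext => t; rewrite powR12_sqrt// ltW.
  exact: (measurableT_comp (@measurable_powR R 2^-1) mphi).
have ic : nu.-integrable setT (fun t => (c t ^+ 2)%:E).
  by apply: eq_integrable iphi => // t _; rewrite /= sqr_sqrtr// ltW.
exists (fun t x => c t * x); split; first exact: linear_family_admissible.
exact: linear_family_form.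
Qed.

End gaussian_process.

(** The theorem is about a bare measure; sigma-finiteness, which follows from the exhaustion, is
    packaged so that the new structure coerces to [nu] itself. *)
Lemma sigma_finite_measureP d (T : measurableType d) (R : realType)
    (nu : {measure set T -> \bar R}) : sigma_finite setT nu ->
  exists nu' : {sigma_finite_measure set T -> \bar R},
    (nu' : {measure set T -> \bar R}) = nu.
Proof.
case: nu => m c m_sf.
pose sf := Measure_isSigmaFinite.Build _ _ _ (Measure.Pack c) m_sf.
pose nu' : {sigma_finite_measure set T -> \bar R} := HB.pack m (Measure.Pack c) sf.
by exists nu'.
Qed.

Theorem theorem1 (R : realType)
  (dT : measure_display) (T : measurableType dT)
  (nu : {measure set T -> \bar R})
  (d : measure_display) (Omega : measurableType d) (P : probability Omega R)
  (X : T -> {RV P >-> R}) (W : T -> T -> R)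
  (pairwise_gaussian : forall s t : T, bivariate_gaussian (X s) (X t))
  (regular : regular_process nu X W) :
  rhoNL_max nu X W = rhoL_max nu X W /\
  rhoNL_min nu X W = rhoL_min nu X W.
Proof.
have [B [mB B_incr B_cover B_fin _]] := rp_exhaustion regular.
have nu_sf : sigma_finite setT nu by exists B => // n; split.
have [nu' nuE] := sigma_finite_measureP nu_sf.
case: _ / nuE in regular mB B_incr B_cover B_fin nu_sf *.
have [mu mu_nu] := exists_dominating_finite_measure mB B_fin B_cover.
have [f0 [af0 f0E]] := @linear_family_exists _ _ _ _ _ nu' _ _ _ pairwise_gaussian regular.
have lin_fin := @linear_form_fin_num _ _ _ _ _ nu' _ _ _ regular.
have lower f af := @nonlinear_form_lower _ _ _ _ _ nu' _ _ _ pairwise_gaussian regular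
  f af mu mu_nu.
have upper f af := @nonlinear_form_upper _ _ _ _ _ nu' _ _ _ pairwise_gaussian regular
  f af mu mu_nu.
have f0_image : [set nonlinear_form nu' X W f0 h | h in L2_sphere nu'] =
    [set linear_form nu' X W h | h in L2_sphere nu'].
  apply/seteqP; split => _ [h Sh <-]; exists h; [exact: Sh|exact/esym/f0E|exact: Sh|exact: f0E].
split; apply/eqP; rewrite eq_le; apply/andP; split.
- apply: ge_ereal_sup => _ [f af <-]; apply: ge_ereal_sup => _ [h Sh <-].
  have le_sup g : L2_sphere nu' g -> (linear_form nu' X W g <= rhoL_max nu' X W)%E.
    by move=> Sg; apply: ereal_sup_ubound; exists g.
  (* The bounds on nonlinear forms take a real [lambda]. The value +oo is trivial, and -oo is
     impossible because the linear form at [h] is finite. *)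
  move: le_sup; case: (rhoL_max nu' X W) => [l| |] le_sup.
  + exact: (upper f af l le_sup h Sh).
  + by rewrite leey.
  + by have := le_sup h Sh; have := lin_fin h Sh; case: (linear_form _ _ _ _).
- apply: ereal_sup_ubound; exists f0; [exact: af0|exact: congr1 f0_image].
- apply: ereal_inf_lbound; exists f0; [exact: af0|exact: congr1 f0_image].
- apply: le_ereal_inf_tmp => _ [f af <-]; apply: le_ereal_inf_tmp => _ [h Sh <-].
  have ge_inf g : L2_sphere nu' g -> (rhoL_min nu' X W <= linear_form nu' X W g)%E.
    by move=> Sg; apply: ereal_inf_lbound; exists g.
  move: ge_inf; case: (rhoL_min nu' X W) => [l| |] ge_inf.
  + exact: (lower f af l ge_inf h Sh).
  + by have := ge_inf h Sh; have := lin_fin h Sh; case: (linear_form _ _ _ _).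
  + by rewrite leNye.
Qed.
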